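(* For $\alpha,\beta\ge0$ put $w_{\alpha,\beta}(a,b):=(a+1)^{-\alpha}(b+1)^{-\beta}$ for $a,b\in\mathbb N$. In each of the two settings (bi-parameter and Zygmund) described in the context, there is a finite constant $C$ such that $\sum_{I\in\mathcal U}w_{\alpha,\beta}(e_1(I;\Omega),e_2(I;\Omega))|I|\le C|\Omega|$ for all admissible pairs $(\Omega,\mathcal U)$ if and only if $$\alpha+\beta\ge1\quad\text{and}\quad(\alpha,\beta)\notin\{(1,0),(0,1)\}.$$ In particular, let $0<s<1$ and $w_s:=w_{s,1-s}$, with $W_s(I;\Omega):=w_s(e_1(I;\Omega),e_2(I;\Omega))$ and $H_s:=\sum_{I\in\mathcal U}W_s(I;\Omega)1_I$. Then in either setting, for every admissible pair $(\Omega,\mathcal U)$, one can choose a $1/8$-sparse subfamily $\mathcal G_0\subset\mathcal U$ such that $$\int_\Omega H_s(x)\,dx=\sum_{I\in\mathcal U}W_s(I;\Omega)|I|\le\frac{2560}{s(1-s)}|\operatorname{sh}(\mathcal G_0)|.$$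
   Context: $\mathbb N=\{0,1,2,\dots\}$; $|\cdot|$ is Lebesgue measure. Fix dyadic grids $\mathcal D^i$ of cubes in $\mathbb R^{d_i}$, $i=1,2,3$ (side lengths $2^k$, $k\in\mathbb Z$). $\ell(Q)$ is the side length of $Q$, and $Q^{(k)}$ is its $k$th dyadic ancestor (the cube of the same grid containing $Q$ with side length $2^k\ell(Q)$). For a collection $\mathcal B$ of rectangles, $M_{\mathcal B}f(x):=\sup_{R\in\mathcal B,\,x\in R}\frac1{|R|}\int_R|f|$. Bi-parameter setting: rectangles are $I=I^1\times I^2\in\mathcal D^1\times\mathcal D^2$. For $\Omega\subset\mathbb R^{d_1+d_2}$ measurable of finite measure, $\widetilde\Omega:=\{M_{\mathcal D^1\times\mathcal D^2}1_\Omega>1/2\}$. Zygmund setting: rectangles are the dyadic Zygmund rectangles $I=I^1\times I^2\times I^3$, $I^i\in\mathcal D^i$, with $\ell(I^3)=\ell(I^1)\ell(I^2)$. For $\Omega\subset\mathbb R^{d_1+d_2+d_3}$ measurable of finite measure, $\widetilde\Omega:=\{M_{\mathcal D_{\mathrm{sZ}}}1_\Omega>1/2\}$, where $\mathcal D_{\mathrm{sZ}}$ consists of all $I^1\times I^2\times I^3$, $I^i\in\mathcal D^i$, with $\ell(I^3)\le\ell(I^1)\ell(I^2)$. In both settings, for a rectangle $I\subset\Omega$ and $i=1,2$, $I_i^{(k)}$ is obtained from $I$ by replacing only $I^i$ by $(I^i)^{(k)}$, and $e_i(I;\Omega):=\max\{k\ge0: I_i^{(k)}\subset\widetilde\Omega\}$.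 In either setting, $(\Omega,\mathcal U)$ is an admissible pair if $\Omega$ is measurable with finite measure and $\mathcal U$ is a family of rectangles of that setting, all contained in $\Omega$, which is incomparable: no member is contained in a different member. $\operatorname{sh}(\mathcal G):=\bigcup_{I\in\mathcal G}I$. For $0<\eta\le1$, a family $\mathcal G$ is $\eta$-sparse if there are pairwise disjoint measurable sets $E_I\subset I$, $I\in\mathcal G$, with $|E_I|\ge\eta|I|$. *)

(* Defs.v *)
From HB Require Import structures.
From mathcomp Require Import all_boot all_order all_algebra.
From mathcomp Require Import all_classical all_reals all_analysis.

Set Implicit Arguments.
Unset Strict Implicit.
Unset Printing Implicit Defensive.

Import Order.TTheory GRing.Theory Num.Theory.

Local Open Scope classical_set_scope.
Local Open Scope ring_scope.

(* n.-tuple and product types carry the product sigma-algebra, hence the Borel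
   one here. *)
Notation euclid R n := (n.-tuple (measurableTypeR R)).

Section lebesgue_euclid.
Context {R : realType}.
Local Open Scope ereal_scope.

Definition tcons n (p : measurableTypeR R * euclid R n) : euclid R n.+1 :=
  [tuple of p.1 :: p.2].
Definition tuncons n (x : euclid R n.+1) : measurableTypeR R * euclid R n :=
  (thead x, [tuple of behead x]).

Lemma measurable_tcons n : measurable_fun setT (@tcons n).
Proof. exact: (measurable_cons measurable_fst measurable_snd). Qed.

Lemma measurable_tuncons n : measurable_fun setT (@tuncons n).
Proof.
apply: measurable_fun_pair; last exact: measurable_behead.
exact: measurable_tnth.
Qed.

Lemma tconsK n : cancel (@tcons n) (@tuncons n).
Proof. by move=> [a t]; congr pair; apply: val_inj. Qed.

(* The library's own instance of this fact is shadowed by the instance for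
   subprobabilities. *)
Lemma product_sigma_finite d1 d2 (T1 : measurableType d1)
    (T2 : measurableType d2) (m1 : {sigma_finite_measure set T1 -> \bar R})
    (m2 : {sigma_finite_measure set T2 -> \bar R}) :
  sigma_finite setT (m1 \x m2).
Proof.
have /sigma_finiteP[F [TF ndF Foo]] := sigma_finiteT m1.
have /sigma_finiteP[G [TG ndG Goo]] := sigma_finiteT m2.
exists (fun n => F n `*` G n).
  rewrite -setXTT TF TG predeqE => -[x y]; split.
    move=> [/= [n _ Fnx] [k _ Gky]]; exists (maxn n k) => //; split.
    - by move: x Fnx; exact/subsetPset/ndF/leq_maxl.
    - by move: y Gky; exact/subsetPset/ndG/leq_maxr.
  by move=> [n _ []/= ? ?]; split; exists n.
move=> k; have [? ?] := Foo k; have [? ?] := Goo k.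
split; first exact: measurableX.
by rewrite product_measure1E// lte_mul_pinfty// ge0_fin_numE.
Qed.

Section step.
Variables (n : nat) (m : {sigma_finite_measure set (euclid R n) -> \bar R}).

Definition lebesgue_step : set (euclid R n.+1) -> \bar R :=
  pushforward (lebesgue_measure \x m) (@tcons n).

Let step0 : lebesgue_step set0 = 0.
Proof. by rewrite /lebesgue_step /pushforward preimage_set0 measure0. Qed.

Let step_ge0 A : 0 <= lebesgue_step A.
Proof. by rewrite /lebesgue_step /pushforward measure_ge0. Qed.

Let step_sigma_additive : semi_sigma_additive lebesgue_step.
Proof.
have mc := @measurable_tcons n.
exact: (@measure_semi_sigma_additive _ _ _
  (pushforward (lebesgue_measure \x m) (@tcons n))).
Qed.

HB.instance Definition _ := isMeasure.Build _ _ _ lebesgue_step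
  step0 step_ge0 step_sigma_additive.

Let step_sigma_finite : sigma_finite setT lebesgue_step.
Proof.
have [F TF Foo] : sigma_finite setT (lebesgue_measure \x m).
  exact: product_sigma_finite.
exists (fun k => @tuncons n @^-1` F k).
  by rewrite -preimage_bigcup -TF preimage_setT.
move=> k; have [mF Fk] := Foo k; split.
  by rewrite -[X in measurable X]setTI; exact: measurable_tuncons.
rewrite /lebesgue_step /pushforward -comp_preimage.
by rewrite (_ : _ \o _ = id) //; apply/funext => x; exact: tconsK.
Qed.

HB.instance Definition _ := Measure_isSigmaFinite.Build _ _ _ lebesgue_step
  step_sigma_finite.

End step.

Fixpoint lebesgue_euclid n : {sigma_finite_measure set (euclid R n) -> \bar R} :=
  match n with
  | 0%N => \d_([tuple] : euclid R 0)
  | n'.+1 => lebesgue_step (lebesgue_euclid n')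
  end.
End lebesgue_euclid.

Lemma measurable_box (R : realType) n (A : 'I_n -> set (measurableTypeR R)) :
  (forall i, measurable (A i)) ->
  measurable [set x : euclid R n | forall i, A i (tnth x i)].
Proof.
move=> mA.
have -> : [set x : euclid R n | forall i, A i (tnth x i)] =
    \bigcap_(i in setT) ((fun x : euclid R n => tnth x i) @^-1` A i).
  by apply/seteqP; split => x H i; [move=> _|]; apply: H.
apply: fin_bigcap_measurable => // i _.
by rewrite -[X in measurable X]setTI; exact: measurable_tnth.
Qed.

Lemma lebesgue_euclid_box (R : realType) n
    (A : 'I_n -> set (measurableTypeR R)) :
  (forall i, measurable (A i)) ->
  lebesgue_euclid n [set x | forall i, A i (tnth x i)] =
    (\prod_(i < n) lebesgue_measure (A i))%E.
Proof.
elim: n A => [|n IH] A mA.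
  rewrite big_ord0 /= diracE; apply/eqP; rewrite eqe; apply/eqP.
  by rewrite mem_set//; case.
rewrite big_ord_recl /= /lebesgue_step /pushforward.
have -> : @tcons R n @^-1` [set x | forall i, A i (tnth x i)] = A ord0 `*`
    [set x : euclid R n | forall i, A (lift ord0 i) (tnth x i)].
  apply/seteqP; split => -[a t] /= H.
    split; first by have := H ord0; rewrite tnth0.
    by move=> i; have := H (lift ord0 i); rewrite tnthS.
  by case: H => H0 H i; case: (unliftP ord0 i) => [j|] ->;
    rewrite ?tnth0 ?tnthS.
pose B (i : 'I_n) := A (lift ord0 i).
rewrite product_measure1E//; last by apply: (@measurable_box R n B) => i; exact: mA.
by congr (_ * _)%E; apply: (IH B) => i; exact: mA.
Qed.

Section cubes.
Variables (R : realType) (d : nat).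

(* (k, a) stands for the half-open cube of side length 2^k with corner a *)
Definition cube : choiceType := (int * d.-tuple R)%type.

Definition side (Q : cube) : R := 2 ^ Q.1.

Definition cube_set (Q : cube) : set (euclid R d) :=
  [set x | forall i, tnth Q.2 i <= tnth x i < tnth Q.2 i + side Q].

Record dyadic_grid (D : set cube) : Prop := {
  grid_partition : forall (k : int) (x : euclid R d),
    exists! Q, [/\ D Q, Q.1 = k & cube_set Q x];
  grid_nested : forall P Q, D P -> D Q ->
    [\/ cube_set P `&` cube_set Q = set0,
        cube_set P `<=` cube_set Q | cube_set Q `<=` cube_set P] }.

Definition ancestor (D : set cube) (k : nat) (Q : cube) : cube :=
  xget Q [set P | [/\ D P, side P = 2 ^+ k * side Q
                    & cube_set Q `<=` cube_set P]].

End cubes.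

Definition maximal_function d (T : measurableType d) (R : realType)
    (mu : {measure set T -> \bar R}) (B : set (set T)) (f : T -> R) (x : T) :
    \bar R :=
  ereal_sup [set ((fine (mu S))^-1)%:E * \int[mu]_(y in S) (`|f y|)%:E
            | S in [set S | B S /\ S x]]%E.

(* The largest element of P; 0 when P has none. *)
Definition max_nat (P : set nat) : nat :=
  xget 0%N [set k | P k /\ forall j, P j -> (j <= k)%N].

(* What the two settings have in common; maximal_rectangles is the collection
   used in the definition of the enlargement, up1 k and up2 k are
   I |-> I_1^(k) and I |-> I_2^(k). *)
Record rectangle_setting (R : realType) := RectangleSetting {
  space_display : measure_display;
  space : measurableType space_display;
  vol : {measure set space -> \bar R};
  rect : choiceType;
  rect_set : rect -> set space;
  rectangles : set rect;
  maximal_rectangles : set rect;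
  up1 : nat -> rect -> rect;
  up2 : nat -> rect -> rect }.

Section setting.
Context {R : realType} (S : rectangle_setting R).
Implicit Types (Omega : set (space S)) (U G : set (rect S)) (I : rect S).

Definition enlargement Omega : set (space S) :=
  [set x | 2^-1%:E < maximal_function (@vol _ S)
     (@rect_set _ S @` @maximal_rectangles _ S) \1_Omega x]%E.

Definition e1 I Omega : nat :=
  max_nat [set k | rect_set (up1 k I) `<=` enlargement Omega].

Definition e2 I Omega : nat :=
  max_nat [set k | rect_set (up2 k I) `<=` enlargement Omega].

Definition incomparable U : Prop :=
  forall I J, U I -> U J -> rect_set I `<=` rect_set J -> I = J.

Definition admissible Omega U : Prop :=
  [/\ measurable Omega, (vol S Omega < +oo)%E,
      U `<=` @rectangles _ S,
      forall I, U I -> rect_set I `<=` Omega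
    & incomparable U].

Definition sh G : set (space S) := \bigcup_(I in G) rect_set I.

Definition sparse (eta : R) G : Prop :=
  exists E : rect S -> set (space S),
    (forall I, G I -> [/\ measurable (E I), E I `<=` rect_set I
                        & (eta%:E * vol S (rect_set I) <= vol S (E I))%E])
    /\ trivIset G E.

Definition weighted_sum (w : nat -> nat -> R) Omega U : \bar R :=
  (\esum_(I in U) ((w (e1 I Omega) (e2 I Omega))%:E * vol S (rect_set I)))%E.

End setting.

Definition weight (R : realType) (alpha beta : R) (a b : nat) : R :=
  a.+1%:R `^ (- alpha) * b.+1%:R `^ (- beta).

Section biparameter.
Variables (R : realType) (d1 d2 : nat).
Variables (D1 : set (cube R d1)) (D2 : set (cube R d2)).

(* completed_measure_extension: measurable means Lebesgue measurable, not just
   Borel *)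
Definition biparameter_setting : rectangle_setting R :=
  @RectangleSetting R _ _
    (@completed_measure_extension _ _ R (lebesgue_euclid d1 \x lebesgue_euclid d2)%E)
    (cube R d1 * cube R d2)%type
    (fun I => cube_set I.1 `*` cube_set I.2)
    (D1 `*` D2)
    (D1 `*` D2)
    (fun k I => (ancestor D1 k I.1, I.2))
    (fun k I => (I.1, ancestor D2 k I.2)).

End biparameter.

Section zygmund.
Variables (R : realType) (d1 d2 d3 : nat).
Variables (D1 : set (cube R d1)) (D2 : set (cube R d2)) (D3 : set (cube R d3)).

Definition zygmund_setting : rectangle_setting R :=
  @RectangleSetting R _ _
    (@completed_measure_extension _ _ R (lebesgue_euclid d1 \x lebesgue_euclid d2
                                  \x lebesgue_euclid d3)%E)
    (cube R d1 * cube R d2 * cube R d3)%type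
    (fun I => cube_set I.1.1 `*` cube_set I.1.2 `*` cube_set I.2)
    [set I | (D1 `*` D2 `*` D3) I /\ side I.2 = side I.1.1 * side I.1.2]
    [set I | (D1 `*` D2 `*` D3) I /\ side I.2 <= side I.1.1 * side I.1.2]
    (fun k I => (ancestor D1 k I.1.1, I.1.2, I.2))
    (fun k I => (I.1.1, ancestor D2 k I.1.2, I.2)).

End zygmund.

(* Main.v *)
From HB Require Import structures.
From mathcomp Require Import all_boot all_order all_algebra.
From mathcomp Require Import zify lra.

Set Implicit Arguments.
Unset Strict Implicit.
Unset Printing Implicit Defensive.

Import Order.TTheory GRing.Theory Num.Theory.

Local Open Scope ring_scope.
(** * Laminar families *)

(** By maximality of e_i, the ancestor of I one level beyond e_i in direction i is at most half
    covered by Omega. So on at least half of I no member of the family exceeds I in direction 1 by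
    more than e_1 levels, and on at least half none exceeds it in direction 2 by more than e_2
    levels. Incomparable rectangles through a point are strictly oppositely ordered in their first
    two sides; hence such bounds give them distinct integer positions, and their weights sum like a
    series of powers. The obstacle is that the two halves of I may be almost disjoint. Without a
    third coordinate they depend on different variables and share a quarter of I; in the Zygmund
    setting both depend on the third variable. A rectangle that is not [good] keeps an eighth of
    itself, chosen so that any two such rectangles through a point can still be compared; there the
    relation between the sides turns an excess in direction 1 into one in direction 2. The constant
    is 72 (4/s + 4/(1-s)) = 288/(s(1-s)) from packing, times 8 from the sparse selection, times 10/9
    from passing to a finite subfamily. Necessity comes from tiling one rectangle by all shapes 2^k
    by 2^(n-k). *)

Definition laminar (T : finType) (fam : {set {set T}}) :=
  forall S S' : {set T}, S \in fam -> S' \in fam -> S :&: S' != set0 ->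
    (S \subset S') || (S' \subset S).

(** The maximal members do it: two of them that meet are nested, hence equal, and a member of
    largest cardinality through a point is maximal. *)
Lemma laminar_cover (T : finType) (fam : {set {set T}}) : laminar fam ->
  exists P : {set {set T}}, [/\ P \subset fam, trivIset P & cover P = cover fam].
Proof.
move=> lam.
pose P := [set S in fam | [forall S' in fam, (S \subset S') ==> (S == S')]].
exists P; split; first by apply/subsetP => S; rewrite inE => /andP[].
- apply/trivIsetP => S S'; rewrite !inE => /andP[Sf /forall_inP mS].
  move=> /andP[S'f /forall_inP mS'] neq; rewrite -setI_eq0.
  apply: contraNT neq => /(lam _ _ Sf S'f) /orP[] sub.
    by have /implyP/(_ sub) := mS _ S'f.
  by rewrite eq_sym; have /implyP/(_ sub) := mS' _ Sf.
apply/setP => x; apply/bigcupP/bigcupP => -[S].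
  by rewrite inE => /andP[Sf _] xS; exists S.
move=> Sf xS; have SP : (S \in fam) && (x \in S) by rewrite Sf.
case: (@arg_maxnP _ S (fun S => (S \in fam) && (x \in S))
  (fun S : {set T} => #|S|) SP) => M /andP[Mf xM] maxM.
exists M => //; rewrite inE Mf; apply/forall_inP => S' S'f; apply/implyP => sub.
by rewrite eqEcard sub; apply: maxM; rewrite S'f (subsetP sub).
Qed.

Lemma laminar_leq_sum (T : finType) (fam : {set {set T}}) (f g : T -> nat) :
  laminar fam ->
  (forall S, S \in fam -> (\sum_(x in S) f x <= \sum_(x in S) g x)%N) ->
  (\sum_(x in cover fam) f x <= \sum_(x in cover fam) g x)%N.
Proof.
move=> /laminar_cover[P [/subsetP sP tP <-]] le.
by rewrite !big_trivIset//; apply: leq_sum => S /sP; apply: le.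
Qed.

Lemma laminar_ler_sum (R : numDomainType) (T : finType) (fam : {set {set T}})
    (f g : T -> R) : laminar fam ->
  (forall S, S \in fam -> \sum_(x in S) f x <= \sum_(x in S) g x) ->
  \sum_(x in cover fam) f x <= \sum_(x in cover fam) g x.
Proof.
move=> /laminar_cover[P [/subsetP sP tP <-]] le.
by rewrite !big_trivIset//; apply: ler_sum => S /sP; apply: le.
Qed.

Lemma card_in_window (T : finType) (A : {set T}) (f : T -> nat) (lo n : nat) :
  {in A &, injective f} -> (forall t, t \in A -> (lo < f t <= lo + n)%N) ->
  (#|A| <= n)%N.
Proof.
move=> inj win; rewrite cardE -(size_map f) -(size_iota lo.+1 n).
apply: uniq_leq_size.
  by rewrite map_inj_in_uniq ?enum_uniq// => s t; rewrite !mem_enum; apply: inj.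
by move=> x /mapP[t]; rewrite mem_enum => /win tw ->; rewrite mem_iota; lia.
Qed.

(** * Incomparable families of rectangles *)

(* A finite model of a family of dyadic rectangles: the cells are the triples of
   A1 * A2 * A3, p, q, h are the logarithms of the side lengths counted from the
   side lengths of the cells, and a, b stand for e_1, e_2. *)
Record config := Config {
  A1 : finType; A2 : finType; A3 : finType; U : finType;
  c1 : U -> {set A1}; c2 : U -> {set A2}; c3 : U -> {set A3};
  p : U -> nat; q : U -> nat; h : U -> nat; a : U -> nat; b : U -> nat }.

Section config_defs.
Variable C : config.
Implicit Types (I J : U C) (x : A1 C * A2 C * A3 C).

Definition rc I := setX (setX (c1 I) (c2 I)) (c3 I).

Definition shc := [set x | [exists I, x \in rc I]].

Definition far_above I :=
  [set x in rc I | [exists J, (x \in rc J) && (p I + a I < p J)%N]].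

Definition far_below I :=
  [set x in rc I | [exists J, (x \in rc J) && (q I + b I < q J)%N]].

(** The factors 2 leave room for a bound on [q] that passes through an intermediate rectangle, as in
    [card_B1], where it costs [b J] twice. *)
Definition core_part I := [set x in rc I | [forall J, (x \in rc J) ==>
  (p J <= p I + 2 * a I)%N && (q J <= q I + 2 * b I)%N]].

(** With 64, the two sets estimated with a loss of 4 in [card_Z] and [card_B1] each take less than a
    sixteenth of a rectangle that is not good. *)
Definition good I := (#|rc I| <= 64 * #|core_part I|)%N.

(** [v_inc] is incomparability, [v_above] and [v_below] are the maximality of e_1 and e_2, and
    [v_zyg] is what is kept of the relation between the three sides: in the Zygmund setting [h] is
    [p + q] up to a constant, in the bi-parameter setting [h] is constant. *)
Record valid : Prop := {
  v_ne1 : forall I, c1 I != set0;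
  v_ne2 : forall I, c2 I != set0;
  v_ne3 : forall I, c3 I != set0;
  v_lam1 : forall I J y, y \in c1 I -> y \in c1 J -> (p I <= p J)%N ->
    c1 I \subset c1 J;
  v_lam2 : forall I J y, y \in c2 I -> y \in c2 J -> (q I <= q J)%N ->
    c2 I \subset c2 J;
  v_lam3 : forall I J y, y \in c3 I -> y \in c3 J -> (h I <= h J)%N ->
    c3 I \subset c3 J;
  v_inc : forall I J x, x \in rc I -> x \in rc J -> I != J ->
    (p I < p J)%N && (q J < q I)%N || (p J < p I)%N && (q I < q J)%N;
  v_zyg : forall I J, (h J < h I)%N -> (p J + q J <= p I + q I)%N;
  v_above : forall I, (2 * #|far_above I| <= #|rc I|)%N;
  v_below : forall I, (2 * #|far_below I| <= #|rc I|)%N }.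

End config_defs.

(** What the count at a point asks of the weight: [T] is the set of rectangles through the point,
    its size is controlled by every e_1, and the [j J] are their distinct positions in direction 2,
    controlled by e_2. *)
Definition sum_bound (R : numDomainType) (wt : nat -> nat -> R) (kappa : R) :=
  forall (V : finType) (T : {set V}) (a b j : V -> nat),
    {in T &, injective j} ->
    (forall J, J \in T -> (#|T| <= 4 * (a J).+1)%N /\ (j J <= 2 * b J)%N) ->
    \sum_(J in T) wt (a J) (b J) <= kappa.

(** * Counting by slices in a product of three finite sets *)

Lemma card_indicator (T : finType) (S : {set T}) : #|S| = (\sum_x (x \in S))%N.
Proof.
by rewrite -sum1_card big_mkcond/=; apply: eq_bigr => x _; case: ifP.
Qed.

Section cylinders.
Variables (T1 T2 T3 : finType).

Definition cyl23 (P : {set T1}) (Q : {set T2 * T3}) : {set T1 * T2 * T3} :=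
  [set x | (x.1.1 \in P) && ((x.1.2, x.2) \in Q)].

Definition cyl13 (Q : {set T1 * T3}) (P : {set T2}) : {set T1 * T2 * T3} :=
  [set x | ((x.1.1, x.2) \in Q) && (x.1.2 \in P)].

Lemma card_cyl23 P Q : #|cyl23 P Q| = (#|P| * #|Q|)%N.
Proof.
pose f (x : T1 * T2 * T3) := (x.1.1, (x.1.2, x.2)).
have fb : bijective f.
  by exists (fun y => (y.1, y.2.1, y.2.2)) => [[[]]|[? []]].
rewrite -cardsX -(on_card_preimset (f := f)); last exact: onW_bij.
by apply: eq_card => -[[x y] z]; rewrite !inE.
Qed.

Lemma card_cyl13 Q P : #|cyl13 Q P| = (#|Q| * #|P|)%N.
Proof.
pose f (x : T1 * T2 * T3) := ((x.1.1, x.2), x.1.2).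
have fb : bijective f.
  by exists (fun y => (y.1.1, y.2, y.1.2)) => [[[]]|[[]]].
rewrite -cardsX -(on_card_preimset (f := f)); last exact: onW_bij.
by apply: eq_card => -[[x y] z]; rewrite !inE.
Qed.

Lemma card_slices2 (S : {set T1 * T2 * T3}) :
  #|S| = (\sum_y \sum_z #|[set x | (x, y, z) \in S]|)%N.
Proof.
transitivity (\sum_y \sum_z \sum_x ((x, y, z) \in S))%N; last first.
  apply: eq_bigr => y _; apply: eq_bigr => z _; rewrite card_indicator.
  by apply: eq_bigr => x _; rewrite inE.
transitivity (\sum_x \sum_y \sum_z ((x, y, z) \in S))%N; last first.
  by rewrite exchange_big/=; apply: eq_bigr => y _; exact: exchange_big.
rewrite (pair_bigA _ (fun x y => \sum_z ((x, y, z) \in S))%N)/=.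
rewrite (pair_bigA _ (fun (u : T1 * T2) z => ((u.1, u.2, z) \in S) : nat))/=.
by rewrite card_indicator; apply: eq_bigr => -[[x y] z].
Qed.

Lemma card_slices1 (S : {set T1 * T2 * T3}) :
  #|S| = (\sum_x #|[set y : T2 * T3 | (x, y.1, y.2) \in S]|)%N.
Proof.
transitivity (\sum_x \sum_(y : T2 * T3) ((x, y.1, y.2) \in S))%N; last first.
  apply: eq_bigr => x _; rewrite card_indicator.
  by apply: eq_bigr => y _; rewrite inE.
rewrite (pair_bigA _ (fun x (y : T2 * T3) => ((x, y.1, y.2) \in S) : nat))/=.
rewrite card_indicator.
rewrite (reindex (fun u : T1 * (T2 * T3) => (u.1, u.2.1, u.2.2)))//=.
by exists (fun x => (x.1.1, (x.1.2, x.2))) => [[? []]|[[]]].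
Qed.

End cylinders.

(** * The exceptional parts of a rectangle and their sizes *)

Section config_theory.
Variables (C : config) (vC : valid C).
Implicit Types I J K : U C.

Local Notation n1 I := #|c1 I|.
Local Notation n2 I := #|c2 I|.
Local Notation n3 I := #|c3 I|.

Lemma card_rc I : #|rc I| = (n1 I * n2 I * n3 I)%N.
Proof. by rewrite !cardsX. Qed.

Lemma n1_gt0 I : (0 < n1 I)%N. Proof. by rewrite card_gt0 (v_ne1 vC). Qed.
Lemma n2_gt0 I : (0 < n2 I)%N. Proof. by rewrite card_gt0 (v_ne2 vC). Qed.
Lemma n3_gt0 I : (0 < n3 I)%N. Proof. by rewrite card_gt0 (v_ne3 vC). Qed.

Lemma mem_rc I (x : A1 C * A2 C * A3 C) :
  (x \in rc I) = [&& x.1.1 \in c1 I, x.1.2 \in c2 I & x.2 \in c3 I].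
Proof. by rewrite !inE andbA. Qed.

Lemma in_rc I x1 x2 x3 : x1 \in c1 I -> x2 \in c2 I -> x3 \in c3 I ->
  (x1, x2, x3) \in rc I.
Proof. by move=> h1 h2 h3; rewrite mem_rc h1 h2 h3. Qed.

Lemma p_lt_above I J (x : A1 C * A2 C * A3 C) : x \in rc I -> x \in rc J -> (p I < p J)%N ->
  [/\ (q J < q I)%N, c1 I \subset c1 J & c2 J \subset c2 I].
Proof.
move=> xI xJ pIJ; have neq : I != J by apply: contraTneq pIJ => ->; rewrite ltnn.
have /orP[/andP[_ qJI]|/andP[]] := v_inc vC xI xJ neq; last by lia.
move: xI xJ; rewrite !mem_rc => /and3P[x1 x2 _] /and3P[y1 y2 _].
by split => //; [apply: (v_lam1 vC x1 y1); lia|apply: (v_lam2 vC y2 x2); lia].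
Qed.

Lemma p_inj I J (x : A1 C * A2 C * A3 C) : x \in rc I -> x \in rc J -> p I = p J -> I = J.
Proof.
move=> xI xJ pIJ; apply/eqP; apply/negPn/negP => neq.
by have := v_inc vC xI xJ neq; lia.
Qed.

Lemma q_inj I J (x : A1 C * A2 C * A3 C) : x \in rc I -> x \in rc J -> q I = q J -> I = J.
Proof.
move=> xI xJ pIJ; apply/eqP; apply/negPn/negP => neq.
by have := v_inc vC xI xJ neq; lia.
Qed.

(* far_above I does not depend on the first coordinate and far_below I does not
   depend on the second one; these are their bases. *)
Definition base_above I : {set A2 C * A3 C} := [set y in setX (c2 I) (c3 I) |
  [exists J, [&& c1 I :&: c1 J != set0, (p I + a I < p J)%N, y.1 \in c2 J
    & y.2 \in c3 J]]].

Definition base_below I : {set A1 C * A3 C} := [set y in setX (c1 I) (c3 I) |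
  [exists J, [&& c2 I :&: c2 J != set0, (q I + b I < q J)%N, y.1 \in c1 J
    & y.2 \in c3 J]]].

(** A rectangle that meets I and has a longer first side contains all of [c1 I] in its first factor,
    so only the other two coordinates decide. *)
Lemma far_aboveE I : far_above I = cyl23 (c1 I) (base_above I).
Proof.
apply/setP => -[[x1 x2] x3]; rewrite !inE/= -!andbA.
case x1I: (x1 \in c1 I) => //=; case x2I: (x2 \in c2 I) => //=.
case x3I: (x3 \in c3 I) => //=.
apply/existsP/existsP => -[J].
  rewrite mem_rc => /andP[/and3P[/= h1 h2 h3] lt]; exists J.
  by rewrite lt h2 h3 !andbT; apply/set0Pn; exists x1; rewrite inE x1I.
move=> /and4P[/set0Pn[y]]; rewrite inE => /andP[yI yJ] lt h2 h3; exists J.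
rewrite lt andbT in_rc//.
by apply: (subsetP (v_lam1 vC yI yJ _)) => //; lia.
Qed.

Lemma far_belowE I : far_below I = cyl13 (base_below I) (c2 I).
Proof.
apply/setP => -[[x1 x2] x3]; rewrite !inE/= -!andbA.
case x1I: (x1 \in c1 I) => //=; case x2I: (x2 \in c2 I) => //=; last first.
  by rewrite !andbF.
case x3I: (x3 \in c3 I) => //=; rewrite andbT.
apply/existsP/existsP => -[J].
  rewrite mem_rc => /andP[/and3P[/= h1 h2 h3] lt]; exists J.
  by rewrite lt h1 h3 !andbT; apply/set0Pn; exists x2; rewrite inE x2I.
move=> /and4P[/set0Pn[y]]; rewrite inE => /andP[yI yJ] lt h2 h3; exists J.
rewrite lt andbT in_rc//.
by apply: (subsetP (v_lam2 vC yI yJ _)) => //; lia.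
Qed.

Lemma card_base_above I : (2 * #|base_above I| <= n2 I * n3 I)%N.
Proof.
have := v_above vC I; rewrite far_aboveE card_cyl23 card_rc; have := n1_gt0 I; nia.
Qed.

Lemma card_base_below I : (2 * #|base_below I| <= n1 I * n3 I)%N.
Proof.
have := v_below vC I; rewrite far_belowE card_cyl13 card_rc; have := n2_gt0 I; nia.
Qed.

Lemma base_aboveN I K (x : A1 C * A2 C * A3 C) : x \in rc I -> x \in rc K ->
  (x.1.2, x.2) \notin base_above I -> (p K <= p I + a I)%N.
Proof.
move=> xI xK; apply: contraNT; rewrite -ltnNge => lt.
have : x \in far_above I by rewrite inE xI; apply/existsP; exists K; rewrite xK.
by rewrite far_aboveE inE => /andP[].
Qed.

Lemma base_belowN I K (x : A1 C * A2 C * A3 C) : x \in rc I -> x \in rc K ->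
  (x.1.1, x.2) \notin base_below I -> (q K <= q I + b I)%N.
Proof.
move=> xI xK; apply: contraNT; rewrite -ltnNge => lt.
have : x \in far_below I by rewrite inE xI; apply/existsP; exists K; rewrite xK.
by rewrite far_belowE inE => /andP[].
Qed.

(* The traces on I of the far rectangles whose third side is at least as long as
   that of I are full in the third coordinate. *)
Definition side_below I : {set A1 C} := [set y in c1 I | [exists J,
  [&& (h I <= h J)%N, (q I + b I < q J)%N, y \in c1 J, c2 I :&: c2 J != set0
    & c3 I :&: c3 J != set0]]].

Definition side_above I : {set A2 C} := [set y in c2 I | [exists J,
  [&& (h I <= h J)%N, (p I + a I < p J)%N, y \in c2 J, c1 I :&: c1 J != set0
    & c3 I :&: c3 J != set0]]].

Lemma side_below_base I : setX (side_below I) (c3 I) \subset base_below I.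
Proof.
apply/subsetP => -[y z]; rewrite !inE/= => /andP[/andP[yI /existsP[J]]] + zI.
move=> /and5P[hIJ lt yJ m2 /set0Pn[t]]; rewrite inE => /andP[tI tJ].
rewrite yI zI/=; apply/existsP; exists J; rewrite m2 lt yJ/=.
by apply: (subsetP (v_lam3 vC tI tJ _)).
Qed.

Lemma side_above_base I : setX (side_above I) (c3 I) \subset base_above I.
Proof.
apply/subsetP => -[y z]; rewrite !inE/= => /andP[/andP[yI /existsP[J]]] + zI.
move=> /and5P[hIJ lt yJ m2 /set0Pn[t]]; rewrite inE => /andP[tI tJ].
rewrite yI zI/=; apply/existsP; exists J; rewrite m2 lt yJ/=.
by apply: (subsetP (v_lam3 vC tI tJ _)).
Qed.

Lemma card_side_above I : (2 * #|side_above I| <= n2 I)%N.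
Proof.
have := subset_leq_card (side_above_base I); rewrite cardsX.
have := card_base_above I => h1 h2; rewrite -(leq_pmul2r (n3_gt0 I)).
move: h1 h2; move: #|_| #|_| #|_| #|_| => n s m f; lia.
Qed.

(** A dichotomy for pairs with [later I J]: either the far part of I takes a quarter of the slab
    over [c3 J], and J is charged to [far_above I :&: far_below I] ([card_Z]), or the slab leaves
    enough room inside [core_part J] ([card_B1]). *)
Definition exceptional I J :=
  (n1 I * n3 J <= 4 * #|base_below I :&: setX (c1 I) (c3 J)|)%N.

(** The far rectangles that [side_above] does not see: their third side is shorter, so their trace
    on I is not full in the third coordinate. *)
Definition later I J := (h J < h I)%N && (p I + a I < p J)%N.

Definition Z I := [set x in rc I |
  [exists J, [&& later I J, exceptional I J & x \in rc J]]].

(** Fix the second coordinate y. The third factors of the J involved are laminar subsets of [c3 I],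
    and [base_below I] fills a quarter of each [c1 I] times [c3 J]. With y inserted, the points of
    this quarter lie in [far_below I], and also in [far_above I] because [c1 I] is contained in
    [c1 J]. *)
Lemma card_Z I : (#|Z I| <= 4 * #|far_above I :&: far_below I|)%N.
Proof.
rewrite !card_slices2 big_distrr/=; apply: leq_sum => y _.
pose JJ := [set J | [&& later I J, exceptional I J, c1 I :&: c1 J != set0,
  y \in c2 J & c3 I :&: c3 J != set0]].
have JJ1 J : J \in JJ -> c1 I \subset c1 J.
  rewrite inE => /and5P[/andP[_ lt] _ /set0Pn[t] + _ _].
  by rewrite inE => /andP[tI tJ]; apply: (v_lam1 vC tI tJ); lia.
have JJ3 J : J \in JJ -> c3 J \subset c3 I.
  rewrite inE => /and5P[/andP[hJI lt] _ _ _ /set0Pn[t]].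
  by rewrite inE => /andP[tI tJ]; apply: (v_lam3 vC tJ tI); lia.
pose fam := [set c3 J | J in JJ].
have lam : laminar fam.
  move=> _ _ /imsetP[J _ ->] /imsetP[J' _ ->] /set0Pn[t].
  rewrite inE => /andP[tJ tJ']; have /orP[le|le] := leq_total (h J) (h J').
    by rewrite (v_lam3 vC tJ tJ').
  by rewrite (v_lam3 vC tJ' tJ) ?orbT.
case yI: (y \in c2 I); last first.
  rewrite big1// => z _; apply: eq_card0 => x.
  by rewrite !inE/= yI andbF.
pose g z := #|[set x | (x, z) \in base_below I]|.
have gsum : forall S : {set A3 C}, (\sum_(z in S) g z)%N =
    #|base_below I :&: setX (c1 I) S|.
  move=> S; rewrite -[RHS]sum1_card (eq_bigl (fun x => (x \in base_below I)
    && (x.2 \in S))); last first.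
    move=> [x z]; rewrite !inE/=.
    by case: (x \in c1 I); case: (z \in S); rewrite ?andbF ?andbT.
  rewrite (eq_bigr (fun z => \sum_(x | (x, z) \in base_below I) 1)%N); last first.
    by move=> z _; rewrite /g -sum1_card; apply: eq_bigl => x; rewrite inE.
  rewrite pair_big_dep/=.
  rewrite (reindex (fun z : A1 C * A3 C => (z.2, z.1))); last first.
    by exists (fun z => (z.2, z.1)) => [[]|[]].
  by apply: eq_bigl => -[x z] /=; rewrite andbC.
have := @laminar_leq_sum _ fam (fun=> n1 I) (fun z => 4 * g z)%N lam.
have H S : S \in fam -> (\sum_(x in S) n1 I <= \sum_(x in S) 4 * g x)%N.
  move=> /imsetP[J]; rewrite inE => /and5P[_ ex _ _ _] ->.
  by rewrite sum_nat_const -big_distrr/= gsum mulnC.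
move=> /(_ H) le.
have inZ z x : (x, y, z) \in Z I -> (x \in c1 I) /\ (z \in cover fam).
  rewrite inE => /andP[xI /existsP[J /and3P[lt ex xJ]]].
  move: (xI) (xJ); rewrite !mem_rc/= => /and3P[x1 _ x3] /and3P[y1 y2 y3].
  split => //; apply/bigcupP; exists (c3 J) => //; apply/imsetP; exists J => //.
  rewrite inE lt ex y2/=; apply/andP; split.
    by apply/set0Pn; exists x; rewrite inE x1.
  by apply/set0Pn; exists z; rewrite inE x3.
rewrite (bigID (mem (cover fam)))/= [X in (_ + X)%N]big1 ?addn0; last first.
  move=> z zN; apply: eq_card0 => x; rewrite inE/=; apply: contraNF zN => /inZ.
  by case.
apply: (@leq_trans (\sum_(z in cover fam) n1 I)%N).
  apply: leq_sum => z _; apply: subset_leq_card; apply/subsetP => x.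
  by rewrite inE => /inZ[].
apply: leq_trans le _; rewrite [X in (_ <= 4 * X)%N](bigID (mem (cover fam)))/=.
rewrite mulnDr; apply: leq_trans (leq_addr _ _); rewrite big_distrr/=.
apply: leq_sum => z zc; rewrite leq_mul2l/=; apply: subset_leq_card.
apply/subsetP => x; rewrite !inE => /andP[/andP[/= x1 x3]] /existsP[K].
move=> /and4P[/set0Pn[t]]; rewrite inE => /andP[tI tK] ltK xK zK.
rewrite x1 x3 yI/=; apply/andP; split; apply/existsP.
  move: zc => /bigcupP[_ /imsetP[J JJJ ->] zJ]; exists J.
  have /subsetP s1 := JJ1 _ JJJ.
  move: JJJ; rewrite inE => /and5P[/andP[_ ltJ] _ _ y2 _].
  by rewrite ltJ andbT in_rc ?s1.
exists K; rewrite ltK andbT in_rc//.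
by apply: (subsetP (v_lam2 vC tI tK _)) => //; lia.
Qed.

(** Where J could be far above some I with no larger e_1 although the pair is not exceptional.
    Outside [side_below J] such an I satisfies [q I <= q J + b J]. *)
Definition B1 J := [set y in c1 J :\: side_below J | [exists I,
  [&& [&& (b I <= a I)%N, (a I <= a J)%N, later I J & ~~ exceptional I J],
    y \in c1 I, c2 I :&: c2 J != set0 & c3 I :&: c3 J != set0]]].

(** The first factors of the I involved are laminar and cover [B1 J], and over each of them at least
    a quarter of the corresponding part of J lies in [core_part J]. *)
Lemma card_B1 J : (#|B1 J| * (n2 J * n3 J) <= 4 * #|core_part J|)%N.
Proof.
pose II := [set I | [&& [&& (b I <= a I)%N, (a I <= a J)%N, later I J
    & ~~ exceptional I J], (c1 J :\: side_below J) :&: c1 I != set0,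
    c2 I :&: c2 J != set0 & c3 I :&: c3 J != set0]].
pose fam := [set c1 I | I in II].
have lam : laminar fam.
  move=> _ _ /imsetP[I _ ->] /imsetP[I' _ ->] /set0Pn[t].
  rewrite inE => /andP[tI tI']; have /orP[le|le] := leq_total (p I) (p I').
    by rewrite (v_lam1 vC tI tI').
  by rewrite (v_lam1 vC tI' tI) ?orbT.
pose g y := #|[set z : A2 C * A3 C | (y, z.1, z.2) \in core_part J]|.
have gsum (S : {set A1 C}) : (\sum_(y in S) g y)%N =
    #|[set x in core_part J | x.1.1 \in S]|.
  rewrite card_slices1 [RHS](bigID (mem S))/= [X in (_ + X)%N]big1 ?addn0.
    apply: eq_bigr => y yS; apply: eq_card => z; rewrite !inE/= yS.
    by rewrite andbT.
  by move=> y /negbTE yS; apply: eq_card0 => z; rewrite !inE/= yS andbF.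
have cov : B1 J \subset cover fam.
  apply/subsetP => y; rewrite inE => /andP[yJ /existsP[I]].
  move=> /and4P[h1 yI h2 h3]; apply/bigcupP; exists (c1 I) => //.
  apply/imsetP; exists I => //; rewrite inE h1 h2 h3 !andbT.
  by apply/set0Pn; exists y; rewrite inE yJ.
have := @laminar_leq_sum _ fam (fun=> n2 J * n3 J)%N (fun y => 4 * g y)%N lam.
have H S : S \in fam ->
    (\sum_(y in S) n2 J * n3 J <= \sum_(y in S) 4 * g y)%N.
  move=> /imsetP[I]; rewrite inE => /and4P[/and4P[bI aIJ /andP[hJI lt] ex]].
  move=> /set0Pn[y0] + /set0Pn[z0] + /set0Pn[t0] + ->.
  rewrite !(inE, in_setI) => /andP[/andP[y0s y0J] y0I] /andP[z0I z0J] /andP[t0I t0J].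
  have oI := in_rc y0I z0I t0I; have oJ := in_rc y0J z0J t0J.
  have [qJI s1 s2] : [/\ (q J < q I)%N, c1 I \subset c1 J & c2 J \subset c2 I].
    by apply: p_lt_above oI oJ _; move: lt; clear; lia.
  have s3 : c3 J \subset c3 I by apply: (v_lam3 vC t0J t0I); apply: ltnW.
  have qgap : (q I <= q J + b J)%N.
    move: y0s; rewrite y0J/=; apply: contraNT; rewrite -ltnNge => ltq.
    apply/existsP; exists I; rewrite ltq y0I (ltnW hJI)/=.
    by apply/andP; split; apply/set0Pn; [exists z0|exists t0];
      rewrite inE ?z0I ?z0J ?t0I ?t0J.
  have bIJ : (b I <= b J)%N by move: (v_zyg vC hJI) lt qgap bI; clear; lia.
  (* The bound [bIJ] just obtained is where the relation between the sides is used: a I < p J - p I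
     <= q I - q J <= b J, and b I <= a I. *)
  rewrite sum_nat_const -big_distrr/= gsum.
  (* [W] is at least half of the part of J over [c1 I], and [W'] is less than a quarter of it
     because the pair is not exceptional. On the difference, every K through the point has p K <= p
     J + a J and q K <= q I + b I <= q J + 2 b J. *)
  pose W := cyl23 (c1 I) (setX (c2 J) (c3 J) :\: base_above J).
  pose W' := cyl13 (base_below I :&: setX (c1 I) (c3 J)) (c2 J).
  have sub : W :\: W' \subset [set x in core_part J | x.1.1 \in c1 I].
    apply/subsetP => -[[x1 x2] x3]; rewrite in_setD => /andP[].
    rewrite [X in ~~ X]inE/= => xW'; rewrite /W inE/= => /andP[x1I].
    rewrite in_setD => /andP[xa]; rewrite in_setX => /andP[/= x2J x3J].
    have x2I := subsetP s2 _ x2J; have x3I := subsetP s3 _ x3J.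
    have x1J := subsetP s1 _ x1I.
    have xb : (x1, x3) \notin base_below I.
      by apply: contra xW' => xb; rewrite in_setI in_setX xb x1I x3J x2J.
    rewrite [X in is_true X]inE/= x1I andbT inE in_rc//=; apply/forallP => K; apply/implyP => xK.
    have xJ := in_rc x1J x2J x3J; have xI := in_rc x1I x2I x3I.
    apply/andP; split.
      by move: (base_aboveN xJ xK xa); clear; lia.
    by move: (base_belowN xI xK xb) qgap bIJ; clear; lia.
  have := subset_leq_card sub; have := cardsD W W'.
  have := subset_leq_card (subsetIr W W').
  have := card_base_above J.
  have : #|setX (c2 J) (c3 J) :\: base_above J| = (n2 J * n3 J - #|base_above J|)%N.
    rewrite cardsD cardsX; congr (_ - _)%N; apply: eq_card => z.
    rewrite in_setI andb_idl//; rewrite inE => /andP[].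
    by [].
  rewrite card_cyl23 card_cyl13 => -> h1 h2 h3 h4.
  move: ex; rewrite /exceptional -ltnNge => h5.
  move: h1 h2 h3 h4 h5; clear.
  move: #|base_above J| #|_ :&: setX _ _| #|W :\: W'| #|W :&: W'| #|[set _ in _ | _]|.
  move: (n1 I) (n2 J) (n3 J) => m1 m2 m3 f g u v t h1 h2 h3 h4 h5.
  have h6 : (m1 * (m2 * m3) <= 2 * (m1 * (m2 * m3 - f)))%N.
    by rewrite [X in (_ <= X)%N]mulnCA leq_mul2l; apply/orP; right; lia.
  have h7 : (4 * (g * m2) <= m1 * (m2 * m3))%N.
    rewrite mulnA [(m2 * m3)%N]mulnC mulnA leq_mul2r; apply/orP; right; lia.
  by lia.
move=> /(_ H); rewrite sum_nat_const -big_distrr/= gsum => le.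
apply: (@leq_trans (#|cover fam| * (n2 J * n3 J))%N).
  by rewrite leq_mul2r subset_leq_card ?orbT.
apply: leq_trans le _; rewrite leq_mul2l/=; apply: subset_leq_card.
by apply/subsetP => x; rewrite inE => /andP[].
Qed.

(** Each exclusion closes one case when two rectangles through a point are compared: [base_below]
    bounds [q]; the other three bound [p], for a third side at least as long, for a pair that is not
    exceptional and for an exceptional pair. *)
Definition main_part J := [set x in rc J | [&& (x.1.1, x.2) \notin base_below J,
  x.1.2 \notin side_above J, x.1.1 \notin B1 J & x \notin Z J]].

(** The complement of the union of the two far sets lies in the core, which is less than 1/64 of I.
    The union is thus more than 63/64, while each far set is at most half, so they overlap in less
    than 1/64. *)
Lemma card_far I : ~~ good I -> (64 * #|far_above I :&: far_below I| < #|rc I|)%N.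
Proof.
rewrite /good -ltnNge => ng; have := v_above vC I; have := v_below vC I.
have sA : far_above I \subset rc I by apply/subsetP => x; rewrite inE => /andP[].
have sB : far_below I \subset rc I by apply/subsetP => x; rewrite inE => /andP[].
have : rc I :\: (far_above I :|: far_below I) \subset core_part I.
  apply/subsetP => x; rewrite in_setD => /andP[]; rewrite !in_setU negb_or.
  move=> /andP[xA xB] xI; rewrite inE xI; apply/forallP => J; apply/implyP => xJ.
  move: xA xB; rewrite [x \in far_above I]in_set [x \in far_below I]in_set xI/=.
  move=> /existsPn/(_ J) + /existsPn/(_ J); rewrite xJ/= => h1 h2.
  by apply/andP; split; [move: h1|move: h2]; clear; lia.
move=> /subset_leq_card; rewrite cardsD.
have -> : rc I :&: (far_above I :|: far_below I) = far_above I :|: far_below I.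
  by apply/setIidPr; rewrite subUset sA.
rewrite cardsU; have := subset_leq_card (subsetIl (far_above I) (far_below I)).
by move: ng; clear; lia.
Qed.

(** The first two exclusions depend on disjoint sets of variables, (1,3) and 2, so what they leave
    is at least a half times a half. From this quarter, [B1 J] and [Z J] remove less than a
    sixteenth of J each. *)
Lemma card_main J : ~~ good J -> (#|rc J| <= 8 * #|main_part J|)%N.
Proof.
move=> ng.
pose P0 := [set x : A1 C * A2 C * A3 C |
  ((x.1.1, x.2) \in setX (c1 J) (c3 J) :\: base_below J)
  && (x.1.2 \in c2 J :\: side_above J)].
have cP0 : (#|rc J| <= 4 * #|P0|)%N.
  have -> : P0 = cyl13 (setX (c1 J) (c3 J) :\: base_below J)
    (c2 J :\: side_above J) by [].
  rewrite card_cyl13 !cardsD card_rc.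
  have -> : setX (c1 J) (c3 J) :&: base_below J = base_below J.
    by apply/setIidPr/subsetP => x; rewrite inE => /andP[].
  have -> : c2 J :&: side_above J = side_above J.
    by apply/setIidPr/subsetP => x; rewrite inE => /andP[].
  rewrite cardsX; have := card_base_below J; have := card_side_above J.
  move: (#|base_below J|) (#|side_above J|) (n1 J) (n2 J) (n3 J) => f s m1 m2 m3 h1 h2.
  have : ((m1 * m3) * m2 <= (2 * (m1 * m3 - f)) * (2 * (m2 - s)))%N.
    by apply: leq_mul; lia.
  by lia.
pose N := setX (setX (B1 J) (c2 J)) (c3 J).
have sub : P0 :\: (N :|: Z J) \subset main_part J.
  apply/subsetP => x; rewrite in_setD in_setU negb_or => /andP[/andP[xN xZ]].
  rewrite [x \in P0]in_set => /andP[/setDP[+ xf] /setDP[x2 xs]].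
  rewrite in_setX => /andP[x1 x3].
  rewrite /main_part in_set mem_rc x1 x2 x3 xf xs xZ/= andbT.
  by apply: contra xN; move: x {xZ xf xs x1} x2 x3 => [[x1 x2] x3]/= y2 y3 xB;
    rewrite !in_setX xB y2 y3.
have cN : (16 * #|N| < #|rc J|)%N.
  have -> : #|N| = (#|B1 J| * (n2 J * n3 J))%N by rewrite !cardsX mulnA.
  move: ng (card_B1 J); rewrite /good -ltnNge.
  by move: (#|B1 J| * _)%N #|core_part J| #|rc J|; clear; lia.
have := subset_leq_card sub; rewrite cardsD.
have := subset_leq_card (subsetIr P0 (N :|: Z J)).
have [+ _] := leq_card_setU N (Z J); move: (card_Z J) (card_far ng) cN cP0.
by clear; lia.
Qed.

End config_theory.

(** * Packing estimates from pointwise bounds *)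

Section packing.
Variables (R : realDomainType) (C : config).
Variable w : U C -> R.
Hypothesis w_ge0 : forall I, 0 <= w I.

Lemma packing (V : {set U C}) (D : U C -> {set A1 C * A2 C * A3 C}) (N : nat)
    (kappa : R) :
  (forall J, J \in V -> D J \subset rc J) ->
  (forall J, J \in V -> (#|rc J| <= N * #|D J|)%N) ->
  0 <= kappa ->
  (forall x, \sum_(J in V | x \in D J) w J <= kappa) ->
  \sum_(J in V) w J * #|rc J|%:R <= N%:R * kappa * #|shc C|%:R.
Proof.
move=> sD cD k0 pt.
apply: (@le_trans _ _ (\sum_(J in V) N%:R * (w J * #|D J|%:R))).
  apply: ler_sum => J JV; rewrite mulrCA ler_wpM2l// -natrM ler_nat.
  exact: cD.
rewrite -big_distrr/= -mulrA ler_wpM2l//.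
rewrite (eq_bigr (fun J => \sum_(x in D J) w J)); last first.
  by move=> J _; rewrite sumr_const mulr_natr.
rewrite (exchange_big_dep (mem (shc C)))/=; last first.
  move=> J x JV xD; rewrite inE; apply/existsP; exists J.
  exact: (subsetP (sD _ JV)).
by rewrite mulr_natr -sumr_const; apply: ler_sum => x _; apply: pt.
Qed.

End packing.

Lemma sum_bound_ge0 (R : numDomainType) (wt : nat -> nat -> R) kappa : sum_bound wt kappa -> 0 <= kappa.
Proof.
move=> /(_ _ (set0 : {set unit}) (fun=> 0%N) (fun=> 0%N) (fun=> 0%N)).
by rewrite big_set0; apply => [[] []//|t]; rewrite inE.
Qed.

Section main_estimate.
Variables (R : realDomainType) (wt : nat -> nat -> R).
Hypothesis wt_ge0 : forall m n, 0 <= wt m n.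

(** At a point, all rectangles are compared with the one, I, that has the smallest e_1. They exceed
    it by at most a I in direction 1 and b I in direction 2, so there are at most 1 + a I + b I <= 2
    a I + 1 of them, and minimality passes this bound to every [a J]. *)
Lemma nongood_estimate (C : config) (kappa : R) : valid C -> sum_bound wt kappa ->
  \sum_(J | ~~ good J && (b J <= a J)%N) wt (a J) (b J) * #|@rc C J|%:R <=
  8%:R * kappa * #|shc C|%:R.
Proof.
move=> vC sb; have k0 := sum_bound_ge0 sb.
pose V := [set J : U C | ~~ good J && (b J <= a J)%N].
rewrite -(eq_bigl _ _ (fun J => in_set _ J)).
apply: (@packing _ _ _ _ V (@main_part C)) => //.
- by move=> J _; apply/subsetP => x; rewrite inE => /andP[].
- by move=> J; rewrite inE => /andP[ng _]; exact: card_main.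
move=> x; pose T := [set J in V | x \in main_part J].
rewrite -(eq_bigl _ _ (fun J => in_set _ J)) -/T.
have Trc J : J \in T -> x \in rc J by rewrite inE => /andP[_]; rewrite inE => /andP[].
have [->|/set0Pn[I0 I0T]] := eqVneq T set0; first by rewrite big_set0.
have [I IT minI] := @arg_minnP _ I0 (fun J => J \in T) (@a C) I0T.
have xI := Trc _ IT; have := IT.
rewrite in_set => /andP[IV]; rewrite in_set => /andP[_ /and4P[xIb xIs xI1 xIZ]].
have qle J : J \in T -> (q J <= q I + b I)%N.
  by move=> JT; apply: base_belowN xI (Trc _ JT) xIb.
have ple J : J \in T -> (p J <= p I + a I)%N.
  move=> JT; have xJ := Trc _ JT; rewrite leqNgt; apply/negP => lt.
  have m1 : c1 I :&: c1 J != set0.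
    by apply/set0Pn; exists x.1.1; move: xI xJ; rewrite !mem_rc inE
      => /and3P[-> _ _] /and3P[->].
  have m2 : c2 I :&: c2 J != set0.
    by apply/set0Pn; exists x.1.2; move: xI xJ; rewrite !mem_rc inE
      => /and3P[_ -> _] /and3P[_ ->].
  have m3 : c3 I :&: c3 J != set0.
    by apply/set0Pn; exists x.2; move: xI xJ; rewrite !mem_rc inE
      => /and3P[_ _ ->] /and3P[_ _ ->].
  (* If J were far above I, the point would lie in [side_above I] when the third side of J is not
     shorter, in [Z I] when the pair is exceptional, and over [B1 J] otherwise. *)
  have [hIJ|hJI] := leqP (h I) (h J).
    move/negP: xIs; apply; rewrite inE; move: xI xJ; rewrite !mem_rc.
    move=> /and3P[_ -> _] /and3P[_ x2 _]; apply/existsP; exists J.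
    by rewrite hIJ lt x2 m1 m3.
  have lat : later I J by rewrite /later hJI lt.
  have [ex|nex] := boolP (exceptional I J).
    move/negP: xIZ; apply; rewrite inE xI; apply/existsP; exists J.
    by rewrite lat ex xJ.
  have := JT; rewrite inE => /andP[_]; rewrite inE => /andP[_].
  move=> /and4P[xJb _ /negP xJ1 _]; apply: xJ1; rewrite !inE.
  move: (xJ) (xI); rewrite !mem_rc => /and3P[xJ1 xJ2 xJ3] /and3P[xI1' _ _].
  rewrite xJ1 andbT/=; apply/andP; split; last first.
    apply/existsP; exists I; rewrite lat nex m2 m3 xI1' minI// !andbT.
    by move: IV; rewrite inE => /andP[].
  apply/negP => /existsP[K /and5P[hJK ltK x1K m2K m3K]].
  move/negP: xJb; apply; rewrite !inE/= xJ1 xJ3/=; apply/existsP; exists K.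
  rewrite m2K ltK x1K/=; case/set0Pn: m3K => t; rewrite inE => /andP[tJ tK].
  by apply: (subsetP (v_lam3 vC tJ tK _)).
(* Every member other than I has either a larger [p] or a larger [q]; these values are distinct and
   lie in windows of length [a I] and [b I]. *)
have cT : (#|T| <= 2 * (a I) + 1)%N.
  have sub : T \subset I |: ([set J in T | (p I < p J)%N]
      :|: [set J in T | (q I < q J)%N]).
    apply/subsetP => J JT; rewrite !in_setU in_set1 [in X in _ || X]in_set [in X in _ || (_ || X)]in_set.
    have [//|neq] := eqVneq J I; rewrite JT/=.
    by case/orP: (v_inc vC (Trc _ JT) xI neq) => /andP[h1 h2]; rewrite ?h1 ?h2 ?orbT.
  apply: leq_trans (subset_leq_card sub) _.
  have := leq_card_setU [set I] ([set J in T | (p I < p J)%N]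
      :|: [set J in T | (q I < q J)%N]).
  have := leq_card_setU [set J in T | (p I < p J)%N] [set J in T | (q I < q J)%N].
  have h1 : (#|[set J in T | (p I < p J)%N]| <= a I)%N.
    apply: (@card_in_window _ _ (@p C) (p I)) => [J K|J].
      by rewrite inE => /andP[/Trc xJ _]; rewrite inE => /andP[/Trc xK _]; apply: p_inj xJ xK.
    by rewrite inE => /andP[/ple ->]; rewrite andbT.
  have h2 : (#|[set J in T | (q I < q J)%N]| <= b I)%N.
    apply: (@card_in_window _ _ (@q C) (q I)) => [J K|J].
      by rewrite inE => /andP[/Trc xJ _]; rewrite inE => /andP[/Trc xK _]; apply: q_inj xJ xK.
    by rewrite inE => /andP[/qle ->]; rewrite andbT.
  move: IV; rewrite inE => /andP[_ bI].
  by case=> le1 _ [le2 _]; move: le1 le2 h1 h2 bI; rewrite cards1; clear; lia.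
(* The position of J is its distance to the largest [q]; it is at most [b J] because the point is
   not far below J. *)
pose Q := \max_(J in T) q J.
have Qge J : J \in T -> (q J <= Q)%N by move=> JT; apply: (leq_bigmax_cond J JT).
apply: (sb _ T (@a C) (@b C) (fun J => Q - q J)%N).
  move=> J K JT KT eqQ; apply: (q_inj vC (Trc _ JT) (Trc _ KT)).
  by move: (Qge _ JT) (Qge _ KT) eqQ; clear; lia.
move=> J JT; split; first by move: (minI _ JT) cT; clear; lia.
have : (Q <= q J + b J)%N; last by clear; lia.
apply/bigmax_leqP => K KT; have := JT; rewrite inE => /andP[_]; rewrite inE.
move=> /andP[_ /and4P[xJb _ _ _]]; exact: base_belowN (Trc _ JT) (Trc _ KT) xJb.
Qed.

(** Rectangles whose cores share a point bound each other in both directions, so #T <= 2 a J + 2 b J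
    + 1 for each J. Hence #T is at most 4 (a J + 1) or at most 4 (b J + 1); the two classes are
    summed by [k1] and, with the directions exchanged, by [k2]. *)
Lemma good_estimate (C : config) (k1 k2 : R) : valid C -> sum_bound wt k1 ->
  sum_bound (fun m n => wt n m) k2 ->
  \sum_(J | @good C J) wt (a J) (b J) * #|@rc C J|%:R <=
  64%:R * (k1 + k2) * #|shc C|%:R.
Proof.
move=> vC sb1 sb2; rewrite -(eq_bigl _ _ (fun J => in_set _ J)).
apply: (@packing _ _ _ _ [set J | good J] (@core_part C)) => //.
- by move=> J _; apply/subsetP => x; rewrite inE => /andP[].
- by move=> J; rewrite inE.
- exact: addr_ge0 (sum_bound_ge0 sb1) (sum_bound_ge0 sb2).
move=> x; pose T := [set J in [set J | good J] | x \in core_part J].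
rewrite -(eq_bigl _ _ (fun J => in_set _ J)) -/T.
have Trc J : J \in T -> x \in rc J by rewrite inE => /andP[_]; rewrite inE => /andP[].
have Tle J K : J \in T -> K \in T ->
    (p K <= p J + 2 * a J)%N && (q K <= q J + 2 * b J)%N.
  rewrite inE => /andP[_]; rewrite inE => /andP[_ /forallP/(_ K) H] KT.
  by move: H; rewrite (Trc _ KT).
have cT J : J \in T -> (#|T| <= 2 * a J + 2 * b J + 1)%N.
  move=> JT.
  have sub : T \subset J |: ([set K in T | (p J < p K)%N]
      :|: [set K in T | (q J < q K)%N]).
    apply/subsetP => K KT; rewrite !in_setU in_set1 [in X in _ || X]in_set [in X in _ || (_ || X)]in_set.
    have [//|neq] := eqVneq K J; rewrite KT/=.
    by case/orP: (v_inc vC (Trc _ KT) (Trc _ JT) neq) => /andP[h1 h2]; rewrite ?h1 ?h2 ?orbT.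
  apply: leq_trans (subset_leq_card sub) _.
  have := leq_card_setU [set J] ([set K in T | (p J < p K)%N]
      :|: [set K in T | (q J < q K)%N]).
  have := leq_card_setU [set K in T | (p J < p K)%N] [set K in T | (q J < q K)%N].
  have h1 : (#|[set K in T | (p J < p K)%N]| <= 2 * a J)%N.
    apply: (@card_in_window _ _ (@p C) (p J)) => [K L|K].
      by rewrite inE => /andP[/Trc xJ _]; rewrite inE => /andP[/Trc xK _]; apply: p_inj xJ xK.
    by rewrite inE => /andP[KT ->]; have /andP[->] := Tle _ _ JT KT.
  have h2 : (#|[set K in T | (q J < q K)%N]| <= 2 * b J)%N.
    apply: (@card_in_window _ _ (@q C) (q J)) => [K L|K].
      by rewrite inE => /andP[/Trc xJ _]; rewrite inE => /andP[/Trc xK _]; apply: q_inj xJ xK.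
    by rewrite inE => /andP[KT ->]; have /andP[_ ->] := Tle _ _ JT KT.
  by case=> le1 _ [le2 _]; move: le1 le2 h1 h2; rewrite cards1; clear; lia.
pose Ta := [set J in T | (#|T| <= 4 * (a J).+1)%N].
pose Tb := [set J in T | (4 * (a J).+1 < #|T|)%N].
rewrite (bigID (fun J => (#|T| <= 4 * (a J).+1)%N))/=; apply: lerD.
  rewrite -(eq_bigl _ _ (fun J => in_set _ J)) -/Ta.
  have sT J : J \in Ta -> J \in T by rewrite inE => /andP[].
  have sub : (#|Ta| <= #|T|)%N by apply/subset_leq_card/subsetP.
  pose Q := \max_(J in Ta) q J.
  have Qge J : J \in Ta -> (q J <= Q)%N by move=> JT; apply: (leq_bigmax_cond J JT).
  apply: (sb1 _ Ta (@a C) (@b C) (fun J => Q - q J)%N) => [J K JT KT eqQ|J JT].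
    apply: (q_inj vC (Trc _ (sT _ JT)) (Trc _ (sT _ KT))).
    by move: (Qge _ JT) (Qge _ KT) eqQ; clear; lia.
  split; first by move: JT sub; rewrite in_set => /andP[_]; clear; lia.
  have : (Q <= q J + 2 * b J)%N; last by clear; lia.
  by apply/bigmax_leqP => K KT; have /andP[] := Tle _ _ (sT _ JT) (sT _ KT).
rewrite (eq_bigl (mem Tb)); last by move=> J; rewrite [RHS]inE/= ltnNge.
have sT J : J \in Tb -> J \in T by rewrite inE => /andP[].
have sub : (#|Tb| <= #|T|)%N by apply/subset_leq_card/subsetP.
pose P := \max_(J in Tb) p J.
have Pge J : J \in Tb -> (p J <= P)%N by move=> JT; apply: (leq_bigmax_cond J JT).
apply: (sb2 _ Tb (@b C) (@a C) (fun J => P - p J)%N) => [J K JT KT eqpP|J JT].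
  apply: (p_inj vC (Trc _ (sT _ JT)) (Trc _ (sT _ KT))).
  by move: (Pge _ JT) (Pge _ KT) eqpP; clear; lia.
split; first by have := cT _ (sT _ JT); move: sub JT; rewrite in_set => + /andP[_]; clear; lia.
have : (P <= p J + 2 * a J)%N; last by clear; lia.
by apply/bigmax_leqP => K KT; have /andP[] := Tle _ _ (sT _ JT) (sT _ KT).
Qed.

(** One direction suffices here: outside [far_above J], which leaves half of J, the distance from
    [p J] to the largest [p] at the point is at most [a J], and these distances are distinct. This
    serves the exponents with one of them zero. *)
Lemma one_sided_estimate (C : config) (k : R) : valid C ->
  (forall (V : finType) (T : {set V}) (a b j : V -> nat), {in T &, injective j} ->
    (forall J, J \in T -> (j J <= a J)%N) -> \sum_(J in T) wt (a J) (b J) <= k) ->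
  \sum_J wt (a J) (b J) * #|@rc C J|%:R <= 2%:R * k * #|shc C|%:R.
Proof.
move=> vC sb; rewrite (eq_bigl (fun J => J \in [set: U C])); last first.
  by move=> J; rewrite in_setT.
have k0 : 0 <= k.
  have := sb _ (set0 : {set unit}) (fun=> 0%N) (fun=> 0%N) (fun=> 0%N).
  by rewrite big_set0; apply => t; rewrite inE.
apply: (@packing _ _ _ _ setT (fun J => rc J :\: far_above J)) => //.
- by move=> J _; apply: subsetDl.
- move=> J _; have := v_above vC J; rewrite cardsD.
  have -> : rc J :&: far_above J = far_above J.
    by apply/setIidPr/subsetP => x; rewrite inE => /andP[].
  by move: #|rc J| #|far_above J|; clear; lia.
move=> x; pose T := [set J in [set: U C] | x \in rc J :\: far_above J].
rewrite -(eq_bigl _ _ (fun J => in_set _ J)) -/T.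
have Trc J : J \in T -> x \in rc J by rewrite inE => /andP[_]; rewrite in_setD => /andP[].
pose P := \max_(J in T) p J.
have Pge J : J \in T -> (p J <= P)%N by move=> JT; apply: (leq_bigmax_cond J JT).
apply: (sb _ T (@a C) (@b C) (fun J => P - p J)%N) => [J K JT KT eqpP|J JT].
  apply: (p_inj vC (Trc _ JT) (Trc _ KT)).
  by move: (Pge _ JT) (Pge _ KT) eqpP; clear; lia.
have : (P <= p J + a J)%N; last by clear; lia.
apply/bigmax_leqP => K KT; rewrite leqNgt; apply/negP => lt.
have := JT; rewrite inE => /andP[_]; rewrite in_setD => /andP[/negP xJ _].
apply: xJ; rewrite inE (Trc _ JT); apply/existsP; exists K.
by rewrite (Trc _ KT).
Qed.

End main_estimate.

(** * Exchange of the two directions *)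

Definition swap_config (C : config) : config := {|
  A1 := A2 C; A2 := A1 C; A3 := A3 C; U := U C;
  c1 := @c2 C; c2 := @c1 C; c3 := @c3 C;
  p := @q C; q := @p C; h := @h C; a := @b C; b := @a C |}.

Section swap.
Variable C : config.
Implicit Types I J : U C.

Let f (x : A2 C * A1 C * A3 C) : A1 C * A2 C * A3 C := (x.1.2, x.1.1, x.2).

Let fb : bijective f.
Proof. by exists (fun x => (x.1.2, x.1.1, x.2)) => [[[]]|[[]]]. Qed.

Let card_f (S : {set A1 C * A2 C * A3 C}) (S' : {set A2 C * A1 C * A3 C}) :
  (forall x, (x \in S') = (f x \in S)) -> #|S'| = #|S|.
Proof.
move=> eS; rewrite -(on_card_preimset (f := f)); last exact: onW_bij.
by apply: eq_card => x; rewrite eS inE.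
Qed.

Let mem_swap I x : (x \in @rc (swap_config C) I) = (f x \in rc I).
Proof. by rewrite !inE/= [(_ \in c2 I) && _]andbC. Qed.

Lemma card_rc_swap I : #|@rc (swap_config C) I| = #|rc I|.
Proof. by apply: card_f => x; rewrite mem_swap. Qed.

Lemma card_shc_swap : #|shc (swap_config C)| = #|shc C|.
Proof.
by apply: card_f => x; rewrite !in_set; apply: eq_existsb => I; rewrite mem_swap.
Qed.

Lemma good_swap I : @good (swap_config C) I = good I.
Proof.
rewrite /good card_rc_swap; congr (_ <= _ * _)%N; apply: card_f => x.
rewrite [LHS]in_set [RHS]in_set mem_swap; congr (_ && _).
by apply: eq_forallb => J; rewrite mem_swap; congr (_ ==> _); rewrite andbC.
Qed.

Lemma valid_swap : valid C -> valid (swap_config C).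
Proof.
case=> ne1 ne2 ne3 lam1 lam2 lam3 inc zyg ab be; split => //=.
- move=> I J x; rewrite !mem_swap => xI xJ /(inc _ _ _ xI xJ).
  by rewrite orbC [X in X || _]andbC [X in _ || X]andbC.
- by move=> I J /zyg; rewrite ![(q _ + _)%N]addnC.
- move=> I; rewrite card_rc_swap; apply: leq_trans (be I).
  rewrite leq_mul2l/= (card_f (S := far_below I))// => x.
  rewrite [LHS]in_set [RHS]in_set mem_swap; congr (_ && _).
  by apply: eq_existsb => J; rewrite mem_swap.
- move=> I; rewrite card_rc_swap; apply: leq_trans (ab I).
  rewrite leq_mul2l/= (card_f (S := far_above I))// => x.
  rewrite [LHS]in_set [RHS]in_set mem_swap; congr (_ && _).
  by apply: eq_existsb => J; rewrite mem_swap.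
Qed.

End swap.

(** The good rectangles give 64 (k1 + k2). The others give 8 k1 when e_2 <= e_1 and, after
    exchanging the directions, 8 k2 when e_1 < e_2. *)
Lemma config_estimate (R : realDomainType) (wt : nat -> nat -> R) (k1 k2 : R)
    (C : config) : (forall m n, 0 <= wt m n) ->
  valid C -> sum_bound wt k1 -> sum_bound (fun m n => wt n m) k2 ->
  \sum_J wt (a J) (b J) * #|@rc C J|%:R <= 72%:R * (k1 + k2) * #|shc C|%:R.
Proof.
move=> wt0 vC sb1 sb2; rewrite (bigID (@good C))/=.
rewrite [X in _ + X](bigID (fun J => b J <= a J)%N)/=.
have g := good_estimate wt0 vC sb1 sb2.
have n1 := nongood_estimate wt0 vC sb1.
have := nongood_estimate (fun m n => wt0 n m) (valid_swap vC) sb2.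
rewrite card_shc_swap => n2.
have n2' : \sum_(J | ~~ good J && ~~ (b J <= a J)%N) wt (a J) (b J) * #|@rc C J|%:R
    <= 8%:R * k2 * #|shc C|%:R.
  apply: le_trans n2; rewrite [X in _ <= X](eq_bigl (fun J => ~~ @good C J && (a J <= b J)%N)); last first.
    by move=> J; rewrite good_swap.
  under [X in _ <= X]eq_bigr do rewrite card_rc_swap.
  rewrite [X in _ <= X](bigID (fun J => b J <= a J)%N)/= addrC -[X in X <= _]addr0.
  apply: lerD.
    rewrite (eq_bigl (fun J => ~~ @good C J && (a J <= b J)%N && ~~ (b J <= a J)%N))//.
    by move=> J; rewrite -ltnNge; case: good => //=; case: ltngtP.
  by apply: sumr_ge0 => J _; rewrite mulr_ge0.
apply: le_trans (lerD g (lerD n1 n2')) _.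
by rewrite -!mulrDl -mulrDr -mulrDl -natrD.
Qed.
(** * The strong maximal function on finite products *)

Section weak_type.
Variable R : realFieldType.

(** The function takes values in [0,1] and is not just an indicator, because it will be the density
    of Omega on cells. The bound is required for all subfamilies since slicing selects a different
    one on each slice. *)
Definition weak_type (B : finType) (fam : {set {set B}}) (lambda K : R) :=
  forall (g : B -> R) (fam' : {set {set B}}), (forall x, 0 <= g x <= 1) ->
    fam' \subset fam ->
    (forall S, S \in fam' -> lambda * #|S|%:R <= \sum_(x in S) g x) ->
    #|cover fam'|%:R <= K * \sum_x g x.

Lemma laminar_subset (T : finType) (fam fam' : {set {set T}}) :
  laminar fam -> fam' \subset fam -> laminar fam'.
Proof. by move=> lam /subsetP sub S S' /sub Sf /sub S'f; apply: lam. Qed.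

Lemma laminar_weak_type (B : finType) (fam : {set {set B}}) (lambda : R) :
  laminar fam -> 0 < lambda -> weak_type fam lambda lambda^-1.
Proof.
move=> lam l0 g fam' g01 sub H; rewrite ler_pdivlMl//.
have := laminar_ler_sum (f := fun=> lambda) (g := g) (laminar_subset lam sub).
move=> /(_ _)/le_trans; rewrite sumr_const mulr_natr; apply.
  by move=> S SF; rewrite sumr_const -mulr_natr; apply: H.
rewrite [leRHS](bigID (mem (cover fam')))/= lerDl sumr_ge0// => x _.
by have /andP[] := g01 x.
Qed.

(* A rectangle S1 * S2 of density at least lambda has density at least mu on the
   slices through a proportion (lambda - mu) / (1 - mu) of S2. *)
Lemma weak_typeX (B A : finType) (famB : {set {set B}}) (famA : {set {set A}})
    (lambda mu K : R) : 0 <= K -> mu < lambda -> lambda < 1 ->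
  weak_type famB mu K -> laminar famA ->
  weak_type [set setX S1 S2 | S1 in famB, S2 in famA] lambda
    (K * ((1 - mu) / (lambda - mu))).
Proof.
move=> K0 ml l1 wB lam g fam' g01 sub H.
have lm0 : 0 < lambda - mu by rewrite subr_gt0.
have m1 : 0 < 1 - mu by rewrite subr_gt0 (lt_trans ml).
pose famy (y : A) := [set S1 in famB | mu * #|S1|%:R <= \sum_(x in S1) g (x, y)].
pose F := [set z : B * A | z.1 \in cover (famy z.2)].
have cF : #|F|%:R <= K * \sum_z g z.
  have -> : \sum_z g z = \sum_y \sum_x g (x, y).
    by rewrite exchange_big/= pair_bigA; apply: eq_bigr => -[].
  have -> : #|F|%:R = \sum_y #|cover (famy y)|%:R :> R.
    rewrite -natr_sum; congr _%:R; rewrite -sum1_card.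
    rewrite (eq_bigr (fun y => \sum_(x in cover (famy y)) 1)%N); last first.
      by move=> y _; rewrite sum1_card.
    rewrite pair_big_dep/= (reindex (fun z : B * A => (z.2, z.1))); last first.
      by exists (fun z => (z.2, z.1)) => [[]|[]].
    by apply: eq_bigl => z; rewrite inE.
  rewrite big_distrr/=; apply: ler_sum => y _; apply: wB => //.
    by apply/subsetP => S; rewrite inE => /andP[].
  by move=> S; rewrite inE => /andP[].
suff le : (lambda - mu) * #|cover fam'|%:R <= (1 - mu) * #|F|%:R.
  rewrite -(ler_pM2l lm0); apply: le_trans le _.
  rewrite -mulrA [(_ / _) * _]mulrC [leRHS]mulrC -!mulrA mulVf ?gt_eqF// mulr1.
  by rewrite mulrA [leRHS]mulrC ler_pM2l.
pose famx (x : B) := [set S2 in famA |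
  [exists S1 in famB, (x \in S1) && (setX S1 S2 \in fam')]].
have key x : (lambda - mu) * #|cover (famx x)|%:R <=
    (1 - mu) * #|[set y | (x, y) \in F]|%:R.
  have lamx : laminar (famx x).
    by apply: laminar_subset lam _; apply/subsetP => S; rewrite inE => /andP[].
  have := laminar_ler_sum (f := fun=> lambda - mu)
    (g := fun y => (1 - mu) * ((x, y) \in F)%:R) lamx.
  rewrite sumr_const mulr_natr => /(_ _)/le_trans; apply; last first.
    rewrite -big_distrr/= ler_wpM2l ?(ltW m1)//.
    rewrite -natr_sum ler_nat -sum1_card [leqRHS]big_mkcond/=.
    rewrite [leqLHS]big_mkcond/=; apply: leq_sum => y _.
    by rewrite inE; case: (y \in _); case: (_ \in F).
  move=> S2; rewrite inE => /andP[S2A /exists_inP[S1 S1B /andP[xS1 SF]]].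
  have := H _ SF; rewrite cardsX sumr_const -big_distrr/=.
  have n1 : (0 : R) < #|S1|%:R by rewrite ltr0n card_gt0; apply/set0Pn; exists x.
  move=> le; rewrite -mulr_natr.
  have e1 : \sum_(z in setX S1 S2) g z = \sum_(y in S2) \sum_(x0 in S1) g (x0, y).
    rewrite exchange_big/= pair_big/=; apply: eq_big => [[u v]|[u v] _] //.
    by rewrite in_setX.
  (* On a slice inside [F] the trivial bound g <= 1 is used; on any other slice, the density on [S1]
     is below [mu], as otherwise [S1] would put x into [F]. *)
  have le2 y : \sum_(x0 in S1) g (x0, y) <=
      #|S1|%:R * (mu + (1 - mu) * ((x, y) \in F)%:R).
    have [xyF|xyF] := boolP ((x, y) \in F).
      rewrite mulr1 addrC subrK mulr1 -sumr_const; apply: ler_sum => x0 _.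
      by have /andP[] := g01 (x0, y).
    rewrite mulr0 addr0 mulrC leNgt; apply: contra xyF => lt.
    by rewrite inE/=; apply/bigcupP; exists S1 => //; rewrite inE S1B ltW.
  have le3 : lambda * (#|S1| * #|S2|)%:R <= \sum_(y in S2)
      #|S1|%:R * (mu + (1 - mu) * ((x, y) \in F)%:R).
    by apply: le_trans le _; rewrite e1; apply: ler_sum => y _; apply: le2.
  move: le3; rewrite -big_distrr/= natrM mulrCA ler_pM2l// big_split/= sumr_const.
  by rewrite -big_distrr/= -[mu *+ _]mulr_natr [(lambda - mu) * _]mulrBl lerBlDl.
have cc : #|cover fam'|%:R <= \sum_x #|cover (famx x)|%:R :> R.
  rewrite -natr_sum ler_nat -sum1_card.
  rewrite [leqRHS](eq_bigr (fun x => \sum_(y in cover (famx x)) 1)%N); last first.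
    by move=> x _; rewrite sum1_card.
  rewrite pair_big_dep/= big_mkcond/= [leqRHS]big_mkcond/=; apply: leq_sum => -[x y] _.
  case: ifP => // /bigcupP[S SF]; have /imset2P[S1 S2 S1B S2A eS] := subsetP sub _ SF.
  rewrite eS in_setX => /andP[xS1 yS2]; rewrite ifT//=; apply/bigcupP; exists S2 => //.
  by rewrite inE S2A; apply/exists_inP; exists S1 => //; rewrite xS1 -eS.
apply: le_trans (ler_wpM2l (ltW lm0) cc) _.
rewrite big_distrr/=.
apply: (@le_trans _ _ (\sum_x (1 - mu) * #|[set y | (x, y) \in F]|%:R)).
  by apply: ler_sum => x _; apply: key.
rewrite -big_distrr/= ler_pM2l// -natr_sum ler_nat -[leqRHS]sum1_card.
rewrite (eq_bigr (fun x => \sum_(y | (x, y) \in F) 1)%N); last first.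
  by move=> x _; rewrite -sum1_card; apply: eq_bigl => y; rewrite inE.
by rewrite pair_big_dep/=; apply: eq_leq; apply: eq_bigl => -[].
Qed.

(** One factor is added at a time, and each addition lowers the level: from [lambda] to [mu] for the
    third factor, from [mu] to [nu] for the second, with the one-parameter bound at level [nu]. *)
Lemma box_weak_type (V T1 T2 T3 : finType) (b1 : V -> {set T1})
    (b2 : V -> {set T2}) (b3 : V -> {set T3}) (lambda mu nu : R)
    (g : T1 * T2 * T3 -> R) :
  0 < nu -> nu < mu -> mu < lambda -> lambda < 1 ->
  laminar [set b1 I | I in V] -> laminar [set b2 I | I in V] ->
  laminar [set b3 I | I in V] ->
  (forall x, 0 <= g x <= 1) ->
  (forall I, lambda * #|setX (setX (b1 I) (b2 I)) (b3 I)|%:R <=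
    \sum_(x in setX (setX (b1 I) (b2 I)) (b3 I)) g x) ->
  #|[set x | [exists I, x \in setX (setX (b1 I) (b2 I)) (b3 I)]]|%:R <=
    nu^-1 * ((1 - nu) / (mu - nu)) * ((1 - mu) / (lambda - mu)) * \sum_x g x.
Proof.
move=> n0 nm ml l1 lam1 lam2 lam3 g01 H.
have w1 := laminar_weak_type lam1 n0.
have w2 := weak_typeX (ltW _) nm (lt_trans ml l1) w1 lam2.
have K1 : 0 <= nu^-1 * ((1 - nu) / (mu - nu)).
  by rewrite !mulr_ge0 ?invr_ge0 ?subr_ge0 ?(ltW n0) ?(ltW nm)//
    (ltW (lt_trans nm (lt_trans ml l1))).
have := weak_typeX K1 ml l1 (w2 _) lam3; rewrite invr_gt0 => /(_ n0).
move=> /(_ g [set setX (setX (b1 I) (b2 I)) (b3 I) | I in V] g01) w3.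
have -> : [set x | [exists I, x \in setX (setX (b1 I) (b2 I)) (b3 I)]] =
    cover [set setX (setX (b1 I) (b2 I)) (b3 I) | I in V].
  apply/setP => x; rewrite inE; apply/existsP/bigcupP => [[I xI]|[_ /imsetP[I _ ->]]].
    by exists (setX (setX (b1 I) (b2 I)) (b3 I)) => //; apply/imsetP; exists I.
  by exists I.
apply: w3 => [|S /imsetP[I _ ->]]; last exact: H.
apply/subsetP => S /imsetP[I _ ->]; apply/imset2P.
exists (setX (b1 I) (b2 I)) (b3 I) => //; last by apply/imsetP; exists I.
by apply/imset2P; exists (b1 I) (b2 I) => //; apply/imsetP; exists I.
Qed.

End weak_type.

(* Greedy selection: a set is kept if an eighth of it is not covered by the sets
   kept before. *)
Lemma greedy_sparse (V T : finType) (r : V -> {set T}) :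
  exists (G : {set V}) (E : V -> {set T}),
  [/\ forall I, I \in G -> E I \subset r I /\ (#|r I| <= 8 * #|E I|)%N,
      forall I J, I \in G -> J \in G -> I != J -> [disjoint E I & E J]
    & forall I, (7 * #|r I| <= 8 * #|r I :&: \bigcup_(J in G) r J|)%N].
Proof.
suff /(_ (enum V))[G [E [h1 h2 h3]]] : forall s : seq V,
    exists (G : {set V}) (E : V -> {set T}),
    [/\ forall I, I \in G -> E I \subset r I /\ (#|r I| <= 8 * #|E I|)%N,
      forall I J, I \in G -> J \in G -> I != J -> [disjoint E I & E J]
    & forall I, I \in s ->
      (7 * #|r I| <= 8 * #|r I :&: \bigcup_(J in G) r J|)%N].
  by exists G, E; split => // I; apply: h3; rewrite mem_enum.
elim=> [|I s [G [E [h1 h2 h3]]]].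
  by exists set0, (fun=> set0); split => // I; rewrite inE.
set S := \bigcup_(J in G) r J.
have [big|small] := leqP #|r I| (8 * #|r I :\: S|); last first.
  exists G, E; split => // J; rewrite inE => /predU1P[->|]; last exact: h3.
  by move: small; rewrite -/S; have := cardsID S (r I); clear; lia.
have [IG|IG] := boolP (I \in G).
  exists G, E; split => // J; rewrite inE => /predU1P[->|]; last exact: h3.
  rewrite (setIidPl _); first by clear; lia.
  exact: bigcup_sup.
exists (I |: G), (fun J => if J == I then r I :\: S else E J).
have sE J : J \in G -> E J \subset S.
  by move=> JG; have [sub _] := h1 _ JG; apply: (subset_trans sub); apply: bigcup_sup.
have dS : [disjoint r I :\: S & S].
  by apply/pred0P => x /=; rewrite in_setD; case: (x \in S); rewrite ?andbF.
have neq J : J \in G -> (J == I) = false.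
  by move=> JG; apply: contraNF IG => /eqP <-.
split.
- move=> J /setU1P[->|JG]; first by rewrite eqxx subsetDl.
  by rewrite neq//; apply: h1.
- move=> J K /setU1P[->|JG] /setU1P[->|KG]; rewrite ?eqxx ?neq// => ne.
  + apply: disjointWr (sE _ KG) _; exact: dS.
  + apply: disjointWl (sE _ JG) _; rewrite disjoint_sym; exact: dS.
  + exact: h2.
move=> J; rewrite inE => /predU1P[->|/h3]; last first.
  move=> /leq_trans; apply; rewrite leq_mul2l/=; apply: subset_leq_card.
  apply/subsetP => x /setIP[xJ /bigcupP[K KG xK]]; rewrite in_setI xJ.
  by apply/bigcupP; exists K => //; rewrite setU1r.
rewrite (setIidPl _); first by clear; lia.
by apply: bigcup_sup; rewrite setU11.
Qed.

Lemma laminar_imset (V T : finType) (r : V -> {set T}) (l : V -> nat) :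
  (forall I J y, y \in r I -> y \in r J -> (l I <= l J)%N -> r I \subset r J) ->
  laminar [set r I | I in V].
Proof.
move=> H _ _ /imsetP[I _ ->] /imsetP[J _ ->] /set0Pn[y /setIP[yI yJ]].
by case/orP: (leq_total (l I) (l J)) => [/(H _ _ y yI yJ) ->//|/(H _ _ y yJ yI) ->];
  rewrite orbT.
Qed.

(** After the greedy selection, every rectangle is covered to 7/8 by the selected ones, so the
    weak-type bound applies to the indicator of their union. With the levels 7/8, 3/4, 1/2 each of
    the three factors of the constant is 2. *)
Lemma config_sparse (C : config) : valid C ->
  exists (G : {set U C}) (E : U C -> {set A1 C * A2 C * A3 C}),
  [/\ forall I, I \in G -> E I \subset rc I /\ (#|rc I| <= 8 * #|E I|)%N,
      forall I J, I \in G -> J \in G -> I != J -> [disjoint E I & E J]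
    & (#|shc C| <= 8 * #|\bigcup_(J in G) rc J|)%N].
Proof.
move=> vC; have [G [E [h1 h2 h3]]] := greedy_sparse (@rc C).
exists G, E; split => //; set S := \bigcup_(J in G) rc J.
have := @box_weak_type rat (U C) _ _ _ (@c1 C) (@c2 C) (@c3 C) (7 / 8) (3 / 4)
  (1 / 2) (fun x => (x \in S)%:R) isT isT isT isT
  (laminar_imset (v_lam1 vC)) (laminar_imset (v_lam2 vC)) (laminar_imset (v_lam3 vC)).
move=> /(_ _ _)/le_trans.
have -> : \sum_x (x \in S)%:R = #|S|%:R :> rat.
  by rewrite -natr_sum; congr _%:R; rewrite card_indicator.
have -> : (1 / 2)^-1 * ((1 - 1 / 2) / (3 / 4 - 1 / 2)) * ((1 - 3 / 4) / (7 / 8 - 3 / 4))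
  = 8%:R :> rat by [].
rewrite -natrM -(ler_nat rat); apply => [x|I|]; [by case: (x \in S)| |exact: lexx].
have -> : \sum_(x in rc I) (x \in S)%:R = #|rc I :&: S|%:R :> rat.
  rewrite -natr_sum -sum1_card big_mkcond/= [in RHS]big_mkcond/=; congr _%:R.
  by apply: eq_bigr => x _; rewrite in_setI; case: (x \in rc I); case: (x \in S).
rewrite mulrAC ler_pdivrMr// -!natrM ler_nat [(_ * 8)%N]mulnC; exact: h3.
Qed.
(* K1 * c2 I * c3 I is the enlargement of I that is not contained in the enlarged
   set: it is at most half covered by the family. *)
Lemma far_above_half (C : config) (I : U C) (K1 : {set A1 C}) :
  c1 I \subset K1 -> K1 != set0 ->
  (forall J y, y \in K1 -> y \in c1 J -> (p I + a I < p J)%N -> K1 \subset c1 J) ->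
  (2 * #|setX (setX K1 (c2 I)) (c3 I) :&: shc C|
    <= #|setX (setX K1 (c2 I)) (c3 I)|)%N ->
  (2 * #|far_above I| <= #|rc I|)%N.
Proof.
move=> sub; rewrite -card_gt0 => K0 lam half.
pose B : {set A2 C * A3 C} := [set y in setX (c2 I) (c3 I) | [exists J,
  [&& K1 :&: c1 J != set0, (p I + a I < p J)%N, y.1 \in c2 J & y.2 \in c3 J]]].
have s1 : far_above I \subset cyl23 (c1 I) B.
  apply/subsetP => -[[x1 x2] x3]; rewrite inE => /andP[+ /existsP[J /andP[]]].
  rewrite !inE/= -!andbA => /and3P[x1I x2I x3I] /and3P[x1J x2J x3J] lt.
  rewrite x1I x2I x3I/=; apply/existsP; exists J; rewrite lt x2J x3J !andbT.
  by apply/set0Pn; exists x1; rewrite inE x1J (subsetP sub).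
have s2 : cyl23 K1 B \subset setX (setX K1 (c2 I)) (c3 I) :&: shc C.
  apply/subsetP => -[[x1 x2] x3]; rewrite !inE/= => /andP[x1K].
  move=> /andP[/andP[x2I x3I] /existsP[J /and4P[/set0Pn[y]]]].
  rewrite inE => /andP[yK yJ] lt x2J x3J; rewrite x1K x2I x3I/=.
  apply/existsP; exists J; rewrite !inE/= x2J x3J !andbT.
  exact: (subsetP (lam _ _ yK yJ lt)).
have := subset_leq_card s2; have := subset_leq_card s1; move: half.
rewrite !card_cyl23 !cardsX; move: #|far_above I| #|_ :&: _| K0 => f u.
move: #|K1| #|c1 I| #|c2 I| #|c3 I| #|B| => k n1 n2 n3 c k0 h1 h2 h3.
have h4 : (2 * c <= n2 * n3)%N by rewrite -(leq_pmul2l k0); move: h1 h3; clear; lia.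
by have := leq_mul (leqnn n1) h4; move: h2; clear; lia.
Qed.

Lemma far_below_half (C : config) (I : U C) (K2 : {set A2 C}) :
  c2 I \subset K2 -> K2 != set0 ->
  (forall J y, y \in K2 -> y \in c2 J -> (q I + b I < q J)%N -> K2 \subset c2 J) ->
  (2 * #|setX (setX (c1 I) K2) (c3 I) :&: shc C|
    <= #|setX (setX (c1 I) K2) (c3 I)|)%N ->
  (2 * #|far_below I| <= #|rc I|)%N.
Proof.
move=> sub; rewrite -card_gt0 => K0 lam half.
pose B : {set A1 C * A3 C} := [set y in setX (c1 I) (c3 I) | [exists J,
  [&& K2 :&: c2 J != set0, (q I + b I < q J)%N, y.1 \in c1 J & y.2 \in c3 J]]].
have s1 : far_below I \subset cyl13 B (c2 I).
  apply/subsetP => -[[x1 x2] x3]; rewrite inE => /andP[+ /existsP[J /andP[]]].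
  rewrite !inE/= -!andbA => /and3P[x1I x2I x3I] /and3P[x1J x2J x3J] lt.
  rewrite x1I x2I x3I andbT/=; apply/existsP; exists J; rewrite lt x1J x3J !andbT.
  by apply/set0Pn; exists x2; rewrite inE x2J (subsetP sub).
have s2 : cyl13 B K2 \subset setX (setX (c1 I) K2) (c3 I) :&: shc C.
  apply/subsetP => -[[x1 x2] x3]; rewrite !inE/= => /andP[+ x2K].
  move=> /andP[/andP[x1I x3I] /existsP[J /and4P[/set0Pn[y]]]].
  rewrite inE => /andP[yK yJ] lt x1J x3J; rewrite x1I x2K x3I/=.
  apply/existsP; exists J; rewrite !inE/= x1J x3J !andbT.
  exact: (subsetP (lam _ _ yK yJ lt)).
have := subset_leq_card s2; have := subset_leq_card s1; move: half.
rewrite !card_cyl13 !cardsX; move: #|far_below I| #|_ :&: _| K0 => f u.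
move: #|K2| #|c1 I| #|c2 I| #|c3 I| #|B| => k n1 n2 n3 c k0 h1 h2 h3.
have h4 : (2 * c <= n1 * n3)%N by rewrite -(leq_pmul2l k0); move: h1 h3; clear; lia.
by have := leq_mul (leqnn n2) h4; move: h2; clear; lia.
Qed.
Require Import Defs.
From HB Require Import structures.
From mathcomp Require Import all_boot all_order all_algebra.
From mathcomp Require Import all_classical all_reals all_analysis.
From mathcomp Require Import measurable_realfun finmap zify ring lra.

Set Implicit Arguments.
Unset Strict Implicit.
Unset Printing Implicit Defensive.

Import Order.TTheory GRing.Theory Num.Theory.

Local Open Scope classical_set_scope.
Local Open Scope ring_scope.
(** * Sums of weights *)

(** Remove the element with the largest index: the remaining indices are distinct and smaller, so
    that index is at least [#|T| - 1]. *)
Lemma ler_sum_injective (R : numDomainType) (f : nat -> R) (V : finType)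
    (T : {set V}) (j : V -> nat) :
  (forall m n, (m <= n)%N -> f n <= f m) -> {in T &, injective j} ->
  \sum_(J in T) f (j J) <= \sum_(k < #|T|) f k.
Proof.
move=> fdec; have [n] := ubnP #|T|; elim: n T => // n IH T; rewrite ltnS => cT inj.
have [->|/set0Pn[J0 J0T]] := eqVneq T finset.set0; first by rewrite big_set0 cards0 big_ord0.
have [J JT maxJ] := @arg_maxnP _ J0 (fun J => J \in T) j J0T.
have cTJ : #|T| = #|T :\ J|.+1 by rewrite (cardsD1 J) JT.
rewrite (big_setD1 J)//= cTJ big_ord_recr/= addrC lerD//.
  apply: IH; first by rewrite -ltnS -cTJ.
  by move=> x y /setD1P[_ xT] /setD1P[_ yT]; apply: inj.
apply: fdec; apply: (@card_in_window _ _ (fun K => (j K).+1) 0).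
  move=> x y /setD1P[_ xT] /setD1P[_ yT] [] ; exact: inj.
move=> K /setD1P[KJ KT]; rewrite add0n /= ltn_neqAle.
rewrite [(j K <= _)%N]maxJ// andbT.
by apply: contra KJ => /eqP/inj ->.
Qed.

Section power_sums.
Variable R : realType.
Implicit Types (s t u : R) (n : nat).

(** Young's inequality for the product of (1-u)^s and 1 with the exponents 1/s and 1/(1-s). *)
Lemma bernoulli_powR s u : 0 < s < 1 -> 0 <= u <= 1 ->
  (1 - u) `^ s <= 1 - s * u.
Proof.
move=> /andP[s0 s1] /andP[u0 u1].
have := @conjugate_powR R ((1 - u) `^ s) 1 s^-1 (1 - s)^-1.
rewrite powR_ge0 ler01 !invr_gt0 s0 subr_gt0 s1 !invrK => /(_ erefl erefl erefl erefl).
rewrite addrC subrK => /(_ erefl).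
rewrite mulr1 -powRrM mulfV ?gt_eqF// powRr1 ?subr_ge0// powR1 mul1r.
by move=> /le_trans; apply; lra.
Qed.

Lemma powR_natS_le s n : 0 < s < 1 ->
  n%:R `^ s <= n.+1%:R `^ s * (1 - s / n.+1%:R) :> R.
Proof.
move=> s01; have n0 : (0 : R) < n.+1%:R by rewrite ltr0n.
have -> : n%:R = n.+1%:R * (1 - n.+1%:R^-1) :> R.
  by rewrite mulrBr mulr1 mulfV ?gt_eqF// -natr1 addrK.
have le1 : n.+1%:R^-1 <= 1 :> R by rewrite invf_le1// ler1n.
rewrite powRM ?subr_ge0//.
rewrite ler_wpM2l ?powR_ge0//; apply: bernoulli_powR => //.
by rewrite invr_ge0 ltW.
Qed.

(** The sum telescopes: by [powR_natS_le] the term (n+1)^(s-1) is at most ((n+1)^s - n^s)/s. *)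
Lemma sum_powR_le s n : 0 < s < 1 ->
  \sum_(k < n) k.+1%:R `^ (- (1 - s)) <= n%:R `^ s / s.
Proof.
move=> s01; have /andP[s0 s1] := s01.
elim: n => [|n IH]; first by rewrite big_ord0 divr_ge0 ?powR_ge0 ?ltW.
rewrite big_ord_recr/=; apply: le_trans (lerD IH (lexx _)) _.
have n0 : (0 : R) < n.+1%:R by rewrite ltr0n.
rewrite opprB powRB; last by rewrite (gt_eqF n0) implybT.
rewrite powRr1// -(ler_pM2r s0) mulrDl !divfK ?gt_eqF//.
by rewrite -lerBrDr (le_trans (powR_natS_le n s01))// mulrBr mulr1 mulrA mulrAC.
Qed.

Lemma sum_powR_bounded s : 1 < s ->
  exists C : R, forall n, \sum_(k < n) k.+1%:R `^ (- s) <= C.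
Proof.
(* Since 1 + t <= s, the terms are dominated by those with exponent 1 + t, which telescope against
   n^(-t)/t; t < 1 is needed for [powR_natS_le]. *)
move=> s1; pose t := Num.min (s - 1) 2^-1.
have t0 : 0 < t by rewrite lt_min subr_gt0 s1 invr_gt0 ltr0n.
have t1 : t < 1 by rewrite gt_min invf_lt1 ?ltr0n// ltr1n orbT.
have ts : 1 + t <= s by rewrite -lerBrDl ge_min lexx.
exists (1 + t^-1) => n.
suff H : \sum_(k < n.+1) k.+1%:R `^ (- s) <= 1 + t^-1 - n.+1%:R `^ (- t) / t.
  apply: (@le_trans _ _ (\sum_(k < n.+1) k.+1%:R `^ (- s))).
    by rewrite big_ord_recr/= lerDl powR_ge0.
  by apply: le_trans H _; rewrite gerBl divr_ge0 ?powR_ge0 ?ltW.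
elim: n => [|n IH].
  by rewrite big_ord_recl big_ord0 addr0 !powR1 mul1r addrK.
rewrite big_ord_recr/=; apply: le_trans (lerD IH (lexx _)) _.
have n0 : (0 : R) < n.+1%:R by rewrite ltr0n.
set N := n.+2; have N0 : (0 : R) < N%:R by rewrite ltr0n.
have le1 : N%:R `^ (- s) <= N%:R `^ (- t) / N%:R.
  rewrite -[X in _ / X]powRr1// -powRN -powRD; last first.
    by rewrite (gt_eqF N0) implybT.
  by apply: ler_powR; [rewrite ler1n|rewrite -opprD lerN2 addrC].
have le2 : N%:R `^ (- t) * (1 + t / N%:R) <= n.+1%:R `^ (- t).
  rewrite !powRN; have := @powR_natS_le t n.+1; rewrite t0 t1 => /(_ erefl).
  rewrite -/N; set x := t / N%:R; set X := N%:R `^ t; set Y := n.+1%:R `^ t => le.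
  have X0 : 0 < X by rewrite powR_gt0.
  have Y0 : 0 < Y by rewrite powR_gt0.
  rewrite mulrC ler_pdivrMr// mulrC ler_pdivlMr//.
  have x0 : 0 <= x by rewrite divr_ge0 ?ltW.
  (* The bound on Y = (n+1)^t by X (1 - x) passes to reciprocals because (1 + x)(1 - x) <= 1. *)
  apply: le_trans (_ : (1 + x) * (X * (1 - x)) <= _).
    by rewrite ler_wpM2l// addr_ge0.
  by rewrite mulrCA -[leRHS]mulr1 ler_wpM2l ?(ltW X0)// mulrC -subr_sqr expr1n gerBl sqr_ge0.
rewrite -(ler_pM2r t0).
have -> : (1 + t^-1 - n.+1%:R `^ (- t) / t + N%:R `^ (- s)) * t =
    t + 1 - n.+1%:R `^ (- t) + N%:R `^ (- s) * t by rewrite !(mulrDl, mulNr) mulVf ?divfK ?gt_eqF// mul1r.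
have -> : (1 + t^-1 - N%:R `^ (- t) / t) * t = t + 1 - N%:R `^ (- t).
  by rewrite !(mulrDl, mulNr) mulVf ?divfK ?gt_eqF// mul1r.
have le3 : N%:R `^ (- s) * t <= N%:R `^ (- t) / N%:R * t by rewrite ler_wpM2r// ltW.
move: le2 le3; rewrite mulrDr mulr1 mulrA [_ / N%:R * t]mulrAC; clear; lra.
Qed.

Lemma weight_ge0 s t m n : 0 <= weight s t m n.
Proof. by rewrite mulr_ge0 ?powR_ge0. Qed.

Lemma powRN_nonincreasing s x y : 0 <= s -> 0 < x <= y -> y `^ (- s) <= x `^ (- s).
Proof.
move=> s0 /andP[x0 xy]; have y0 := lt_le_trans x0 xy.
rewrite !powRN lef_pV2 ?posrE ?powR_gt0//.
by apply: ge0_ler_powR => //; rewrite nnegrE ltW.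
Qed.

(** From a J + 1 >= #T/4 and b J + 1 >= (j J + 1)/2, the sum is at most (#T/4)^(-s) 2^(1-s) times
    the sum of k^(s-1) over 1 <= k <= #T, which is at most (#T)^s/s. The powers of #T cancel and 4^s
    2^(1-s) <= 4. *)
Lemma weight_sum_bound s : 0 < s < 1 -> sum_bound (weight s (1 - s)) (4 / s).
Proof.
move=> s01 V T a b j inj H; have /andP[s0 s1] := s01.
have [->|T0] := eqVneq T finset.set0; first by rewrite big_set0 divr_ge0 ?ltW.
have cT : (0 : R) < #|T|%:R by rewrite ltr0n card_gt0.
have cs : 0 <= 1 - s by rewrite subr_ge0 ltW.
pose f k := k.+1%:R `^ (- (1 - s)) : R.
have fdec m n : (m <= n)%N -> f n <= f m.
  by move=> mn; apply: powRN_nonincreasing; rewrite // ltr0n ler_nat/= ltnS mn.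
apply: (@le_trans _ _ (\sum_(J in T)
    ((#|T|%:R / 4) `^ (- s) * 2^-1 `^ (- (1 - s))) * f (j J))).
  apply: ler_sum => J /H[h1 h2]; rewrite -mulrA; apply: ler_pM; rewrite ?powR_ge0//.
    apply: powRN_nonincreasing; first exact: ltW.
    by rewrite divr_gt0//= ler_pdivrMr// -natrM ler_nat mulnC.
  rewrite -powRM//; apply: powRN_nonincreasing => //.
  by rewrite mulr_gt0//= mulrC ler_pdivrMr// -natrM ler_nat; lia.
rewrite -big_distrr/=.
apply: (@le_trans _ _ ((#|T|%:R / 4) `^ (- s) * 2^-1 `^ (- (1 - s)) *
    (#|T|%:R `^ s / s))).
  rewrite ler_wpM2l// ?mulr_ge0 ?powR_ge0//.
  exact: le_trans (ler_sum_injective fdec inj) (sum_powR_le _ s01).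
have -> : (#|T|%:R / 4) `^ (- s) = (#|T|%:R `^ s)^-1 * 4 `^ s.
  by rewrite powRM// powRN; congr (_ * _); rewrite -powR_inv1// -powRrM mulrNN mul1r.
have -> : 2^-1 `^ (- (1 - s)) = 2 `^ (1 - s) :> R.
  by rewrite -powR_inv1// -powRrM mulrNN mul1r.
have -> : (#|T|%:R `^ s)^-1 * 4 `^ s * 2 `^ (1 - s) * (#|T|%:R `^ s / s) =
    4 `^ s * 2 `^ (1 - s) / s.
  by rewrite mulrA; congr (_ / s); rewrite -!mulrA mulrC -!mulrA mulfV ?mulr1// gt_eqF// powR_gt0.
rewrite ler_pM2r ?invr_gt0//.
apply: (@le_trans _ _ (4 `^ s * 4 `^ (1 - s))).
  rewrite ler_wpM2l ?powR_ge0// ge0_ler_powR// ?nnegrE//; lra.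
by rewrite -powRD ?pnatr_eq0 ?implybT// subrKC powRr1.
Qed.

Lemma weight_sum_bound_swap s : 0 < s < 1 ->
  sum_bound (fun m n => weight s (1 - s) n m) (4 / (1 - s)).
Proof.
move=> s01; have s01' : 0 < 1 - s < 1 by move/andP: s01 => []; lra.
move=> V T a b j inj H; apply: le_trans (weight_sum_bound s01' inj H).
by apply: ler_sum => J _; rewrite /weight subKr mulrC.
Qed.

Lemma weight_le s t s' t' m n : s' <= s -> t' <= t -> weight s t m n <= weight s' t' m n.
Proof.
by move=> hs ht; apply: ler_pM; rewrite ?powR_ge0// ler_powR ?ler1n// lerN2.
Qed.

Lemma one_sided_weight s : 1 < s -> exists k : R,
  forall (V : finType) (T : {set V}) (a b j : V -> nat), {in T &, injective j} ->
    (forall J, J \in T -> (j J <= a J)%N) ->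
    \sum_(J in T) weight s 0 (a J) (b J) <= k.
Proof.
move=> s1; have [k kP] := sum_powR_bounded s1; exists k => V T a b j inj H.
have s0 : 0 <= s by lra.
apply: le_trans (kP #|T|); pose f k := k.+1%:R `^ (- s) : R.
apply: le_trans (_ : \sum_(J in T) f (j J) <= _).
  apply: ler_sum => J /H ja; rewrite /weight oppr0 powRr0 mulr1.
  by apply: powRN_nonincreasing => //; rewrite ltr0n ler_nat/= ltnS.
apply: (ler_sum_injective (f := f)) => // m n mn.
by apply: powRN_nonincreasing => //; rewrite ltr0n ler_nat/= ltnS mn.
Qed.

Lemma harmonic_unbounded C : ~ forall n, \sum_(k < n) k.+1%:R^-1 <= C :> R.
Proof.
move=> H; apply: (@dvg_harmonic R); apply: nondecreasing_is_cvgn.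
  by apply: nondecreasing_series => n _ _; apply: harmonic_ge0.
by exists C => _ [n _ <-]; rewrite seriesEord; apply: H.
Qed.

(** Each term is at least (n+1)^(-(s+t)), so the sum is at least (n+1)^(1-s-t), which is unbounded
    for s + t < 1. At the two excluded points the sum is harmonic. *)
Lemma weight_antidiagonal s t C : 0 <= s -> 0 <= t ->
  (forall n, \sum_(k < n.+1) weight s t (n - k) k <= C) ->
  [/\ 1 <= s + t, (s, t) <> (1, 0) & (s, t) <> (0, 1)].
Proof.
move=> s0 t0 H; split.
- rewrite leNgt; apply/negP => st; pose u := 1 - (s + t).
  have u0 : 0 < u by rewrite subr_gt0.
  have H' n : n.+1%:R `^ u <= C.
    apply: le_trans (H n).
    apply: le_trans (_ : \sum_(k < n.+1) n.+1%:R `^ (- (s + t)) <= _).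
      rewrite sumr_const card_ord -[leRHS]mulr_natl -[X in _ <= X * _]powRr1// -powRD//.
      by rewrite pnatr_eq0 implybT.
    apply: ler_sum => k _; rewrite opprD powRD ?pnatr_eq0 ?implybT//.
    apply: ler_pM; rewrite ?powR_ge0//; apply: powRN_nonincreasing => //;
      rewrite ltr0n ler_nat/= ltnS //; [exact: leq_subr|exact: leq_ord].
  have C0 : 0 <= C by apply: le_trans (H' 0%N); apply: powR_ge0.
  (* For this n one has n + 1 > C^(1/u), hence (n+1)^u > C. *)
  have := H' (Num.trunc (C `^ u^-1)); apply/negP; rewrite -ltNge.
  rewrite -[ltLHS]powRr1// -[X in C `^ X](mulVf (lt0r_neq0 u0)) powRrM.
  apply: gt0_ltr_powR => //; rewrite ?nnegrE ?powR_ge0//.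
  exact: truncnS_gt.
- move=> [s1 t1]; apply: (@harmonic_unbounded C) => -[|n].
    by apply: le_trans (H 0%N); rewrite big_ord0 sumr_ge0// => k _; apply: weight_ge0.
  apply: le_trans (H n); rewrite (reindex_inj rev_ord_inj)/=; apply: ler_sum => k _.
  by rewrite subSS /weight s1 t1 oppr0 powRr0 mulr1 powR_inv1.
- move=> [s1 t1]; apply: (@harmonic_unbounded C) => -[|n].
    by apply: le_trans (H 0%N); rewrite big_ord0 sumr_ge0// => k _; apply: weight_ge0.
  apply: le_trans (H n); apply: ler_sum => k _.
  by rewrite /weight s1 t1 oppr0 powRr0 mul1r powR_inv1.
Qed.

End power_sums.
(** * Dyadic cubes *)

Section cubes_theory.
Variables (R : realType) (d : nat).
Implicit Types (P Q : cube R d) (x : euclid R d).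

Lemma side_gt0 Q : 0 < side Q.
Proof. exact: exprz_gt0. Qed.

Lemma ler_side P Q : (side P <= side Q) = (P.1 <= Q.1).
Proof. by rewrite /side ler_eXz2l// ltr1n. Qed.

Lemma cube_corner Q : cube_set Q Q.2.
Proof. by move=> i; rewrite lexx/= ltrDl side_gt0. Qed.

Lemma measurable_cube Q : measurable (cube_set Q).
Proof.
have -> : cube_set Q = [set x : euclid R d | forall i,
    `[tnth Q.2 i, tnth Q.2 i + side Q[%classic (tnth x i)].
  by apply/seteqP; split => x H i; have := H i; rewrite /= in_itv.
by apply: (@measurable_box R d (fun i => `[tnth Q.2 i, tnth Q.2 i + side Q[%classic)) => i.
Qed.

Lemma lebesgue_cube Q : lebesgue_euclid d (cube_set Q) = (side Q ^+ d)%:E.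
Proof.
have -> : cube_set Q = [set x : euclid R d | forall i,
    `[tnth Q.2 i, tnth Q.2 i + side Q[%classic (tnth x i)].
  by apply/seteqP; split => x H i; have := H i; rewrite /= in_itv.
rewrite (@lebesgue_euclid_box R d (fun i => `[tnth Q.2 i, tnth Q.2 i + side Q[%classic))//.
rewrite (eq_bigr (fun=> (side Q)%:E)); last first.
  move=> i _; rewrite lebesgue_measure_itv/= lte_fin ltrDl side_gt0.
  by rewrite -EFinD addrC addKr.
by rewrite prodEFin prodr_const card_ord.
Qed.

Hypothesis d_gt0 : (0 < d)%N.

(** If P were longer than Q, moving one coordinate of the corner of P to the right end of Q, or
    keeping it if it is already beyond, would give a point of P outside Q. This requires a
    coordinate to exist. *)
Lemma cube_sub_level P Q : cube_set P `<=` cube_set Q -> P.1 <= Q.1.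
Proof.
move=> PQ; rewrite -ler_side leNgt; apply/negP => lt.
pose i0 := Ordinal d_gt0.
have /andP[c1 _] := PQ _ (cube_corner P) i0.
pose v := Num.max (tnth P.2 i0) (tnth Q.2 i0 + side Q).
pose y : euclid R d := [tuple if i == i0 then v else tnth P.2 i | i < d].
have yP : cube_set P y.
  move=> i; rewrite tnth_mktuple; case: eqP => [->|_]; last first.
    by rewrite lexx ltrDl side_gt0.
  by rewrite /v le_max lexx/= gt_max ltrDl side_gt0/= ler_ltD.
have /andP[_] := PQ _ yP i0.
by rewrite tnth_mktuple eqxx /v gt_max ltxx andbF.
Qed.

Variables (D : set (cube R d)) (gD : dyadic_grid D).

Lemma grid_eq P Q x : D P -> D Q -> P.1 = Q.1 -> cube_set P x -> cube_set Q x ->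
  P = Q.
Proof.
move=> DP DQ e Px Qx; have [M [_ uM]] := grid_partition gD P.1 x.
by rewrite -(uM P)// -(uM Q).
Qed.

Lemma grid_sub P Q x : D P -> D Q -> P.1 <= Q.1 -> cube_set P x -> cube_set Q x ->
  cube_set P `<=` cube_set Q.
Proof.
move=> DP DQ le Px Qx; have [e|//|QP] := grid_nested gD DP DQ.
  by have : (cube_set P `&` cube_set Q) x by []; rewrite e.
have e : P.1 = Q.1 by apply/eqP; rewrite eq_le le cube_sub_level.
by rewrite (grid_eq DP DQ e Px Qx).
Qed.

Lemma grid_at (k : int) x : exists P, [/\ D P, P.1 = k & cube_set P x].
Proof. by have [M [H _]] := grid_partition gD k x; exists M. Qed.

Lemma ancestorP k Q : D Q -> [/\ D (ancestor D k Q),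
  (ancestor D k Q).1 = Q.1 + k%:Z & cube_set Q `<=` cube_set (ancestor D k Q)].
Proof.
move=> DQ; pose H := [set P | [/\ D P, side P = 2 ^+ k * side Q
  & cube_set Q `<=` cube_set P]].
have [M [DM lM Mx]] := grid_at (Q.1 + k%:Z) Q.2.
have : H (ancestor D k Q).
  apply: xgetPex; exists M; split => //.
    by rewrite /side lM expfzDr ?pnatr_eq0// mulrC.
  by apply: (grid_sub DQ DM _ (cube_corner Q) Mx); rewrite lM lerDl.
move=> [h1 h2 h3]; split => //.
have : side (ancestor D k Q) = (2 : R) ^ (Q.1 + k%:Z).
  by rewrite h2 expfzDr ?pnatr_eq0// mulrC.
move=> e; apply/eqP; rewrite eq_le -!(@ler_eXz2l R 2) ?ltr1n//.
by move: e; rewrite /side => ->; rewrite lexx.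
Qed.

Definition subcubes (k : int) Q := [set P | [/\ D P, P.1 = k & cube_set P `<=` cube_set Q]].

Lemma trivIset_subcubes k Q : trivIset (subcubes k Q) (@cube_set R d).
Proof.
by move=> P P' [DP lP _] [DP' lP' _] [x [Px P'x]]; apply: (grid_eq DP DP' _ Px P'x); rewrite lP.
Qed.

(** Subcubes of one level are disjoint and have equal volume, so their number is bounded by a ratio
    of volumes. *)
Lemma finite_subcubes k Q : finite_set (subcubes k Q).
Proof.
apply: contrapT => inf.
pose s : R := (2 ^ k) ^+ d.
have s0 : 0 < s by rewrite exprn_gt0// exprz_gt0.
pose n := (Num.trunc (side Q ^+ d / s)).+1.
have [X XS nX] := infinite_set_fset n inf.
have : (lebesgue_euclid d (\bigcup_(P in [set` X]) cube_set P) <=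
    lebesgue_euclid d (cube_set Q))%E.
  apply: le_measure.
  - by apply: mem_set; apply: fin_bigcup_measurable => // P _; apply: measurable_cube.
  - exact: mem_set (measurable_cube Q).
  - by move=> x [P XP Px]; have [_ _] := XS _ XP; apply.
rewrite measure_fin_bigcup//; last 2 first.
- by apply: (sub_trivIset XS); apply: trivIset_subcubes.
- by move=> P _; apply: measurable_cube.
rewrite fsbig_finite// set_fsetK lebesgue_cube.
rewrite (eq_big_seq (fun=> s%:E)); last first.
  by move=> P /XS [_ lP _]; apply: etrans (lebesgue_cube P) _; rewrite /side lP.
rewrite sumEFin lee_fin big_const_seq count_predT iter_addr addr0 => le.
have : side Q ^+ d / s < n%:R by exact: truncnS_gt.
rewrite ltr_pdivrMr// mulr_natl; apply/negP; rewrite -leNgt.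
apply: le_trans le; rewrite -!(mulr_natl s) ler_pM2r// ler_nat.
exact: nX.
Qed.

Lemma cube_subcubes (k : int) Q : D Q -> k <= Q.1 ->
  cube_set Q = \bigcup_(P in subcubes k Q) cube_set P.
Proof.
move=> DQ le; apply/seteqP; split => [x Qx|x [P [_ _]]]; last exact.
have [P [DP lP Px]] := grid_at k x; exists P => //; split => //.
by apply: (grid_sub DP DQ _ Px Qx); rewrite lP.
Qed.

(** A cube of the grid is determined by its level and any rational point in it. *)
Lemma countable_grid : countable D.
Proof.
have ex (P : cube R d) : exists x : d.-tuple rat,
    cube_set P [tuple ratr (tnth x i) | i < d].
  have H i : exists r : rat, tnth P.2 i <= ratr r < tnth P.2 i + side P.
    have lt : tnth P.2 i < tnth P.2 i + side P by rewrite ltrDl side_gt0.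
    have [r] := rat_in_itvoo lt; rewrite in_itv/= => /andP[h1 h2].
    by exists r; rewrite h2 ltW.
  have [f fP] := choice H.
  by exists [tuple f i | i < d] => i; rewrite !tnth_mktuple.
have [f fP] := choice ex.
apply/countable_injP; exists (fun P => @choice.pickle (int * d.-tuple rat)%type (P.1, f P)) => P Q.
move=> /set_mem DP /set_mem DQ /(pcan_inj (@choice.pickleK _)) [e1 e2].
by apply: (grid_eq DP DQ e1 (fP P)); rewrite e2; apply: fP.
Qed.

(** The cells are the grid cubes, at one level k not above any listed cube, that lie in some listed
    cube. *)
Lemma grid_cells (qs : seq (cube R d)) : (forall Q, Q \in qs -> D Q) ->
  exists (A : finType) (cell : A -> cube R d) (k : int)
      (c : cube R d -> {set A}),
    [/\ forall t, D (cell t) /\ (cell t).1 = k, injective cell,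
        forall Q, Q \in qs -> k <= Q.1,
        forall Q, Q \in qs ->
          cube_set Q = \bigcup_(t in [set` c Q]) cube_set (cell t)
      & forall Q t, t \in c Q <-> cube_set (cell t) `<=` cube_set Q].
Proof.
move=> Dqs.
have [k kle] : exists k : int, forall Q, Q \in qs -> k <= Q.1.
  elim: qs {Dqs} => [|Q qs [k H]]; first by exists 0.
  exists (Num.min k Q.1) => P; rewrite inE => /predU1P[->|/H].
    by rewrite ge_min lexx orbT.
  by rewrite ge_min => ->.
pose X := \bigcup_(Q in [set` qs]) subcubes k Q.
have fX : finite_set X by apply: bigcup_finite => // Q _; apply: finite_subcubes.
pose A : finType := fset_set X.
pose cell (t : A) : cube R d := val t.
have cellP (t : A) : X (cell t).
  by have := valP t; rewrite in_fset_set// => /set_mem.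
exists A, cell, k, (fun Q => [set t | `[< cube_set (cell t) `<=` cube_set Q >]]%SET).
split.
- by move=> t; have [Q _ []] := cellP t.
- exact: val_inj.
- exact: kle.
- move=> Q Qqs; rewrite [LHS](cube_subcubes (Dqs _ Qqs) (kle _ Qqs)).
  apply/seteqP; split => x [].
    move=> P SP Px; have XP : P \in fset_set X.
      by rewrite in_fset_set//; apply: mem_set; exists Q.
    exists [` XP]%fset => //=; rewrite inE; apply/asboolP.
    by have [] := SP.
  move=> t /=; rewrite inE => /asboolP sub tx; exists (cell t) => //.
  by have [Q' _ [? ? _]] := cellP t.
- by move=> Q t; rewrite inE; split => [/asboolP|/asboolP].
Qed.

End cubes_theory.

(** * Volumes of unions of cells *)

Lemma measure_cells dT (T : measurableType dT) (R : realType)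
    (mu : {measure set T -> \bar R}) (A : finType) (cell : A -> set T) (v : R)
    (X : {set A}) : (forall t, measurable (cell t)) -> trivIset setT cell ->
  (forall t, mu (cell t) = v%:E) ->
  measurable (\bigcup_(t in [set` X]) cell t) /\
  mu (\bigcup_(t in [set` X]) cell t) = (#|X|%:R * v)%:E.
Proof.
move=> mc tr vc; have eX : [set` X] = [set` enum X].
  by apply/seteqP; split => t /=; rewrite mem_enum.
split; first by apply: fin_bigcup_measurable => // t _; apply: mc.
rewrite measure_fin_bigcup//; last by apply: sub_trivIset tr.
rewrite eX -fsbig_seq ?enum_uniq// (eq_bigr (fun=> v%:E)) => [|t _]; last exact: vc.
by rewrite sumEFin big_const_seq count_predT iter_addr addr0 -cardE mulr_natl.
Qed.

(** The levels [l] are counted from the common cell level [k]. The number of cells in a cube is read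
    off by comparing volumes, and inclusions of cubes become inclusions of finite sets. *)
Lemma grid_model (R : realType) (d : nat) (D : set (cube R d))
    (qs : seq (cube R d)) : (0 < d)%N -> dyadic_grid D ->
  (forall Q, Q \in qs -> D Q) ->
  exists (A : finType) (cell : A -> set (euclid R d)) (v : R) (k : int)
      (c : cube R d -> {set A}) (l : cube R d -> nat),
    [/\ [/\ forall t, measurable (cell t),
            forall t, lebesgue_euclid d (cell t) = v%:E, 0 < v
          & trivIset setT cell],
        forall Q, Q \in qs -> (l Q)%:Z = Q.1 - k,
        forall Q, Q \in qs -> cube_set Q = \bigcup_(t in [set` c Q]) cell t
          /\ #|c Q| = ((2 ^ d) ^ l Q)%N,
        forall P Q, cube_set P `<=` cube_set Q -> c P \subset c Q
      & forall P Q y, P \in qs -> Q \in qs -> y \in c P -> y \in c Q ->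
          (l P <= l Q)%N -> c P \subset c Q].
Proof.
move=> d0 gD Dqs; have [A [cell [k [c [cellP cell_inj kle cE cP]]]]] :=
  grid_cells d0 gD Dqs.
pose l (Q : cube R d) := `|Q.1 - k|%N.
have lE Q : Q \in qs -> (l Q)%:Z = Q.1 - k.
  by move=> Qqs; rewrite /l gez0_abs// subr_ge0 kle.
have sub P Q : cube_set P `<=` cube_set Q -> c P \subset c Q.
  by move=> PQ; apply/fintype.subsetP => t /cP tP; apply/cP => x /tP /PQ.
pose s : R := (2 ^ k) ^+ d.
have s0 : 0 < s by rewrite exprn_gt0// exprz_gt0.
have vol t : lebesgue_euclid d (cube_set (cell t)) = s%:E.
  by rewrite lebesgue_cube /side; have [_ ->] := cellP t.
have tr : trivIset setT (fun t => cube_set (cell t)).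
  move=> t t' _ _ [x [tx t'x]]; apply: cell_inj.
  have [D1 l1] := cellP t; have [D2 l2] := cellP t'.
  by apply: (grid_eq gD D1 D2 _ tx t'x); rewrite l1.
exists A, (fun t => cube_set (cell t)), s, k, c, l; split => //.
- by split => // t; apply: measurable_cube.
- move=> Q Qqs; split; first exact: cE.
  have : lebesgue_euclid d (cube_set Q) = (#|c Q|%:R * s)%:E.
    rewrite (cE _ Qqs).
    by apply: (measure_cells (mu := lebesgue_euclid d) (c Q) _ tr vol).2 => t;
      apply: measurable_cube.
  rewrite lebesgue_cube => -[e]; have sn0 : s != 0 by rewrite gt_eqF.
  apply/eqP; rewrite -(eqr_nat R); apply/eqP/(mulIf sn0); rewrite -e /side.
  have -> : Q.1 = k + (l Q)%:Z by rewrite lE// subrKC.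
  by rewrite expfzDr ?pnatr_eq0// exprMn mulrC !natrX -!exprM [(l Q * d)%N]mulnC.
- move=> P Q y Pqs Qqs yP yQ le; apply: sub.
  have [x tx] : exists x, cube_set (cell y) x by exists (cell y).2; apply: cube_corner.
  apply: (grid_sub d0 gD (Dqs _ Pqs) (Dqs _ Qqs) _ (proj1 (cP _ _) yP _ tx)
    (proj1 (cP _ _) yQ _ tx)).
  by move: le; rewrite -lez_nat !lE// lerD2r.
Qed.

(** * Finite models of the two settings *)

Section models.
Variables (R : realType) (S : rectangle_setting R).

(* The rectangles of rs are unions of disjoint cells of the same volume, indexed
   by a product of three finite sets. *)
Record model (rs : seq (rect S)) := Model {
  m1 : finType; m2 : finType; m3 : finType;
  cell : m1 * m2 * m3 -> set (Defs.space S); cv : R;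
  b1 : rect S -> {set m1}; b2 : rect S -> {set m2}; b3 : rect S -> {set m3};
  l1 : rect S -> nat; l2 : rect S -> nat; l3 : rect S -> nat;
  N1 : nat; N2 : nat; N3 : nat;
  cell_measurable : forall x, measurable (cell x);
  cell_vol : forall x, vol S (cell x) = cv%:E;
  cv_gt0 : 0 < cv;
  cell_trivIset : trivIset setT cell;
  rect_cells : forall r, r \in rs ->
    rect_set r = \bigcup_(x in [set` finset.setX (finset.setX (b1 r) (b2 r)) (b3 r)]) cell x;
  N_gt1 : [/\ (1 < N1)%N, (1 < N2)%N & (1 < N3)%N];
  card_b : forall r, r \in rs ->
    [/\ #|b1 r| = (N1 ^ l1 r)%N, #|b2 r| = (N2 ^ l2 r)%N
      & #|b3 r| = (N3 ^ l3 r)%N];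
  lam1 : forall r r' y, r \in rs -> r' \in rs -> y \in b1 r -> y \in b1 r' ->
    (l1 r <= l1 r')%N -> b1 r \subset b1 r';
  lam2 : forall r r' y, r \in rs -> r' \in rs -> y \in b2 r -> y \in b2 r' ->
    (l2 r <= l2 r')%N -> b2 r \subset b2 r';
  lam3 : forall r r' y, r \in rs -> r' \in rs -> y \in b3 r -> y \in b3 r' ->
    (l3 r <= l3 r')%N -> b3 r \subset b3 r';
  up1P : forall k r, r \in rs -> up1 k r \in rs ->
    [/\ b1 r \subset b1 (up1 k r), b2 (up1 k r) = b2 r, b3 (up1 k r) = b3 r
      & l1 (up1 k r) = (l1 r + k)%N];
  up2P : forall k r, r \in rs -> up2 k r \in rs ->
    [/\ b2 r \subset b2 (up2 k r), b1 (up2 k r) = b1 r, b3 (up2 k r) = b3 r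
      & l2 (up2 k r) = (l2 r + k)%N];
  rect_mono : forall r r', r \in rs -> r' \in rs -> rectangles r ->
    rectangles r' -> (l1 r <= l1 r')%N -> (l2 r <= l2 r')%N -> (l3 r <= l3 r')%N;
  rect_area : forall r r', r \in rs -> r' \in rs -> rectangles r ->
    rectangles r' -> (l3 r' < l3 r)%N -> (l1 r' + l2 r' <= l1 r + l2 r)%N }.

End models.

Arguments cell {R S rs} M x : rename.
Arguments cell_measurable {R S rs} M x : rename.
Arguments cell_vol {R S rs} M x : rename.
Arguments cell_trivIset {R S rs} M : rename.
Arguments cv_gt0 {R S rs} M : rename.
Arguments N_gt1 {R S rs} M : rename.

Section instances.
Variables (R : realType) (d1 d2 d3 : nat).
Hypotheses (d1_gt0 : (0 < d1)%N) (d2_gt0 : (0 < d2)%N) (d3_gt0 : (0 < d3)%N).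
Variables (D1 : set (cube R d1)) (D2 : set (cube R d2)) (D3 : set (cube R d3)).
Hypotheses (gridD1 : dyadic_grid D1) (gridD2 : dyadic_grid D2)
  (gridD3 : dyadic_grid D3).

Lemma completed_measureE dT (T : semiRingOfSetsType dT) (mu : {measure set T -> \bar R})
    (X : set T) : measurable X ->
  measurable (X : set (caratheodory_type (mu^*)%mu)) /\
  @completed_measure_extension _ _ R mu X = mu X.
Proof.
move=> mX; split; last exact: measurable_mu_extE.
by apply: sub_caratheodory; apply: sub_sigma_algebra.
Qed.

Lemma expn2_gt1 d : (0 < d)%N -> (1 < 2 ^ d)%N.
Proof. by move=> d0; rewrite -{1}(expn0 2) ltn_exp2l. Qed.

Lemma zygmund_model (rs : seq (rect (zygmund_setting D1 D2 D3))) :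
  (forall r, r \in rs -> (D1 `*` D2 `*` D3) r) -> model rs.
Proof.
move=> rsD.
have h1 Q : Q \in [seq r.1.1 | r <- rs] -> D1 Q.
  by move=> /mapP[r /rsD[[? ?] ?] ->].
have h2 Q : Q \in [seq r.1.2 | r <- rs] -> D2 Q.
  by move=> /mapP[r /rsD[[? ?] ?] ->].
have h3 Q : Q \in [seq r.2 | r <- rs] -> D3 Q.
  by move=> /mapP[r /rsD[[? ?] ?] ->].
have [A1 /cid[cell1 /cid[v1 /cid[k1 /cid[c1 /cid[l1]]]]]] :=
  cid (grid_model d1_gt0 gridD1 h1).
move=> [[mc1 vc1 v10 tr1] lE1 cE1 sub1 lam1].
have [A2 /cid[cell2 /cid[v2 /cid[k2 /cid[c2 /cid[l2]]]]]] :=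
  cid (grid_model d2_gt0 gridD2 h2).
move=> [[mc2 vc2 v20 tr2] lE2 cE2 sub2 lam2].
have [A3 /cid[cell3 /cid[v3 /cid[k3 /cid[c3 /cid[l3]]]]]] :=
  cid (grid_model d3_gt0 gridD3 h3).
move=> [[mc3 vc3 v30 tr3] lE3 cE3 sub3 lam3].
have q1 r : r \in rs -> r.1.1 \in [seq r.1.1 | r <- rs] by move=> ?; apply/mapP; exists r.
have q2 r : r \in rs -> r.1.2 \in [seq r.1.2 | r <- rs] by move=> ?; apply/mapP; exists r.
have q3 r : r \in rs -> r.2 \in [seq r.2 | r <- rs] by move=> ?; apply/mapP; exists r.
pose cell (x : A1 * A2 * A3) : set (Defs.space (zygmund_setting D1 D2 D3)) :=
  cell1 x.1.1 `*` cell2 x.1.2 `*` cell3 x.2.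
have mcell x : measurable (cell1 x.1.1 `*` cell2 x.1.2 `*` cell3 x.2).
  by apply: measurableX => //; apply: measurableX.
(* The logarithm of the Zygmund relation, in levels counted from the cells. It yields both
   [rect_mono] and [rect_area]. *)
have area r : r \in rs -> rectangles r -> (l3 r.2)%:Z + k3 = (l1 r.1.1)%:Z + k1 + ((l2 r.1.2)%:Z + k2).
  move=> rrs [_]; rewrite lE1 ?lE2 ?lE3 ?q1 ?q2 ?q3// !subrK /side -expfzDr ?pnatr_eq0// => e.
  by apply/eqP; rewrite eq_le -!(@ler_eXz2l R 2) ?ltr1n// e lexx.
refine (@Model _ _ rs A1 A2 A3 cell (v1 * v2 * v3)
  (fun r => c1 r.1.1) (fun r => c2 r.1.2) (fun r => c3 r.2)
  (fun r => l1 r.1.1) (fun r => l2 r.1.2) (fun r => l3 r.2)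
  (2 ^ d1) (2 ^ d2) (2 ^ d3) _ _ _ _ _ _ _ _ _ _ _ _ _ _).
- by move=> x; have [] := completed_measureE (lebesgue_euclid d1 \x lebesgue_euclid d2
    \x lebesgue_euclid d3)%E (mcell x).
- move=> x; have [_ e] := completed_measureE (lebesgue_euclid d1 \x lebesgue_euclid d2
    \x lebesgue_euclid d3)%E (mcell x).
  apply: etrans e _.
  apply: etrans; first by apply: product_measure1E => //; apply: measurableX.
  rewrite EFinM; congr (_ * _)%E; last exact: vc3.
  apply: etrans; first exact: product_measure1E.
  by rewrite EFinM; congr (_ * _)%E; [exact: vc1|exact: vc2].
- by rewrite !mulr_gt0.
- move=> [[x1 x2] x3] [[y1 y2] y3] _ _ [[[z1 z2] z3] [[[/= a1 a2] a3] [[/= e1 e2] e3]]].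
  rewrite (tr1 x1 y1)//; last by exists z1.
  rewrite (tr2 x2 y2)//; last by exists z2.
  by rewrite (tr3 x3 y3)//; exists z3.
- move=> r rrs; apply/seteqP; split => [[[z1 z2] z3] [[/= a1 a2] a3]|].
    move: a1 a2 a3; rewrite (cE1 _ (q1 _ rrs)).1 (cE2 _ (q2 _ rrs)).1 (cE3 _ (q3 _ rrs)).1.
    move=> [t1 T1 a1] [t2 T2 a2] [t3 T3 a3]; exists (t1, t2, t3) => //=.
    by rewrite !finset.in_setX T1 T2.
  move=> [[z1 z2] z3] [[[t1 t2] t3]]; rewrite /= !finset.in_setX => /andP[/andP[T1 T2] T3].
  move=> [[/= a1 a2] a3]; split; first split => /=.
  + by rewrite (cE1 _ (q1 _ rrs)).1; exists t1.
  + by rewrite (cE2 _ (q2 _ rrs)).1; exists t2.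
  + by rewrite /= (cE3 _ (q3 _ rrs)).1; exists t3.
- by split; apply: expn2_gt1.
- by move=> r rrs; rewrite (cE1 _ (q1 _ rrs)).2 (cE2 _ (q2 _ rrs)).2 (cE3 _ (q3 _ rrs)).2.
- by move=> r r' y rrs rrs'; apply: lam1; apply: q1.
- by move=> r r' y rrs rrs'; apply: lam2; apply: q2.
- by move=> r r' y rrs rrs'; apply: lam3; apply: q3.
- move=> k r rrs urs; have [[Dr1 _] _] := rsD _ rrs.
  have [_ le sub] := ancestorP d1_gt0 gridD1 k Dr1; split => //=; first exact: sub1.
  apply/eqP; rewrite -eqz_nat PoszD !lE1 ?(q1 _ rrs)//; last exact: (q1 _ urs).
  by rewrite le addrAC.
- move=> k r rrs urs; have [[_ Dr2] _] := rsD _ rrs.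
  have [_ le sub] := ancestorP d2_gt0 gridD2 k Dr2; split => //=; first exact: sub2.
  apply/eqP; rewrite -eqz_nat PoszD !lE2 ?(q2 _ rrs)//; last exact: (q2 _ urs).
  by rewrite le addrAC.
- by move=> r r' rrs rrs' /(area _ rrs) e /(area _ rrs') e'; move: e e'; clear; lia.
- by move=> r r' rrs rrs' /(area _ rrs) e /(area _ rrs') e'; move: e e'; clear; lia.
Qed.

(** The third factor is a single point at level 0, so its cardinality is 2^0 and all comparisons of
    third sides are trivial. *)
Lemma biparameter_model (rs : seq (rect (biparameter_setting D1 D2))) :
  (forall r, r \in rs -> (D1 `*` D2) r) -> model rs.
Proof.
move=> rsD.
have h1 Q : Q \in [seq r.1 | r <- rs] -> D1 Q.
  by move=> /mapP[r /rsD[? ?] ->].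
have h2 Q : Q \in [seq r.2 | r <- rs] -> D2 Q.
  by move=> /mapP[r /rsD[? ?] ->].
have [A1 /cid[cell1 /cid[v1 /cid[k1 /cid[c1 /cid[l1]]]]]] :=
  cid (grid_model d1_gt0 gridD1 h1).
move=> [[mc1 vc1 v10 tr1] lE1 cE1 sub1 lam1].
have [A2 /cid[cell2 /cid[v2 /cid[k2 /cid[c2 /cid[l2]]]]]] :=
  cid (grid_model d2_gt0 gridD2 h2).
move=> [[mc2 vc2 v20 tr2] lE2 cE2 sub2 lam2].
have q1 r : r \in rs -> r.1 \in [seq r.1 | r <- rs] by move=> ?; apply/mapP; exists r.
have q2 r : r \in rs -> r.2 \in [seq r.2 | r <- rs] by move=> ?; apply/mapP; exists r.
pose cell (x : A1 * A2 * unit) : set (Defs.space (biparameter_setting D1 D2)) :=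
  cell1 x.1.1 `*` cell2 x.1.2.
have mcell (x : A1 * A2 * unit) : measurable (cell1 x.1.1 `*` cell2 x.1.2) by apply: measurableX.
refine (@Model _ _ rs A1 A2 unit cell (v1 * v2)
  (fun r => c1 r.1) (fun r => c2 r.2) (fun=> [set: unit]%SET)
  (fun r => l1 r.1) (fun r => l2 r.2) (fun=> 0%N)
  (2 ^ d1) (2 ^ d2) 2 _ _ _ _ _ _ _ _ _ _ _ _ _ _).
- by move=> x; have [] := completed_measureE (lebesgue_euclid d1 \x lebesgue_euclid d2)%E
    (mcell x).
- move=> x; have [_ e] := completed_measureE (lebesgue_euclid d1 \x lebesgue_euclid d2)%E
    (mcell x).
  apply: etrans e _.
  apply: etrans; first exact: product_measure1E.
  by rewrite EFinM; congr (_ * _)%E; [exact: vc1|exact: vc2].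
- by rewrite !mulr_gt0.
- move=> [[x1 x2] []] [[y1 y2] []] _ _ [[z1 z2] [[/= a1 a2] [/= e1 e2]]].
  rewrite (tr1 x1 y1)//; last by exists z1.
  by rewrite (tr2 x2 y2)//; exists z2.
- move=> r rrs; apply/seteqP; split => [[z1 z2] [/= a1 a2]|].
    move: a1 a2; rewrite (cE1 _ (q1 _ rrs)).1 (cE2 _ (q2 _ rrs)).1.
    move=> [t1 T1 a1] [t2 T2 a2]; exists (t1, t2, tt) => //=.
    by rewrite !finset.in_setX T1 T2 finset.in_setT.
  move=> [z1 z2] [[[t1 t2] t3]]; rewrite /= !finset.in_setX => /andP[/andP[T1 T2] T3].
  move=> [/= a1 a2]; split => /=.
  + by rewrite (cE1 _ (q1 _ rrs)).1; exists t1.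
  + by rewrite (cE2 _ (q2 _ rrs)).1; exists t2.
- by split => //; apply: expn2_gt1.
- move=> r rrs; rewrite (cE1 _ (q1 _ rrs)).2 (cE2 _ (q2 _ rrs)).2; split => //.
  by rewrite cardsT card_unit.
- by move=> r r' y rrs rrs'; apply: lam1; apply: q1.
- by move=> r r' y rrs rrs'; apply: lam2; apply: q2.
- by [].
- move=> k r rrs urs; have [Dr1 _] := rsD _ rrs.
  have [_ le sub] := ancestorP d1_gt0 gridD1 k Dr1; split => //=; first exact: sub1.
  apply/eqP; rewrite -eqz_nat PoszD !lE1 ?(q1 _ rrs)//; last exact: (q1 _ urs).
  by rewrite le addrAC.
- move=> k r rrs urs; have [_ Dr2] := rsD _ rrs.
  have [_ le sub] := ancestorP d2_gt0 gridD2 k Dr2; split => //=; first exact: sub2.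
  apply/eqP; rewrite -eqz_nat PoszD !lE2 ?(q2 _ rrs)//; last exact: (q2 _ urs).
  by rewrite le addrAC.
- by [].
- by [].
Qed.

End instances.
(** * The packing estimate for an abstract setting *)

(** If the successor of [max_nat P] were in [P], then [P] would be nonempty and bounded and
    [max_nat P] its true maximum. An empty [P], where the default 0 is returned, is thus covered. *)
Lemma max_natP (P : set nat) (N : nat) : (forall k, P k -> (k <= N)%N) ->
  ~ P (max_nat P).+1.
Proof.
move=> PN Pm; have ex : exists k, `[< P k >] by exists (max_nat P).+1; apply/asboolP.
have ub k : `[< P k >] -> (k <= N)%N by move=> /asboolP/PN.
case: (ex_maxnP ex ub) => i /asboolP Pi maxi.
have [_ /(_ _ Pm)] : P (max_nat P) /\ forall j, P j -> (j <= max_nat P)%N.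
  apply: (@xgetPex _ 0%N [set k | P k /\ forall j, P j -> (j <= k)%N]).
  by exists i; split => // j Pj; apply: maxi; apply/asboolP.
by rewrite ltnn.
Qed.

Section abstract_setting.
Variables (R : realType) (S : rectangle_setting R) (AR : set (rect S)).
Variable mk_model : forall rs : seq (rect S), (forall r, r \in rs -> AR r) -> model rs.
Hypothesis rectanglesAR : forall r : rect S, rectangles r -> AR r.
Hypothesis maximalAR : forall r : rect S, maximal_rectangles r -> AR r.
Hypothesis up1_maximal : forall k (r : rect S), rectangles r ->
  maximal_rectangles (up1 k r).
Hypothesis up2_maximal : forall k (r : rect S), rectangles r ->
  maximal_rectangles (up2 k r).
Hypothesis countableAR : countable AR.
Implicit Types (r : rect S) (Omega X Y : set (Defs.space S)).

Let mes X : R := fine (vol S X).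

Section in_model.
Variables (rs : seq (rect S)) (M : model rs).

Definition box r : {set m1 M * m2 M * m3 M} :=
  finset.setX (finset.setX (b1 M r) (b2 M r)) (b3 M r).

Definition cells (X : {set m1 M * m2 M * m3 M}) : set (Defs.space S) :=
  \bigcup_(x in [set` X]) cell M x.

Lemma cells_measurable (X : {set m1 M * m2 M * m3 M}) : measurable (cells X).
Proof.
exact: (measure_cells (mu := vol S) X (cell_measurable M)
  (cell_trivIset M) (cell_vol M)).1.
Qed.

Lemma vol_cells (X : {set m1 M * m2 M * m3 M}) : vol S (cells X) = (#|X|%:R * cv M)%:E.
Proof.
exact: (measure_cells (mu := vol S) X (cell_measurable M)
  (cell_trivIset M) (cell_vol M)).2.
Qed.

Lemma box_gt0 r : r \in rs -> (0 < #|box r|)%N.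
Proof.
move=> rrs; have [g1 g2 g3] := N_gt1 M; have [e1 e2 e3] := card_b M rrs.
by rewrite !cardsX e1 e2 e3 !muln_gt0 !expn_gt0 !(ltnW g1) !(ltnW g2) (ltnW g3).
Qed.

Lemma cells_bigcup (V : finType) (f : V -> {set m1 M * m2 M * m3 M}) (A : {set V}) :
  cells (\bigcup_(I in A) f I) = \bigcup_(I in [set` A]) cells (f I).
Proof.
apply/seteqP; split => [z [t /= /finset.bigcupP[I IA tI] tz]|z [I /= IA [t /= tI tz]]].
  by exists I => //; exists t.
by exists t => //=; apply/finset.bigcupP; exists I.
Qed.

Lemma cells_sub (X Y : {set m1 M * m2 M * m3 M}) : X \subset Y -> cells X `<=` cells Y.
Proof. by move=> /fintype.subsetP XY z [t /= tX tz]; exists t => //=; apply: XY. Qed.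

Lemma sub_cells (X Y : {set m1 M * m2 M * m3 M}) : cells X `<=` cells Y -> X \subset Y.
Proof.
move=> XY; apply/fintype.subsetP => t tX.
have [z tz] : cell M t !=set0.
  apply/set0P/negP => /eqP e; have := cell_vol M t; rewrite e measure0 => -[].
  by have := cv_gt0 M => + h; rewrite -h ltxx.
have [t' /= t'Y t'z] := XY z (ex_intro2 _ _ t tX tz).
by rewrite (cell_trivIset M t t')//; exists z.
Qed.

Lemma rect_cellsE r : r \in rs -> rect_set r = cells (box r).
Proof. exact: rect_cells. Qed.

End in_model.

Let model1 r (rAR : AR r) : model [:: r].
Proof. by apply: mk_model => r'; rewrite inE => /eqP ->. Defined.

Lemma rect_measurable r : AR r -> measurable (rect_set r).
Proof.
by move=> rAR; rewrite (rect_cellsE (model1 rAR)) ?mem_head//; apply: cells_measurable.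
Qed.

Lemma rect_vol r : AR r -> vol S (rect_set r) = (mes (rect_set r))%:E /\ 0 < mes (rect_set r).
Proof.
move=> rAR; have rr : r \in [:: r] by rewrite mem_head.
rewrite /mes (rect_cellsE (model1 rAR) rr) vol_cells/=; split => //.
by rewrite mulr_gt0 ?cv_gt0// ltr0n box_gt0.
Qed.

Lemma mesE Omega X : measurable Omega -> (vol S Omega < +oo)%E -> measurable X ->
  X `<=` Omega -> vol S X = (mes X)%:E.
Proof.
move=> mO fO mX XO; rewrite fineK// ge0_fin_numE//.
by apply: le_lt_trans fO; apply: le_measure => //; exact: mem_set.
Qed.

Lemma mes_le X Y : measurable X -> measurable Y -> (vol S Y < +oo)%E -> X `<=` Y ->
  mes X <= mes Y.
Proof.
move=> mX mY fY XY; rewrite -lee_fin -(mesE mY fY mX XY) -(mesE mY fY mY)//.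
by apply: le_measure => //; exact: mem_set.
Qed.

(** * Size of the enlargement *)

Section enlargement_theory.
Variable Omega : set (Defs.space S).
Hypotheses (mOmega : measurable Omega) (fOmega : (vol S Omega < +oo)%E).

Lemma average_half r : AR r ->
  (2^-1%:E < ((fine (vol S (rect_set r)))^-1)%:E *
     \int[vol S]_(y in rect_set r) (`|\1_Omega y|)%:E)%E =
  (mes (rect_set r) < 2 * mes (Omega `&` rect_set r)).
Proof.
move=> rAR; have [ev v0] := rect_vol rAR; have mr := rect_measurable rAR.
under eq_integral => y _ do rewrite ger0_norm ?indicE//.
rewrite (eq_integral (fun y => (\1_Omega y)%:E)) => [|y _]; last by rewrite indicE.
rewrite integral_indic//.
rewrite (mesE mOmega fOmega (measurableI _ _ mOmega mr) (@subIsetl _ _ _)).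
rewrite -EFinM lte_fin -/(mes _) [_^-1 * _]mulrC ltr_pdivlMr// mulrC ltr_pdivrMr//.
by rewrite mulrC.
Qed.

Lemma enlargementP x : enlargement Omega x -> exists r, [/\ maximal_rectangles r,
  rect_set r x & mes (rect_set r) < 2 * mes (Omega `&` rect_set r)].
Proof.
rewrite /enlargement /maximal_function/= => /ereal_sup_gt[_ [_ [[r mr <-] rx] <-]].
by rewrite average_half; [exists r|exact: maximalAR].
Qed.

Lemma sub_enlargement r : maximal_rectangles r ->
  mes (rect_set r) < 2 * mes (Omega `&` rect_set r) ->
  rect_set r `<=` enlargement Omega.
Proof.
move=> mr lt x rx; rewrite /enlargement /maximal_function/=.
apply/ereal_sup_gtP; exists (((fine (vol S (rect_set r)))^-1)%:E *
     \int[vol S]_(y in rect_set r) (`|\1_Omega y|)%:E)%E; last first.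
  by rewrite average_half//; exact: maximalAR.
by exists (rect_set r) => //; split => //; exists r.
Qed.

(* The strong maximal theorem, for finitely many rectangles. *)
Lemma union_half (rs : seq (rect S)) : (forall r, r \in rs -> AR r /\
    mes (rect_set r) < 2 * mes (Omega `&` rect_set r)) ->
  (vol S (\bigcup_(r in [set` rs]) rect_set r) <= (168 * mes Omega)%:E)%E.
Proof.
move=> H; have rsAR r : r \in rs -> AR r by move=> /H[].
have M := mk_model rsAR.
pose V : finType := seq_sub rs.
pose vl (I : V) : rect S := ssval I.
have vV (I : V) : vl I \in rs := ssvalP I.
(* Omega need not be a union of cells; its density on each cell is all that averages over rectangles
   see. *)
pose g (x : m1 M * m2 M * m3 M) := mes (Omega `&` cell M x) / cv M.
have mOc (X : {set m1 M * m2 M * m3 M}) : measurable (Omega `&` cells X) by apply: measurableI => //; apply: cells_measurable.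
have gsum (X : {set m1 M * m2 M * m3 M}) :
    \sum_(x in X) g x = mes (Omega `&` cells X) / cv M.
  rewrite -mulr_suml; congr (_ / _); apply: EFin_inj.
  rewrite -(mesE mOmega fOmega (mOc X) (@subIsetl _ _ _)).
  rewrite /cells setI_bigcupr measure_fin_bigcup//; last 2 first.
  - by apply: trivIset_setIl; apply: sub_trivIset (cell_trivIset M).
  - by move=> t _; apply: measurableI => //; apply: cell_measurable.
  have eX : [set` X] = [set` enum X] by apply/seteqP; split => t /=; rewrite mem_enum.
  rewrite eX -fsbig_seq ?enum_uniq// -sumEFin big_enum/=; apply: eq_bigr => t _.
  exact: esym (mesE mOmega fOmega (measurableI _ _ mOmega (cell_measurable M t))
    (@subIsetl _ _ _)).
have g01 x : 0 <= g x <= 1.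
  rewrite divr_ge0 ?fine_ge0 ?(ltW (cv_gt0 M))//= ler_pdivrMr ?cv_gt0// mul1r.
  have -> : cv M = mes (cell M x) by rewrite /mes cell_vol.
  apply: mes_le => //; [|exact: cell_measurable|by rewrite cell_vol ltry].
  by apply: measurableI => //; apply: cell_measurable.
have lam1' := laminar_imset (r := fun I : V => b1 M (vl I))
  (l := fun I : V => l1 M (vl I)) (fun (I J : V) y => @lam1 _ _ _ M _ _ y (vV I) (vV J)).
have lam2' := laminar_imset (r := fun I : V => b2 M (vl I))
  (l := fun I : V => l2 M (vl I)) (fun (I J : V) y => @lam2 _ _ _ M _ _ y (vV I) (vV J)).
have lam3' := laminar_imset (r := fun I : V => b3 M (vl I))
  (l := fun I : V => l3 M (vl I)) (fun (I J : V) y => @lam3 _ _ _ M _ _ y (vV I) (vV J)).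
have := @box_weak_type R V (m1 M) (m2 M) (m3 M) (fun I => b1 M (vl I))
  (fun I => b2 M (vl I)) (fun I => b3 M (vl I)) 2^-1 4^-1 8^-1 g.
move=> /(_ _ _ _ _ lam1' lam2' lam3' g01).
set X := [set x | _]%SET => wt.
have -> : \bigcup_(r in [set` rs]) rect_set r = cells X.
  apply/seteqP; split => [z [r /= rrs]|z [t /=]].
    rewrite (rect_cellsE M rrs) => -[t /= tr tz]; exists t => //=.
    by rewrite inE; apply/existsP; exists (SeqSub rrs).
  rewrite inE => /existsP[I tI] tz; exists (vl I); first exact: vV.
  by rewrite (rect_cellsE M (vV I)); exists t.
rewrite vol_cells lee_fin -ler_pdivlMr ?cv_gt0//.
have le1 : #|X|%:R <= 168 * \sum_x g x.
  (* The levels 1/2, 1/4, 1/8 give the factors 3, 7 and 8. *)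
  have -> : 168 = 8^-1^-1 * ((1 - 8^-1) / (4^-1 - 8^-1)) *
      ((1 - 4^-1) / (2^-1 - 4^-1)) :> R.
    by field.
  apply: wt; [lra|lra|lra|lra|].
    move=> I; rewrite -/(box M (vl I)) gsum -(rect_cellsE M (vV I)).
    have [_] := H _ (vV I); rewrite ler_pdivlMr ?cv_gt0// mulrC.
    rewrite {1}/mes {1}(rect_cellsE M (vV I)) vol_cells/=; lra.
apply: le_trans le1 _; rewrite -mulrA ler_pM2l//.
have -> : \sum_x g x = \sum_(x in [set: m1 M * m2 M * m3 M]%SET) g x.
  by apply: eq_bigl => x; rewrite finset.in_setT.
rewrite gsum ler_pM2r ?invr_gt0 ?cv_gt0//; apply: mes_le => //.
Qed.

(** Makes the maxima e_1 and e_2 genuine. A rectangle inside the enlargement is exhausted by its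
    intersections with finitely many rectangles of density above 1/2, so its volume is at most 168
    |Omega|, while the volume of [u k] grows at least linearly. *)
Lemma enlargement_bounded (u : nat -> rect S) (c : R) : 0 < c ->
  (forall k, AR (u k)) -> (forall k, c * k%:R <= mes (rect_set (u k))) ->
  exists N, forall k, rect_set (u k) `<=` enlargement Omega -> (k <= N)%N.
Proof.
move=> c0 uAR uk; exists (Num.trunc (168 * mes Omega / c)) => k sub.
rewrite leqNgt; apply/negP => ltk.
pose RR := [set r | maximal_rectangles r /\
  mes (rect_set r) < 2 * mes (Omega `&` rect_set r)].
have cRR : countable RR.
  by apply: sub_countable countableAR; apply: subset_card_le => r [/maximalAR].
have [f finj] := countable_injP RR cRR.
(* An increasing sequence of finite families exhausting [RR], along which continuity of the measure
   applies. *)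
pose Rn n := [set r | RR r /\ (f r <= n)%N].
have fRn n : finite_set (Rn n).
  have finj' : {in Rn n &, injective f}.
    by move=> r r' /set_mem[rR _] /set_mem[r'R _]; apply: finj; apply: mem_set.
  rewrite -(eq_finite_set (inj_card_eq finj')).
  by apply: sub_finite_set (finite_II n.+1) => _ [r [_ le] <-]; rewrite /= ltnS.
pose K := rect_set (u k).
pose B n := K `&` \bigcup_(r in Rn n) rect_set r.
have mK : measurable K by apply: rect_measurable.
have mB n : measurable (B n).
  apply: measurableI => //; apply: fin_bigcup_measurable => // r [[/maximalAR rAR _] _].
  exact: rect_measurable.
have eK : \bigcup_n B n = K.
  apply/seteqP; split => [z [n _ []]//|z Kz].
  have [r [mr rz lt]] := enlargementP (sub _ Kz).
  by exists (f r) => //; split => //; exists r.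
have ndB : nondecreasing_seq B.
  move=> m n mn; apply/subsetPset => z [Kz [r [Rr fr] rz]]; split => //.
  by exists r => //; split => //; apply: leq_trans mn.
have [vK K0] := rect_vol (uAR k).
have cvgB : vol S \o B @ \oo --> vol S K.
  by rewrite -eK; apply: nondecreasing_cvg_mu => //; rewrite eK.
have leB n : (vol S (B n) <= (168 * mes Omega)%:E)%E.
  have fs := fRn n.
  have eR : Rn n = [set` enum_fset (fset_set (Rn n))].
    by rewrite -[LHS](fset_setK fs); apply/seteqP; split => z.
  apply: (@le_trans _ _ (vol S (\bigcup_(r in Rn n) rect_set r))).
    apply: le_measure; [exact: mem_set| |by move=> z []].
    apply: mem_set; apply: fin_bigcup_measurable => // r [[/maximalAR rAR _] _].
    exact: rect_measurable.
  have := @union_half (enum_fset (fset_set (Rn n))).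
  rewrite -eR => H.
  apply: H => r.
  move=> rX; have : r \in fset_set (Rn n) by exact: rX.
  rewrite in_fset_set// => /set_mem[[mr lt] _].
  by split => //; apply: maximalAR.
have : (vol S K <= (168 * mes Omega)%:E)%E.
  rewrite -(cvg_lim _ cvgB)//; apply: lime_le; first by apply/cvg_ex; exists (vol S K).
  by apply: nearW => n; apply: leB.
rewrite vK lee_fin => le.
have := uk k; apply/negP; rewrite -ltNge.
apply: le_lt_trans le _.
have lt : 168 * mes Omega / c < k%:R.
  by apply: lt_le_trans (truncnS_gt _) _; rewrite ler_nat.
by move: lt; rewrite ltr_pdivrMr// [k%:R * c]mulrC.
Qed.

End enlargement_theory.
(** The volume is multiplied by N1^k, and k < N1^k; linear growth is what [enlargement_bounded] asks
    for. *)
Lemma up1_growth k r : rectangles r ->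
  mes (rect_set r) * k%:R <= mes (rect_set (up1 k r)).
Proof.
move=> rr; have rsAR r' : r' \in [:: r; up1 k r] -> AR r'.
  rewrite !inE => /orP[/eqP ->|/eqP ->]; first exact: rectanglesAR.
  exact/maximalAR/up1_maximal.
have M := mk_model rsAR.
have i1 : r \in [:: r; up1 k r] by rewrite !inE eqxx.
have i2 : up1 k r \in [:: r; up1 k r] by rewrite !inE eqxx orbT.
rewrite /mes (rect_cellsE M i1) (rect_cellsE M i2) !vol_cells/= mulrAC.
rewrite ler_pM2r ?cv_gt0// -natrM ler_nat !cardsX.
have [_ e2 e3 e4] := up1P M i1 i2; have [g1 _ _] := N_gt1 M.
have [c1 _ _] := card_b M i1; have [c1' _ _] := card_b M i2.
rewrite e2 e3 c1 c1' e4 expnD -!mulnA leq_mul2l; apply/orP; right.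
by rewrite mulnA [leqRHS]mulnC leq_mul2l ltnW ?orbT// ltn_expl.
Qed.

Lemma up2_growth k r : rectangles r ->
  mes (rect_set r) * k%:R <= mes (rect_set (up2 k r)).
Proof.
move=> rr; have rsAR r' : r' \in [:: r; up2 k r] -> AR r'.
  rewrite !inE => /orP[/eqP ->|/eqP ->]; first exact: rectanglesAR.
  exact/maximalAR/up2_maximal.
have M := mk_model rsAR.
have i1 : r \in [:: r; up2 k r] by rewrite !inE eqxx.
have i2 : up2 k r \in [:: r; up2 k r] by rewrite !inE eqxx orbT.
rewrite /mes (rect_cellsE M i1) (rect_cellsE M i2) !vol_cells/= mulrAC.
rewrite ler_pM2r ?cv_gt0// -natrM ler_nat !cardsX.
have [_ e2 e3 e4] := up2P M i1 i2; have [_ g1 _] := N_gt1 M.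
have [_ c1 _] := card_b M i1; have [_ c1' _] := card_b M i2.
rewrite e2 e3 c1 c1' e4 expnD mulnAC leq_mul2r; apply/orP; right.
by rewrite mulnA leq_mul2l ltnW ?orbT// ltn_expl.
Qed.

(** * From finite subfamilies to admissible families *)

Section family.
Variables (Omega : set (Defs.space S)) (F : set (rect S)).
Hypothesis adm : admissible Omega F.

Let mOmega : measurable Omega. Proof. by case: adm. Qed.
Let fOmega : (vol S Omega < +oo)%E. Proof. by case: adm. Qed.
Let Frect r : F r -> rectangles r. Proof. by case: adm => _ _ H _ _; apply: H. Qed.
Let Fsub r : F r -> rect_set r `<=` Omega. Proof. by case: adm => _ _ _ H _; apply: H. Qed.

(** The ancestor is itself a rectangle of the maximal function; with density above 1/2 it would lie
    in the enlargement, against the maximality of e_1. *)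
Lemma e1_maximal r : rectangles r ->
  2 * mes (Omega `&` rect_set (up1 (e1 r Omega).+1 r))
    <= mes (rect_set (up1 (e1 r Omega).+1 r)).
Proof.
move=> rr; rewrite leNgt; apply/negP => /(sub_enlargement mOmega fOmega (up1_maximal _ rr)).
have [|||N HN] := @enlargement_bounded Omega mOmega fOmega (fun k => up1 k r) (mes (rect_set r)).
- by have [] := rect_vol (rectanglesAR rr).
- by move=> k; apply/maximalAR/up1_maximal.
- by move=> k; apply: up1_growth.
exact: (max_natP (P := [set k | rect_set (up1 k r) `<=` enlargement Omega]) HN).
Qed.

Lemma e2_maximal r : rectangles r ->
  2 * mes (Omega `&` rect_set (up2 (e2 r Omega).+1 r))
    <= mes (rect_set (up2 (e2 r Omega).+1 r)).
Proof.
move=> rr; rewrite leNgt; apply/negP => /(sub_enlargement mOmega fOmega (up2_maximal _ rr)).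
have [|||N HN] := @enlargement_bounded Omega mOmega fOmega (fun k => up2 k r) (mes (rect_set r)).
- by have [] := rect_vol (rectanglesAR rr).
- by move=> k; apply/maximalAR/up2_maximal.
- by move=> k; apply: up2_growth.
exact: (max_natP (P := [set k | rect_set (up2 k r) `<=` enlargement Omega]) HN).
Qed.

Section finite_family.
Variables (X : {fset rect S}) (XF : forall r, r \in X -> F r).

Let K1 r := up1 (e1 r Omega).+1 r.
Let K2 r := up2 (e2 r Omega).+1 r.
(** The model has to resolve the ancestors one level beyond e_1 and e_2 too, since [v_above] and
    [v_below] are proved on them. *)
Let rs := enum_fset X ++ ([seq K1 r | r <- enum_fset X] ++ [seq K2 r | r <- enum_fset X]).

Let rsAR r : r \in rs -> AR r.
Proof.
rewrite !mem_cat => /or3P[rX|/mapP[r' rX ->]|/mapP[r' rX ->]].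
- exact/rectanglesAR/Frect/XF.
- exact/maximalAR/up1_maximal/Frect/XF.
- exact/maximalAR/up2_maximal/Frect/XF.
Qed.

Let M := mk_model rsAR.

Definition family_config : config := {|
  A1 := m1 M; A2 := m2 M; A3 := m3 M; U := X;
  c1 := fun I : X => b1 M (val I); c2 := fun I : X => b2 M (val I);
  c3 := fun I : X => b3 M (val I);
  p := fun I : X => l1 M (val I); q := fun I : X => l2 M (val I);
  h := fun I : X => l3 M (val I);
  a := fun I : X => e1 (val I) Omega; b := fun I : X => e2 (val I) Omega |}.

Let Xrs (I : X) : val I \in rs.
Proof. by rewrite mem_cat; apply/orP; left; apply: valP. Qed.
Let K1rs (I : X) : K1 (val I) \in rs.
Proof. by rewrite !mem_cat; apply/or3P/Or32/map_f; apply: valP. Qed.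
Let K2rs (I : X) : K2 (val I) \in rs.
Proof. by rewrite !mem_cat; apply/or3P/Or33/map_f; apply: valP. Qed.
Let XR (I : X) : rectangles (val I).
Proof. by apply/Frect/XF; apply: valP. Qed.

Lemma rect_family (I : X) : rect_set (val I) = cells (@rc family_config I).
Proof. exact: (rect_cellsE M (Xrs I)). Qed.

Lemma shc_family : shc family_config = (\bigcup_(I : X) @rc family_config I)%SET.
Proof.
apply/setP => x; rewrite inE; apply/existsP/finset.bigcupP => [[I xI]|[I _ xI]].
  by exists I.
by exists I.
Qed.

Lemma cells_shc_sub : cells (shc family_config) `<=` Omega.
Proof.
move=> z [x /=]; rewrite inE => /existsP[I xI] xz.
by apply: (Fsub (XF (valP I))); rewrite rect_family; exists x.
Qed.

Lemma half_cells r (A : {set m1 M * m2 M * m3 M}) : r \in rs -> A = box M r ->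
  2 * mes (Omega `&` rect_set r) <= mes (rect_set r) ->
  (2 * #|A :&: shc family_config| <= #|A|)%N.
Proof.
move=> rr -> le; rewrite -(ler_nat R) natrM -(ler_pM2r (cv_gt0 M)).
rewrite -mulrA; move: le; rewrite [X in _ <= X -> _]/mes {2}(rect_cellsE M rr) vol_cells/=.
apply: le_trans; rewrite ler_pM2l//.
have -> : #|box M r :&: shc family_config|%:R * cv M =
    mes (cells (box M r :&: shc family_config)%SET) by rewrite /mes vol_cells.
apply: mes_le.
- exact: cells_measurable.
- exact: measurableI mOmega (rect_measurable (rsAR rr)).
- apply: le_lt_trans fOmega; apply: le_measure; [|exact: mem_set|by move=> z []].
  apply: mem_set; exact: measurableI mOmega (rect_measurable (rsAR rr)).
- move=> z zI; split.
    by apply: cells_shc_sub; apply: cells_sub zI; apply: finset.subsetIr.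
  by rewrite (rect_cellsE M rr); apply: cells_sub zI; apply: finset.subsetIl.
Qed.

Lemma family_valid : valid family_config.
Proof.
have ne (I : X) : [/\ b1 M (val I) != finset.set0, b2 M (val I) != finset.set0
    & b3 M (val I) != finset.set0].
  have [g1 g2 g3] := N_gt1 M; have [k1 k2 k3] := card_b M (Xrs I).
  by rewrite -!card_gt0 k1 k2 k3 !expn_gt0 !(ltnW g1) !(ltnW g2) !(ltnW g3).
(* For rectangles of the setting the order of the first two sides forces that of the third
   ([rect_mono]), so two levels decide inclusion. *)
have inc (I J : X) x : x \in @rc family_config I -> x \in @rc family_config J ->
    (l1 M (val I) <= l1 M (val J))%N -> (l2 M (val I) <= l2 M (val J))%N -> I = J.
  rewrite !mem_rc/= => /and3P[x1 x2 x3] /and3P[y1 y2 y3] le1 le2; apply: val_inj.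
  have [_ _ _ _ Finc] := adm.
  apply: Finc; [by apply: XF; apply: valP|by apply: XF; apply: valP|].
  rewrite (rect_cellsE M (Xrs I)) (rect_cellsE M (Xrs J)); apply: cells_sub.
  have le3 := rect_mono (Xrs I) (Xrs J) (XR I) (XR J) le1 le2.
  apply/fintype.subsetP => -[[z1 z2] z3]; rewrite !finset.in_setX.
  move=> /andP[/andP[h1 h2] h3].
  rewrite (fintype.subsetP (lam1 (Xrs I) (Xrs J) x1 y1 le1) _ h1).
  rewrite (fintype.subsetP (lam2 (Xrs I) (Xrs J) x2 y2 le2) _ h2).
  by rewrite (fintype.subsetP (lam3 (Xrs I) (Xrs J) x3 y3 le3) _ h3).
split.
- by move=> I; have [] := ne I.
- by move=> I; have [] := ne I.
- by move=> I; have [] := ne I.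
- by move=> I J y; apply: (lam1 (Xrs I) (Xrs J)).
- by move=> I J y; apply: (lam2 (Xrs I) (Xrs J)).
- by move=> I J y; apply: (lam3 (Xrs I) (Xrs J)).
- move=> I J x xI xJ neq /=; have nIJ : I <> J by apply/eqP.
  have n1 := inc _ _ _ xI xJ; have n2 := inc _ _ _ xJ xI.
  case: (ltngtP (l1 M (val I)) (l1 M (val J))) => h1;
    case: (ltngtP (l2 M (val I)) (l2 M (val J))) => h2 //=; exfalso; apply: nIJ.
  + by apply: n1; exact: ltnW.
  + by apply: n1; [exact: ltnW|rewrite h2].
  + by apply/esym/n2; exact: ltnW.
  + by apply/esym/n2; [exact: ltnW|rewrite h2].
  + by apply: n1; [rewrite h1|exact: ltnW].
  + by apply/esym/n2; [rewrite h1|exact: ltnW].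
  + by apply: n1; rewrite ?h1 ?h2.
- by move=> I J; apply: (rect_area (Xrs I) (Xrs J) (XR I) (XR J)).
- move=> I; have [u1 u2 u3 u4] := up1P M (Xrs I) (K1rs I).
  apply: (@far_above_half family_config I (b1 M (K1 (val I)))) => //.
  + by have [/set0Pn[y yI] _ _] := ne I; apply/set0Pn; exists y; apply: (fintype.subsetP u1).
  + move=> J y yK yJ lt; apply: (lam1 (K1rs I) (Xrs J) yK yJ).
    by rewrite u4 addnS.
  + apply: (half_cells (K1rs I)); last exact: e1_maximal (XR I).
    by rewrite /box u2 u3.
- move=> I; have [u1 u2 u3 u4] := up2P M (Xrs I) (K2rs I).
  apply: (@far_below_half family_config I (b2 M (K2 (val I)))) => //.
  + by have [_ /set0Pn[y yI] _] := ne I; apply/set0Pn; exists y; apply: (fintype.subsetP u1).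
  + move=> J y yK yJ lt; apply: (lam2 (K2rs I) (Xrs J) yK yJ).
    by rewrite u4 addnS.
  + apply: (half_cells (K2rs I)); last exact: e2_maximal (XR I).
    by rewrite /box u2 u3.
Qed.

Lemma family_sum (wt : nat -> nat -> R) :
  \sum_(I <- X) wt (e1 I Omega) (e2 I Omega) * mes (rect_set I) =
  (\sum_J wt (a J) (b J) * #|@rc family_config J|%:R) * cv M.
Proof.
rewrite big_seq_fsetE/= mulr_suml; apply: eq_bigr => I _.
by rewrite -mulrA /mes rect_family vol_cells.
Qed.

Lemma family_le (wt : nat -> nat -> R) (k : R) : 0 <= k ->
  \sum_J wt (a J) (b J) * #|@rc family_config J|%:R <=
    k * #|shc family_config|%:R ->
  \sum_(I <- X) wt (e1 I Omega) (e2 I Omega) * mes (rect_set I) <= k * mes Omega.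
Proof.
move=> k0 le; rewrite family_sum.
apply: (@le_trans _ _ (k * #|shc family_config|%:R * cv M)).
  by rewrite ler_wpM2r// ltW// cv_gt0.
rewrite -mulrA ler_wpM2l//.
have -> : #|shc family_config|%:R * cv M = mes (cells (shc family_config)).
  by rewrite /mes vol_cells.
by apply: mes_le => //; [exact: cells_measurable|exact: cells_shc_sub].
Qed.

Lemma family_sparse (wt : nat -> nat -> R) (k : R) : 0 <= k ->
  \sum_J wt (a J) (b J) * #|@rc family_config J|%:R <=
    k * #|shc family_config|%:R ->
  exists G0 : set (rect S), [/\ G0 `<=` F, sparse 8^-1 G0 &
    ((\sum_(I <- X) wt (e1 I Omega) (e2 I Omega) * mes (rect_set I))%:E <=
      (k * 8)%:E * vol S (sh G0))%E].
Proof.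
move=> k0 le; have [G [E [GE Gdis Gcov]]] := config_sparse family_valid.
pose G0 := [set r | exists2 I : X, I \in G & val I = r].
exists G0; split.
- by move=> _ [I _ <-]; apply: XF; apply: valP.
- exists (fun r => if (insub r : option X) is Some J then cells (E J) else set0); split.
    move=> _ [I IG <-]; rewrite valK; have [sub le8] := GE _ IG; split.
    + exact: cells_measurable.
    + by rewrite rect_family; apply: cells_sub.
    + rewrite rect_family !vol_cells -EFinM lee_fin mulrA ler_pM2r ?cv_gt0//.
      by rewrite ler_pdivrMl// -natrM ler_nat.
  move=> _ _ [I IG <-] [J JG <-]; rewrite !valK => -[z [[s sI sz] [t tJ tz]]].
  have est : s = t by apply: (cell_trivIset M) => //; exists z.
  congr val; apply/eqP/negPn/negP => /(Gdis _ _ IG JG); rewrite -setI_eq0.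
  move=> /eqP/setP/(_ s); rewrite finset.in_setI finset.in_set0.
  by move: sI tJ => /= ->; rewrite est => ->.
have -> : sh G0 = cells (\bigcup_(J in G) @rc family_config J)%SET.
  rewrite cells_bigcup; apply/seteqP; split => [z [_ [I IG <-] zI]|z [I /= IG zI]].
    by exists I => //; rewrite -rect_family.
  by exists (val I); [exists I|rewrite rect_family].
rewrite vol_cells -EFinM lee_fin family_sum mulrA ler_pM2r ?cv_gt0//.
by apply: le_trans le _; rewrite -mulrA ler_wpM2l// -natrM ler_nat.
Qed.

End finite_family.

Lemma fsum_weighted (wt : nat -> nat -> R) (Y : set (rect S)) : finite_set Y -> Y `<=` F ->
  (\sum_(I \in Y) ((wt (e1 I Omega) (e2 I Omega))%:E * vol S (rect_set I)))%E =
  (\sum_(I <- fset_set Y) wt (e1 I Omega) (e2 I Omega) * mes (rect_set I))%:E.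
Proof.
move=> fY YF; rewrite fsbig_finite// -sumEFin; apply: eq_big_seq => I.
rewrite in_fset_set// => /set_mem IY.
by rewrite (rect_vol (rectanglesAR (Frect (YF _ IY)))).1 -EFinM.
Qed.

Lemma mem_fset_setF (Y : set (rect S)) : finite_set Y -> Y `<=` F ->
  forall r, r \in fset_set Y -> F r.
Proof. by move=> fY YF r; rewrite in_fset_set// => /set_mem/YF. Qed.

Lemma weighted_sum_le (wt : nat -> nat -> R) (k : R) : 0 <= k ->
  (forall C : config, valid C ->
    \sum_J wt (a J) (b J) * #|@rc C J|%:R <= k * #|shc C|%:R) ->
  (weighted_sum wt Omega F <= k%:E * vol S Omega)%E.
Proof.
move=> k0 H; apply: ge_ereal_sup => _ [Y [fY YF] <-].
rewrite (fsum_weighted wt fY YF) (mesE mOmega fOmega mOmega)// -EFinM lee_fin.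
have FY := mem_fset_setF fY YF.
exact: family_le k0 (H _ (family_valid FY)).
Qed.

(** The full sum is finite by [weighted_sum_le], so a finite subfamily carries more than nine tenths
    of it; the sparse family is selected from that subfamily, and 10/9 pays for the rest. *)
Lemma weighted_sum_sparse (wt : nat -> nat -> R) (k k' : R) : 0 < k ->
  (forall m n, 0 <= wt m n) -> k * 8 * (10 / 9) = k' ->
  (forall C : config, valid C ->
    \sum_J wt (a J) (b J) * #|@rc C J|%:R <= k * #|shc C|%:R) ->
  exists G0 : set (rect S), [/\ G0 `<=` F, sparse 8^-1 G0 &
    (weighted_sum wt Omega F <= k'%:E * vol S (sh G0))%E].
Proof.
move=> k0 wt0 ek H; have le := weighted_sum_le (ltW k0) H.
have T0 : (0 <= weighted_sum wt Omega F)%E.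
  by apply: esum_ge0 => I _; rewrite mule_ge0 ?lee_fin.
have fT : weighted_sum wt Omega F \is a fin_num.
  rewrite ge0_fin_numE//; apply: le_lt_trans le _.
  by rewrite (mesE mOmega fOmega mOmega)// -EFinM ltry.
move: T0 fT; set T := weighted_sum _ _ _; move eT : T => [t| |]//.
rewrite lee_fin le_eqVlt => /predU1P[<- _|t0 _].
  (* When the sum is zero, no subfamily exceeds nine tenths of it strictly; the empty family
     serves. *)
  exists set0; split => //; first by exists (fun=> set0); split => // I J [].
  by rewrite mule_ge0// lee_fin -ek !mulr_ge0// ltW.
have : ((9 / 10 * t)%:E < T)%E by rewrite eT lte_fin; lra.
move=> /ereal_sup_gt[_ [Y [fY YF] <-]].
rewrite (fsum_weighted wt fY YF) lte_fin => lt.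
have FY := mem_fset_setF fY YF.
have [G0 [G0F spG leG]] := family_sparse (ltW k0) (H _ (family_valid FY)).
exists G0; split => //.
have : ((10 / 9)%:E * (9 / 10 * t)%:E <= (10 / 9)%:E * ((k * 8)%:E * vol S (sh G0)))%E.
  apply: lee_wpmul2l; first by rewrite lee_fin; lra.
  by apply: le_trans leG; rewrite lee_fin ltW.
have -> : ((10 / 9)%:E * (9 / 10 * t)%:E)%E = t%:E by rewrite -EFinM; congr EFin; field.
by rewrite muleA -EFinM mulrC ek.
Qed.

(** Monotone convergence, after the countable family is enumerated: [e n] is the rectangle with code
    n, and [P n] says that n is a code. *)
Lemma integral_weighted (wt : nat -> nat -> R) : (forall m n, 0 <= wt m n) ->
  (\int[vol S]_(x in Omega) (\esum_(I in F)
     (wt (e1 I Omega) (e2 I Omega) * \1_(rect_set I) x)%:E))%E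
  = weighted_sum wt Omega F.
Proof.
move=> wt0; have cF : countable F.
  by apply: sub_countable countableAR; apply: subset_card_le => r /Frect/rectanglesAR.
have [f finj] := countable_injP F cF.
have [->|/set0P[I0 FI0]] := eqVneq F set0.
  rewrite /weighted_sum esum_set0; under eq_integral do rewrite esum_set0.
  exact: integral0.
pose e n := xget I0 [set I | F I /\ f I = n].
have eK I : F I -> e (f I) = I.
  move=> FI; have [FJ eJ] : [set J | F J /\ f J = f I] (e (f I)) by apply: xgetI (conj FI erefl).
  by apply: finj => //; apply: mem_set.
pose P n := `[< (f @` F) n >].
have eF n : P n -> F (e n) by move=> /asboolP[I FI <-]; rewrite eK.
have series (u : rect S -> \bar R) : (forall I, F I -> 0 <= u I)%E ->
    (\esum_(I in F) u I = \sum_(n <oo) (if P n then u (e n) else 0))%E.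
  move=> u0; rewrite -eseries_mkcond nneseries_esum; last by move=> n /eF/u0.
  rewrite (_ : [set n | P n] = f @` F); last first.
    by apply/seteqP; split => n /asboolP.
  rewrite esum_image//; first by apply: eq_esum => I FI; rewrite eK.
rewrite /weighted_sum series; last by move=> I _; rewrite mule_ge0 ?lee_fin.
rewrite (eq_integral (fun x => \sum_(n <oo) (if P n then
    (wt (e1 (e n) Omega) (e2 (e n) Omega) * \1_(rect_set (e n)) x)%:E else 0)))%E; last first.
  by move=> x _; rewrite series// => I _; rewrite lee_fin mulr_ge0.
have me n : P n -> measurable (rect_set (e n)).
  by move=> /eF/Frect/rectanglesAR/rect_measurable.
rewrite integral_nneseries//; last 2 first.
- move=> n; case: (boolP (P n)) => Pn; last exact: measurable_cst.
  apply/measurable_EFinP; apply: measurable_funM; first exact: measurable_cst.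
  by apply: measurable_indic; apply: me.
- by move=> n x _; case: ifP => // _; rewrite lee_fin mulr_ge0.
apply: eq_eseriesr => n _; case: (boolP (P n)) => /= Pn; last exact: integral0.
under eq_integral do rewrite EFinM.
rewrite ge0_integralZl_EFin//; last first.
  by apply/measurable_EFinP; apply: measurable_indic; apply: me.
rewrite integral_indic//; last exact: me.
by rewrite setIidl//; apply: Fsub; apply: eF.
Qed.

End family.

(** If one exponent is zero, the other exceeds 1 and one direction is enough. If both are positive,
    the weight is dominated by some w_s with 0 < s < 1. *)
Lemma abstract_sufficient (alpha beta : R) : 0 <= alpha -> 0 <= beta ->
  1 <= alpha + beta -> (alpha, beta) <> (1, 0) -> (alpha, beta) <> (0, 1) ->
  exists C : R, forall Omega F, @admissible R S Omega F ->
    (weighted_sum (weight alpha beta) Omega F <= C%:E * vol S Omega)%E.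
Proof.
move=> a0 b0 ab n10 n01.
have [b00|bn0] := eqVneq beta 0.
  have a1 : 1 < alpha.
    rewrite lt_neqAle; apply/andP; split; last by rewrite -[alpha]addr0 -b00.
    by apply/eqP => e; apply: n10; rewrite b00 e.
  have [k kP] := one_sided_weight a1.
  have k0 : 0 <= k.
    have := kP _ (finset.set0 : {set unit}) (fun=> 0%N) (fun=> 0%N) (fun=> 0%N).
    by rewrite big_set0; apply => t; rewrite inE.
  exists (2%:R * k) => Omega F adm; apply: (weighted_sum_le adm).
    by rewrite mulr_ge0.
  move=> C vC; rewrite b00; apply: one_sided_estimate => //.
  by move=> m n; apply: weight_ge0.
have [a00|an0] := eqVneq alpha 0.
  have b1 : 1 < beta.
    rewrite lt_neqAle; apply/andP; split; last by rewrite -[beta]add0r -a00.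
    by apply/eqP => e; apply: n01; rewrite a00 e.
  have [k kP] := one_sided_weight b1.
  have k0 : 0 <= k.
    have := kP _ (finset.set0 : {set unit}) (fun=> 0%N) (fun=> 0%N) (fun=> 0%N).
    by rewrite big_set0; apply => t; rewrite inE.
  exists (2%:R * k) => Omega F adm; apply: (weighted_sum_le adm).
    by rewrite mulr_ge0.
  move=> C vC; have := @one_sided_estimate R (weight beta 0)
    (fun m n => weight_ge0 _ _ m n) (swap_config C) k (valid_swap vC) kP.
  rewrite card_shc_swap; apply: le_trans; rewrite le_eqVlt; apply/orP; left; apply/eqP.
  by apply: eq_bigr => J _; rewrite card_rc_swap a00; congr (_ * _); rewrite // /weight mulrC.
have [s [s01 sa sb]] : exists s : R, [/\ 0 < s < 1, s <= alpha & 1 - s <= beta].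
  have ap : 0 < alpha by rewrite lt0r an0.
  have bp : 0 < beta by rewrite lt0r bn0.
  have [ge1|lt1] := leP 1 alpha; last by exists alpha; split; rewrite ?ap//; lra.
  (* Here alpha >= 1, so only 1 - beta <= s < 1 and s > 0 matter; 1/2 keeps s positive, and beta > 0
     keeps it below 1. *)
  exists (Num.max (2^-1) (1 - beta)); split; last 2 first.
  - by rewrite ge_max; apply/andP; split; lra.
  - by rewrite lerBlDl -lerBlDr le_max lexx orbT.
  by rewrite lt_max gt_max; apply/andP; split; [apply/orP; left; lra|apply/andP; split; lra].
exists (72%:R * (4 / s + 4 / (1 - s))) => Omega F adm; apply: (weighted_sum_le adm).
  by move/andP: s01 => [s0 s1]; rewrite mulr_ge0// addr_ge0// divr_ge0//; lra.
move=> C vC; apply: le_trans (config_estimate (weight_ge0 s (1 - s)) vC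
  (weight_sum_bound s01) (weight_sum_bound_swap s01)).
by apply: ler_sum => J _; rewrite ler_wpM2r//; apply: weight_le.
Qed.

Lemma abstract_sparse (s : R) : 0 < s -> s < 1 ->
  forall Omega F, @admissible R S Omega F ->
  let w := weight s (1 - s) in
  let H x :=
    (\esum_(I in F) (w (e1 I Omega) (e2 I Omega) * \1_(rect_set I) x)%:E)%E in
  exists G0 : set (rect S),
    [/\ G0 `<=` F, sparse 8^-1 G0,
        (\int[vol S]_(x in Omega) H x = weighted_sum w Omega F)%E
      & (weighted_sum w Omega F
           <= (2560 / (s * (1 - s)))%:E * vol S (sh G0))%E].
Proof.
move=> s0 s1 Omega F adm w H; have s01 : 0 < s < 1 by rewrite s0.
have t0 : 0 < 1 - s by rewrite subr_gt0.
have w0 m n : 0 <= w m n by apply: weight_ge0.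
have [|||G0 [h1 h2 h3]] := @weighted_sum_sparse Omega F adm w
    (72%:R * (4 / s + 4 / (1 - s))) (2560 / (s * (1 - s))) _ w0.
- by rewrite mulr_gt0// addr_gt0// divr_gt0.
- by field; rewrite !gt_eqF.
- move=> C vC; exact: config_estimate w0 vC (weight_sum_bound s01) (weight_sum_bound_swap s01).
by exists G0; split => //; apply: integral_weighted.
Qed.

End abstract_setting.
(** * Necessity *)

Section necessity.
Variables (R : realType) (S : rectangle_setting R) (AR : set (rect S)).
Variable mk_model : forall rs : seq (rect S), (forall r, r \in rs -> AR r) -> model rs.
Hypothesis maximalAR : forall r : rect S, maximal_rectangles r -> AR r.

(** A rectangle with more than half of its volume in Q meets Q and cannot be longer than Q in any
    direction, as a longer factor would be at most half inside Q. Being laminar in each factor, it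
    is contained in Q. *)
Lemma rect_enlargement (Q : rect S) : AR Q ->
  enlargement (rect_set Q) `<=` rect_set Q.
Proof.
move=> AQ; have [vQ _] := rect_vol mk_model AQ.
have mQ := rect_measurable mk_model AQ.
have fQ : (vol S (rect_set Q) < +oo)%E by rewrite vQ ltry.
move=> x /(enlargementP mk_model maximalAR mQ fQ)[r [mr rx lt]].
have rsAR r' : r' \in [:: r; Q] -> AR r'.
  by rewrite !inE => /orP[/eqP ->|/eqP ->] //; apply: maximalAR.
have M := mk_model rsAR.
have i1 : r \in [:: r; Q] by rewrite !inE eqxx.
have i2 : Q \in [:: r; Q] by rewrite !inE eqxx orbT.
have eI : rect_set Q `&` rect_set r = cells (box M Q :&: box M r)%SET.
  rewrite (rect_cellsE M i1) (rect_cellsE M i2); apply/seteqP; split.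
    move=> z [[s /= sQ sz] [t /= tr tz]]; exists s => //=.
    rewrite finset.in_setI sQ/=; suff -> : s = t by [].
    by apply: (cell_trivIset M) => //; exists z.
  by move=> z [s /=]; rewrite finset.in_setI => /andP[sQ sr] sz; split; exists s.
move: lt; rewrite eI {1}(rect_cellsE M i1) !vol_cells/= mulrA ltr_pM2r ?cv_gt0//.
rewrite -natrM ltr_nat => lt.
have [[[y1 y2] y3] yI] : exists y, y \in (box M Q :&: box M r)%SET.
  by apply/set0Pn; rewrite -card_gt0; case: #|_| lt.
move: (yI); rewrite !finset.in_setI !finset.in_setX.
move=> /andP[/andP[/andP[Q1 Q2] Q3] /andP[/andP[r1 r2] r3]].
have eB : #|(box M Q :&: box M r)%SET| = (#|b1 M Q :&: b1 M r| * #|b2 M Q :&: b2 M r|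
    * #|b3 M Q :&: b3 M r|)%N.
  rewrite -!cardsX; apply: eq_card => -[[z1 z2] z3].
  rewrite !finset.in_setI !finset.in_setX !finset.in_setI.
  by do 6?[case: (_ \in _)].
have [g1 g2 g3] := N_gt1 M.
have [cr1 cr2 cr3] := card_b M i1; have [cQ1 cQ2 cQ3] := card_b M i2.
(* One level more multiplies the size of a factor by at least 2, as the bases exceed 1. *)
have small (n k l : nat) : (1 < n)%N -> (k < l)%N -> (2 * n ^ k <= n ^ l)%N.
  move=> n1 kl; apply: (@leq_trans (n ^ k.+1)%N); first by rewrite expnS leq_mul2r n1 orbT.
  by rewrite leq_exp2l.
have L1 : (l1 M r <= l1 M Q)%N.
  rewrite leqNgt; apply/negP => /(small _ _ _ g1) h; move: lt; apply/negP; rewrite -leqNgt.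
  rewrite eB !cardsX cr1 mulnA mulnA; apply: leq_mul; last by apply/subset_leq_card/finset.subsetIr.
  apply: leq_mul; last by apply/subset_leq_card/finset.subsetIr.
  apply: leq_trans h; rewrite leq_mul2l -cQ1/=; by rewrite subset_leq_card ?orbT// finset.subsetIl.
have L2 : (l2 M r <= l2 M Q)%N.
  rewrite leqNgt; apply/negP => /(small _ _ _ g2) h; move: lt; apply/negP; rewrite -leqNgt.
  rewrite eB !cardsX cr2 mulnA mulnCA; apply: leq_mul; last by apply/subset_leq_card/finset.subsetIr.
  apply: leq_mul; first by apply/subset_leq_card/finset.subsetIr.
  apply: leq_trans h; rewrite leq_mul2l -cQ2/=; by rewrite subset_leq_card ?orbT// finset.subsetIl.
have L3 : (l3 M r <= l3 M Q)%N.
  rewrite leqNgt; apply/negP => /(small _ _ _ g3) h; move: lt; apply/negP; rewrite -leqNgt.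
  rewrite eB !cardsX cr3 mulnCA; apply: leq_mul.
    by apply: leq_mul; apply/subset_leq_card/finset.subsetIr.
  apply: leq_trans h; rewrite leq_mul2l -cQ3/=; by rewrite subset_leq_card ?orbT// finset.subsetIl.
move: rx; rewrite (rect_cellsE M i1) (rect_cellsE M i2); apply: cells_sub.
apply/fintype.subsetP => -[[z1 z2] z3]; rewrite !finset.in_setX => /andP[/andP[h1 h2] h3].
rewrite (fintype.subsetP (lam1 i1 i2 r1 Q1 L1) _ h1).
rewrite (fintype.subsetP (lam2 i1 i2 r2 Q2 L2) _ h2).
by rewrite (fintype.subsetP (lam3 i1 i2 r3 Q3 L3) _ h3).
Qed.

Lemma max_nat_le (P : set nat) (N : nat) : (forall k, P k -> (k <= N)%N) ->
  (max_nat P <= N)%N.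
Proof. by move=> H; rewrite /max_nat; case: xgetP => // k _ [/H]. Qed.

(* The rectangles of F k have side lengths 2^k and 2^(n-k) (up to a common scale)
   and tile Q, which has side lengths 2^n. *)
Lemma tiling_bound (alpha beta C : R) (n : nat) (Q : rect S)
    (F : nat -> set (rect S)) :
  0 <= alpha -> 0 <= beta -> AR Q ->
  (forall k I, (k <= n)%N -> F k I -> rectangles I) ->
  (forall I : rect S, rectangles I -> AR I) ->
  (forall k, (k <= n)%N -> finite_set (F k)) ->
  (forall k, (k <= n)%N -> trivIset (F k) (@rect_set _ S)) ->
  (forall k, (k <= n)%N -> rect_set Q = \bigcup_(I in F k) rect_set I) ->
  (forall k k' I J, (k <= n)%N -> (k' <= n)%N -> F k I -> F k' J ->
     rect_set I `<=` rect_set J -> k = k' /\ I = J) ->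
  (forall k I j, (k <= n)%N -> F k I -> rect_set (up1 j I) `<=` rect_set Q -> (j <= n - k)%N) ->
  (forall k I j, (k <= n)%N -> F k I -> rect_set (up2 j I) `<=` rect_set Q -> (j <= k)%N) ->
  (forall Omega U, @admissible R S Omega U ->
    (weighted_sum (weight alpha beta) Omega U <= C%:E * vol S Omega)%E) ->
  \sum_(k < n.+1) weight alpha beta (n - k) k <= C.
Proof.
move=> a0 b0 AQ Frect rAR Ffin Ftr Fcov Finc Fup1 Fup2 H.
have [vQ Q0] := rect_vol mk_model AQ; have mQ := rect_measurable mk_model AQ.
(* Cut off beyond n, so that the families are pairwise disjoint over all k. *)
pose F' k := if (k <= n)%N then F k else set0.
have F'E k : (k <= n)%N -> F' k = F k by rewrite /F' => ->.
pose V := \bigcup_(k in `I_n.+1) F' k.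
have fV : finite_set V by apply: bigcup_finite => // k /=; rewrite ltnS => kn; rewrite F'E//; apply: Ffin.
have admV : admissible (rect_set Q) V.
  split => //; first by rewrite vQ ltry.
  - by move=> I [k /=]; rewrite ltnS => kn; rewrite F'E// => FI; apply: Frect FI.
  - by move=> I [k /=]; rewrite ltnS => kn; rewrite F'E// => FI; rewrite (Fcov _ kn); apply: bigcup_sup.
  - move=> I J [k /=]; rewrite ltnS => kn; rewrite F'E// => FI [k' /=]; rewrite ltnS => kn'; rewrite F'E// => FJ sub.
    by have [_ ->] := Finc _ _ _ _ kn kn' FI FJ sub.
have := H _ _ admV; rewrite vQ -EFinM => le.
rewrite -(ler_pM2r Q0) -lee_fin; apply: le_trans le.
have trF : trivIset setT F'.
  move=> k k' _ _ [I []]; rewrite /F'; case: ifP => // kn FI; case: ifP => // kn' FI'.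
  by have [] := Finc _ _ _ _ kn kn' FI FI' (@subset_refl _ _).
have w0 I : (0 <= (weight alpha beta (e1 I (rect_set Q)) (e2 I (rect_set Q)))%:E *
    vol S (rect_set I))%E by rewrite mule_ge0// lee_fin weight_ge0.
rewrite /weighted_sum esum_bigcupT//.
rewrite esum_fset; [|exact: finite_II|by move=> k _; apply: esum_ge0].
rewrite -fsbig_ord mulr_suml -sumEFin.
apply: lee_sum => k _; have kn : (k <= n)%N by rewrite -ltnS.
have vF : vol S (rect_set Q) = (\sum_(I \in F k) vol S (rect_set I))%E.
  rewrite (Fcov _ kn) measure_fin_bigcup//.
  - exact: Ffin.
  - exact: Ftr.
  - by move=> I FI; apply: (rect_measurable mk_model); apply: rAR; apply: Frect FI.
rewrite F'E// EFinM -vQ vF esum_fset; [|exact: Ffin|by move=> I _; apply: w0].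
rewrite ge0_mule_fsumr; last by move=> I; apply: measure_ge0.
apply: lee_fsum => [|I FI]; first exact: Ffin.
apply: lee_wpmul2r => //; rewrite lee_fin.
(* Ancestors in the enlargement of Q stay in Q, so e_1 <= n - k and e_2 <= k, and the weights only
   increase when these bounds are replaced by the true values. *)
have sQ := rect_enlargement AQ.
have le1 : (e1 I (rect_set Q) <= n - k)%N.
  by apply: max_nat_le => j /= sub; apply: (Fup1 _ _ _ kn FI); apply: subset_trans sub sQ.
have le2 : (e2 I (rect_set Q) <= k)%N.
  by apply: max_nat_le => j /= sub; apply: (Fup2 _ _ _ kn FI); apply: subset_trans sub sQ.
by apply: ler_pM; rewrite ?powR_ge0//; apply: powRN_nonincreasing => //;
  rewrite ltr0n ler_nat ltnS.
Qed.

End necessity.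

(** * Verification in the bi-parameter and Zygmund settings *)

Lemma setX_subset (T1 T2 : Type) (X1 Y1 : set T1) (X2 Y2 : set T2) x1 x2 :
  X1 x1 -> X2 x2 -> X1 `*` X2 `<=` Y1 `*` Y2 -> X1 `<=` Y1 /\ X2 `<=` Y2.
Proof.
move=> h1 h2 sub; split=> [y hy|y hy].
  by have [] := sub (y, x2) (conj hy h2).
by have [] := sub (x1, y) (conj h1 hy).
Qed.

Lemma grid_sub_eq (R : realType) (d : nat) (D : set (cube R d)) (P Q : cube R d) :
  dyadic_grid D -> D P -> D Q -> P.1 = Q.1 -> cube_set P `<=` cube_set Q -> P = Q.
Proof.
move=> gD DP DQ e sub.
exact: (grid_eq gD DP DQ e (cube_corner P) (sub _ (cube_corner P))).
Qed.

Section settings.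
Variables (R : realType) (d1 d2 d3 : nat).
Hypotheses (d1_gt0 : (0 < d1)%N) (d2_gt0 : (0 < d2)%N) (d3_gt0 : (0 < d3)%N).
Variables (D1 : set (cube R d1)) (D2 : set (cube R d2)) (D3 : set (cube R d3)).
Hypotheses (gridD1 : dyadic_grid D1) (gridD2 : dyadic_grid D2)
  (gridD3 : dyadic_grid D3).

Lemma biparameter_up1 k (r : rect (biparameter_setting D1 D2)) : rectangles r ->
  maximal_rectangles (up1 k r).
Proof. by move=> [h1 h2]; split => //=; case: (ancestorP d1_gt0 gridD1 k h1). Qed.

Lemma biparameter_up2 k (r : rect (biparameter_setting D1 D2)) : rectangles r ->
  maximal_rectangles (up2 k r).
Proof. by move=> [h1 h2]; split => //=; case: (ancestorP d2_gt0 gridD2 k h2). Qed.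

Lemma side_ancestor d (D : set (cube R d)) k Q : (0 < d)%N -> dyadic_grid D -> D Q ->
  side Q <= side (ancestor D k Q).
Proof.
by move=> d0 gD DQ; have [_ e _] := ancestorP d0 gD k DQ; rewrite ler_side e lerDl.
Qed.

(** Lengthening one of the first two sides can break the equality between the sides but preserves
    the inequality that defines the collection of the maximal function. *)
Lemma zygmund_up1 k (r : rect (zygmund_setting D1 D2 D3)) : rectangles r ->
  maximal_rectangles (up1 k r).
Proof.
move=> [[[h1 h2] h3] e]; split; first by split => //; split => //=; case: (ancestorP d1_gt0 gridD1 k h1).
by rewrite /= e ler_pM2r ?side_gt0// side_ancestor.
Qed.

Lemma zygmund_up2 k (r : rect (zygmund_setting D1 D2 D3)) : rectangles r ->
  maximal_rectangles (up2 k r).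
Proof.
move=> [[[h1 h2] h3] e]; split; first by split => //; split => //=; case: (ancestorP d2_gt0 gridD2 k h2).
by rewrite /= e ler_pM2l ?side_gt0// side_ancestor.
Qed.

Lemma biparameter_necessity (alpha beta C : R) : 0 <= alpha -> 0 <= beta ->
  (forall Omega U, @admissible R (biparameter_setting D1 D2) Omega U ->
    (weighted_sum (weight alpha beta) Omega U <= C%:E * vol _ Omega)%E) ->
  [/\ 1 <= alpha + beta, (alpha, beta) <> (1, 0) & (alpha, beta) <> (0, 1)].
Proof.
move=> a0 b0 H; apply: (weight_antidiagonal (C := C) a0 b0) => n.
have [Q1 [DQ1 l1 _]] := grid_at gridD1 n%:Z [tuple of nseq d1 (0 : measurableTypeR R)].
have [Q2 [DQ2 l2 _]] := grid_at gridD2 n%:Z [tuple of nseq d2 (0 : measurableTypeR R)].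
pose S := biparameter_setting D1 D2.
pose F k : set (rect S) := subcubes D1 k%:Z Q1 `*` subcubes D2 (n - k)%N%:Z Q2.
have hr k (I : rect S) : (k <= n)%N -> F k I -> rectangles I by move=> _ [[? _ _] [? _ _]].
have hfin k : (k <= n)%N -> finite_set (F k).
  by move=> _; apply: finite_setX; apply: finite_subcubes.
have htr k : (k <= n)%N -> trivIset (F k) (@rect_set _ S).
  move=> _ [I1 I2] [J1 J2] [/= hI1 hI2] [/= hJ1 hJ2] [[x1 x2] [[/= p1 p2] [/= q1 q2]]].
  rewrite (trivIset_subcubes gridD1 hI1 hJ1); last by exists x1.
  by rewrite (trivIset_subcubes gridD2 hI2 hJ2)//; exists x2.
have hcov k : (k <= n)%N -> rect_set ((Q1, Q2) : rect S) = \bigcup_(I in F k) rect_set I.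
  move=> kn; have k1 : k%:Z <= Q1.1 by rewrite l1 lez_nat.
  have k2 : (n - k)%N%:Z <= Q2.1 by rewrite l2 lez_nat leq_subr.
  apply/seteqP; split => -[x1 x2].
    move=> [/=]; rewrite {1}(cube_subcubes d1_gt0 gridD1 DQ1 k1).
    rewrite (cube_subcubes d2_gt0 gridD2 DQ2 k2) => -[P1 h1 p1] [P2 h2 p2].
    by exists (P1, P2).
  by move=> [[P1 P2] [/= [_ _ s1] [_ _ s2]] [/= p1 p2]]; split => /=; [exact: s1|exact: s2].
have hinc k k' (I J : rect S) : (k <= n)%N -> (k' <= n)%N -> F k I -> F k' J ->
    rect_set I `<=` rect_set J -> k = k' /\ I = J.
  case: I J => [I1 I2] [J1 J2] kn kn' [/= [DI1 lI1 _] [DI2 lI2 _]] [/= [DJ1 lJ1 _] [DJ2 lJ2 _]].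
  move=> /(setX_subset (cube_corner I1) (cube_corner I2))[s1 s2].
  have kk : k = k'.
    have := cube_sub_level d1_gt0 s1; have := cube_sub_level d2_gt0 s2.
    by rewrite lI1 lI2 lJ1 lJ2; move: kn kn'; clear; lia.
  split => //; rewrite (grid_sub_eq gridD1 DI1 DJ1 _ s1); last by rewrite lI1 lJ1 kk.
  by rewrite (grid_sub_eq gridD2 DI2 DJ2 _ s2)// lI2 lJ2 kk.
have hup1 k (I : rect S) j : (k <= n)%N -> F k I ->
    rect_set (up1 j I) `<=` rect_set ((Q1, Q2) : rect S) -> (j <= n - k)%N.
  case: I => [I1 I2] kn [/= [DI lI _] _].
  move=> /(setX_subset (cube_corner _) (cube_corner I2))[/(cube_sub_level d1_gt0) + _].
  by have [_ -> _] := ancestorP d1_gt0 gridD1 j DI; rewrite lI l1; move: kn; clear; lia.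
have hup2 k (I : rect S) j : (k <= n)%N -> F k I ->
    rect_set (up2 j I) `<=` rect_set ((Q1, Q2) : rect S) -> (j <= k)%N.
  case: I => [I1 I2] kn [/= _ [DI lI _]].
  move=> /(setX_subset (cube_corner I1) (cube_corner _))[_ /(cube_sub_level d2_gt0)].
  by have [_ -> _] := ancestorP d2_gt0 gridD2 j DI; rewrite lI l2; move: kn; clear; lia.
exact: (@tiling_bound R S (D1 `*` D2)
  (@biparameter_model R d1 d2 d1_gt0 d2_gt0 D1 D2 gridD1 gridD2) (fun _ h => h)
  alpha beta C n (Q1, Q2) F a0 b0 (conj DQ1 DQ2) hr (fun _ h => h) hfin htr hcov
  hinc hup1 hup2 H).
Qed.

Lemma zygmund_necessity (alpha beta C : R) : 0 <= alpha -> 0 <= beta ->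
  (forall Omega U, @admissible R (zygmund_setting D1 D2 D3) Omega U ->
    (weighted_sum (weight alpha beta) Omega U <= C%:E * vol _ Omega)%E) ->
  [/\ 1 <= alpha + beta, (alpha, beta) <> (1, 0) & (alpha, beta) <> (0, 1)].
Proof.
move=> a0 b0 H; apply: (weight_antidiagonal (C := C) a0 b0) => n.
have [Q1 [DQ1 l1 _]] := grid_at gridD1 n%:Z [tuple of nseq d1 (0 : measurableTypeR R)].
have [Q2 [DQ2 l2 _]] := grid_at gridD2 n%:Z [tuple of nseq d2 (0 : measurableTypeR R)].
have [Q3 [DQ3 l3 _]] := grid_at gridD3 n%:Z [tuple of nseq d3 (0 : measurableTypeR R)].
pose S := zygmund_setting D1 D2 D3.
(* The third factor is kept equal to [Q3], of level n, because 2^k 2^(n-k) = 2^n; all shapes are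
   then Zygmund rectangles. *)
pose F k : set (rect S) :=
  subcubes D1 k%:Z Q1 `*` subcubes D2 (n - k)%N%:Z Q2 `*` [set Q3].
have hr k (I : rect S) : (k <= n)%N -> F k I -> rectangles I.
  case: I => [[I1 I2] I3] kn [/= [[DI1 lI1 _] [DI2 lI2 _]] ->]; split => //=.
  by rewrite /side l3 lI1 lI2 -expfzDr ?pnatr_eq0// -PoszD subnKC.
have hfin k : (k <= n)%N -> finite_set (F k).
  move=> _; apply: finite_setX; last exact: finite_set1.
  by apply: finite_setX; apply: finite_subcubes.
have htr k : (k <= n)%N -> trivIset (F k) (@rect_set _ S).
  move=> _ [[I1 I2] I3] [[J1 J2] J3] [/= [/= hI1 hI2] ->] [/= [/= hJ1 hJ2] ->].
  move=> [[[x1 x2] x3] [[[/= p1 p2] _] [[/= q1 q2] _]]].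
  rewrite (trivIset_subcubes gridD1 hI1 hJ1); last by exists x1.
  by rewrite (trivIset_subcubes gridD2 hI2 hJ2)//; exists x2.
have hcov k : (k <= n)%N -> rect_set ((Q1, Q2, Q3) : rect S) = \bigcup_(I in F k) rect_set I.
  move=> kn; have k1 : k%:Z <= Q1.1 by rewrite l1 lez_nat.
  have k2 : (n - k)%N%:Z <= Q2.1 by rewrite l2 lez_nat leq_subr.
  apply/seteqP; split => -[[x1 x2] x3].
    move=> [/= [/=]]; rewrite {1}(cube_subcubes d1_gt0 gridD1 DQ1 k1).
    rewrite {1}(cube_subcubes d2_gt0 gridD2 DQ2 k2) => -[P1 h1 p1] [P2 h2 p2] q3.
    by exists (P1, P2, Q3).
  move=> [[[P1 P2] P3] [/= [[_ _ s1] [_ _ s2]] ->] [/= [p1 p2] p3]].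
  by split => //; split => /=; [exact: s1|exact: s2].
have hinc k k' (I J : rect S) : (k <= n)%N -> (k' <= n)%N -> F k I -> F k' J ->
    rect_set I `<=` rect_set J -> k = k' /\ I = J.
  case: I J => [[I1 I2] I3] [[J1 J2] J3] kn kn'.
  move=> [/= [[DI1 lI1 _] [DI2 lI2 _]] ->] [/= [[DJ1 lJ1 _] [DJ2 lJ2 _]] ->].
  move=> /(setX_subset (conj (cube_corner I1) (cube_corner I2) :
    (cube_set I1 `*` cube_set I2) (_, _)) (cube_corner Q3))[+ _].
  move=> /(setX_subset (cube_corner I1) (cube_corner I2))[s1 s2].
  have kk : k = k'.
    have := cube_sub_level d1_gt0 s1; have := cube_sub_level d2_gt0 s2.
    by rewrite lI1 lI2 lJ1 lJ2; move: kn kn'; clear; lia.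
  split => //; rewrite (grid_sub_eq gridD1 DI1 DJ1 _ s1); last by rewrite lI1 lJ1 kk.
  by rewrite (grid_sub_eq gridD2 DI2 DJ2 _ s2)// lI2 lJ2 kk.
have hup1 k (I : rect S) j : (k <= n)%N -> F k I ->
    rect_set (up1 j I) `<=` rect_set ((Q1, Q2, Q3) : rect S) -> (j <= n - k)%N.
  case: I => [[I1 I2] I3] kn [/= [[DI lI _] _] _].
  move=> /(setX_subset (conj (cube_corner (ancestor D1 j I1)) (cube_corner I2) :
    (cube_set _ `*` cube_set I2) (_, _)) (cube_corner I3))[+ _].
  move=> /(setX_subset (cube_corner _) (cube_corner I2))[/(cube_sub_level d1_gt0) + _].
  by have [_ -> _] := ancestorP d1_gt0 gridD1 j DI; rewrite lI l1; move: kn; clear; lia.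
have hup2 k (I : rect S) j : (k <= n)%N -> F k I ->
    rect_set (up2 j I) `<=` rect_set ((Q1, Q2, Q3) : rect S) -> (j <= k)%N.
  case: I => [[I1 I2] I3] kn [/= [_ [DI lI _]] _].
  move=> /(setX_subset (conj (cube_corner I1) (cube_corner (ancestor D2 j I2)) :
    (cube_set I1 `*` cube_set _) (_, _)) (cube_corner I3))[+ _].
  move=> /(setX_subset (cube_corner I1) (cube_corner _))[_ /(cube_sub_level d2_gt0)].
  by have [_ -> _] := ancestorP d2_gt0 gridD2 j DI; rewrite lI l2; move: kn; clear; lia.
exact: (@tiling_bound R S (D1 `*` D2 `*` D3)
  (@zygmund_model R d1 d2 d3 d1_gt0 d2_gt0 d3_gt0 D1 D2 D3 gridD1 gridD2 gridD3)
  (fun _ h => h.1) alpha beta C n (Q1, Q2, Q3) F a0 b0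
  (conj (conj DQ1 DQ2) DQ3) hr (fun _ h => h.1) hfin htr hcov hinc hup1 hup2 H).
Qed.

End settings.

Theorem corollary1p2 (R : realType) (d1 d2 d3 : nat)
    (d1_gt0 : (0 < d1)%N) (d2_gt0 : (0 < d2)%N) (d3_gt0 : (0 < d3)%N)
    (D1 : set (cube R d1)) (D2 : set (cube R d2)) (D3 : set (cube R d3))
    (gridD1 : dyadic_grid D1) (gridD2 : dyadic_grid D2)
    (gridD3 : dyadic_grid D3)
    (S : rectangle_setting R)
    (hS : S = biparameter_setting D1 D2 \/ S = zygmund_setting D1 D2 D3) :
  (forall alpha beta : R, 0 <= alpha -> 0 <= beta ->
    (exists C : R, forall Omega U, @admissible R S Omega U ->
       (weighted_sum (weight alpha beta) Omega U <= C%:E * vol S Omega)%E)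
    <->
    [/\ 1 <= alpha + beta, (alpha, beta) <> (1, 0) & (alpha, beta) <> (0, 1)])
  /\
  (forall s : R, 0 < s -> s < 1 ->
    forall Omega U, @admissible R S Omega U ->
    let w := weight s (1 - s) in
    let H x :=
      (\esum_(I in U) (w (e1 I Omega) (e2 I Omega) * \1_(rect_set I) x)%:E)%E in
    exists G0 : set (rect S),
      [/\ G0 `<=` U, sparse 8^-1 G0,
          (\int[vol S]_(x in Omega) H x = weighted_sum w Omega U)%E
        & (weighted_sum w Omega U
             <= (2560 / (s * (1 - s)))%:E * vol S (sh G0))%E]).

Proof.
case: hS => ->.
  have mk := @biparameter_model R d1 d2 d1_gt0 d2_gt0 D1 D2 gridD1 gridD2.
  have cnt := countableX (countable_grid gridD1) (countable_grid gridD2).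
  split=> [alpha beta a0 b0|].
    split=> [[C]|[]]; first exact: biparameter_necessity.
    exact: (@abstract_sufficient R (biparameter_setting D1 D2) (D1 `*` D2) mk
      (fun _ h => h) (fun _ h => h) (biparameter_up1 d1_gt0 gridD1)
      (biparameter_up2 d2_gt0 gridD2) cnt).
  exact: (@abstract_sparse R (biparameter_setting D1 D2) (D1 `*` D2) mk
    (fun _ h => h) (fun _ h => h) (biparameter_up1 d1_gt0 gridD1)
    (biparameter_up2 d2_gt0 gridD2) cnt).
have mk := @zygmund_model R d1 d2 d3 d1_gt0 d2_gt0 d3_gt0 D1 D2 D3 gridD1 gridD2 gridD3.
have cnt := countableX (countableX (countable_grid gridD1) (countable_grid gridD2))
  (countable_grid gridD3).
split=> [alpha beta a0 b0|].
  split=> [[C]|[]]; first exact: zygmund_necessity.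
  exact: (@abstract_sufficient R (zygmund_setting D1 D2 D3) (D1 `*` D2 `*` D3) mk
    (fun _ h => h.1) (fun _ h => h.1) (@zygmund_up1 R d1 d2 d3 d1_gt0 D1 D2 D3 gridD1)
    (@zygmund_up2 R d1 d2 d3 d2_gt0 D1 D2 D3 gridD2) cnt).
exact: (@abstract_sparse R (zygmund_setting D1 D2 D3) (D1 `*` D2 `*` D3) mk
  (fun _ h => h.1) (fun _ h => h.1) (@zygmund_up1 R d1 d2 d3 d1_gt0 D1 D2 D3 gridD1)
  (@zygmund_up2 R d1 d2 d3 d2_gt0 D1 D2 D3 gridD2) cnt).
Qed.
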